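(* Let $M=(M^{2m+1};\varphi,\xi,\eta,g)\in\mathcal A_7^a$, that is, $M$ is an almost semi-Sasakian manifold, and let $f:M\to N$ be a $(\pm)$-holomorphic map. (1) If $N\in\mathcal B_1\cup\mathcal C_1$, then $f$ is harmonic. (2) If $N\in\mathcal B_3$, then there is no non-constant $(\pm)$-holomorphic harmonic map from $M$ into $N$. (3) Let $N=(N^{2n+1};\phi,\gamma,\sigma,h)\in\mathcal A_3$, that is, $N$ is a trans-Sasakian manifold of type $(\wp,\theta)$ with $2n\wp=\delta\Omega_N(\gamma)$ and $2n\theta=-\delta\sigma$ both nowhere zero on $N$. Then: (i) $f$ is harmonic if and only if $n\,d\lambda(\xi)+(\delta\sigma)\sum_{i=1}^mh(E_i,E_i)=0$. (ii) Any two of the following imply the third: $f$ is harmonic; $\lambda$ is constant along $\xi$, that is, $d\lambda(\xi)=0$; $f$ is constant along $D^M$. (iii) There is no non-constant $(\pm)$-holomorphic weakly conformal harmonic map from $M$ into $N$. (iv) When $m>n$, any $(\pm)$-holomorphic horizontally weakly conformal $f$ is harmonic (and therefore a harmonic morphism) if and only if $d\lambda(\xi)+(\delta\sigma)\lambda^2=0$. Suppose further that either $f$ has minimal fibres or $M$ is also normal (i.e. $M\in\mathcal A_7\subset\mathcal A_7^a$); then $f$ is a harmonic morphism if and only if it is constant. (4) Let $N\in\mathcal A_1\cup\mathcal A_4$. Then: (i) $f$ is harmonic if and only if $\lambda$ is constant along $\xi$ (that is, $d\lambda(\xi)=0$). (ii) If $M$ is also normal (i.e. $M\in\mathcal A_7\subset\mathcal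 A_7^a$), then $f$ is harmonic. In particular, every $(\pm)$-holomorphic map from a semi-Sasakian manifold into an $\alpha$-Sasakian one is harmonic with $\lambda$ constant. (iii) If $f$ is also weakly conformal, then it is homothetic and harmonic. (iv) When $m\le n$, for a $(\pm)$-holomorphic weakly conformal $f$ from $M$ into $N$ the following are equivalent: $f$ is harmonic; $\lambda$ is constant and therefore $f$ is homothetic; $\lambda$ is constant along $\xi$. Further, if any one of these holds, then $f$ has a minimal image.
   Context: Manifolds and maps are smooth; $\nabla$ denotes Levi-Civita connections. An almost contact metric manifold $M=(M^{2m+1};\varphi,\xi,\eta,g)$ is a $(2m+1)$-dimensional Riemannian manifold with a $(1,1)$-tensor $\varphi$, a vector field $\xi$ and a 1-form $\eta$ such that $\varphi^2X=-X+\eta(X)\xi$, $\eta(\xi)=1$, $g(\varphi X,\varphi Y)=g(X,Y)-\eta(X)\eta(Y)$. Put $D^M=\varphi(TM)=\ker\eta$, $\Omega(X,Y)=\Omega_M(X,Y)=g(X,\varphi Y)$, $P(X,Y)=(\nabla_X\varphi)Y+(\nabla_{\varphi X}\varphi)\varphi Y$, $W_X=\nabla_XX+\nabla_{\varphi X}(\varphi X)$, $2\mathfrak h=\mathcal L_\xi\varphi$. Conventions: $2d\eta(X,Y)=X\eta(Y)-Y\eta(X)-\eta([X,Y])$; $d\Omega(X,Y,Z)$ is the cyclic sum of $(\nabla_X\Omega)(Y,Z)$ and $(\eta\wedge\Omega)(X,Y,Z)$ the cyclic sum of $\eta(X)\Omega(Y,Z)$; $\{e_i;\varphi e_i;\xi\}_{1\le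 i\le m}$ is any local orthonormal frame; $\delta\eta=\eta(\sum_iW_{e_i})=-\operatorname{div}\xi$; $\delta\Omega(X)=g(-\varphi(\nabla_\xi\xi)+\sum_iP(e_i,e_i),X)$. $M$ is normal if $[\varphi,\varphi]+2d\eta\otimes\xi=0$, where $[\varphi,\varphi](X,Y)=\varphi^2[X,Y]+[\varphi X,\varphi Y]-\varphi[\varphi X,Y]-\varphi[X,\varphi Y]$. Classes. $\mathcal A_7^a$: almost semi-Sasakian manifolds ($\delta\Omega=2m\eta$); $\mathcal A_7$: semi-Sasakian manifolds (almost semi-Sasakian and normal). $\mathcal A_1$: $\alpha$-contact metric manifolds ($d\eta=\alpha\Omega$, $\alpha\neq0$ a real constant); quasi-contact metric manifolds ($P(X,Y)=2g(X,Y)\xi-\eta(Y)\{X+\eta(X)\xi+\mathfrak hX\}$); quasi-$\mathcal K$-Sasakian manifolds ($P(X,Y)=2g(X,Y)\xi-2\eta(Y)X+\eta(Y)\nabla_{\varphi X}\xi$); strongly pseudoconvex CR-manifolds ($d\eta=\Omega$ and $(\nabla_X\varphi)Y=g(X+\mathfrak hX,Y)\xi-\eta(Y)(X+\mathfrak hX)$); $\alpha$-Sasakian manifolds ($d\eta=\alpha\Omega$, $\alpha\neq0$ constant, and normal). $\mathcal A_3$: trans-Sasakian manifolds of type $(\wp,\theta)$: normal with $(\nabla_X\varphi)Y=\wp\{g(X,Y)\xi-\eta(Y)X\}+\theta\{g(\varphi X,Y)\xi-\eta(Y)\varphi X\}$, where $2m\wp=\delta\Omega(\xi)$, $2m\theta=-\delta\eta$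 and $\wp,\theta$ vanish nowhere. $\mathcal A_4$: quasi-Sasakian manifolds (normal, $d\Omega=0$, and $\eta\wedge(d\eta)^r\neq0$, $(d\eta)^{r+1}=0$ for some $1\le r\le m-1$). $\mathcal B_1$: cosymplectic ($d\eta=0$, $d\Omega=0$, normal), almost cosymplectic ($d\eta=0$, $d\Omega=0$), nearly cosymplectic ($(\nabla_X\varphi)X=0$), nearly-$\mathcal K$-cosymplectic ($(\nabla_X\varphi)X=0$ and $(\nabla_X\varphi)\xi=0$), quasi-$\mathcal K$-cosymplectic ($P(X,Y)=\eta(Y)\nabla_{\varphi X}\xi$) manifolds. $\mathcal B_3$: almost $\beta$-Kenmotsu manifolds ($d\Omega=2\beta\,\eta\wedge\Omega$, $d\eta=0$, $d\beta\wedge\eta=0$ for a nowhere vanishing smooth function $\beta$), including the $\beta$-Kenmotsu (normal) and the CR-integrable ($(\nabla_X\varphi)Y=g(\mathfrak hX,Y)\xi-\eta(Y)\mathfrak hX+\beta\{g(\varphi X,Y)\xi-\eta(Y)\varphi X\}$) ones. $\mathcal C_1$: almost Hermitian manifolds $(H;J,G)$ that are Kähler ($\nabla J=0$), nearly Kähler ($(\nabla_XJ)X=0$), almost Kähler ($d\Phi=0$, $\Phi(X,Y)=G(X,JY)$) or quasi-Kähler ($(\nabla_{JX}J)X-(\nabla_XJ)JX=0$). An almost contact metric target is written $N=(N^{2n+1};\phi,\gamma,\sigma,h)$, with the same notions for $(\phi,\gamma,\sigma,h,n)$ (in particular $\Omega_N(X,Y)=h(X,\phi Y)$); functions on $N$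 such as $\delta\sigma$ are evaluated along $f$. $f$ is $(\pm)$-holomorphic if $f_*\varphi=\pm\psi f_*$ (one fixed sign), with $\psi=\phi$, resp. $\psi=J$ for an almost Hermitian target. For an almost contact metric target, $\lambda\in C^\infty(M)$ is the function with $f_*\xi=\lambda\gamma$ (it exists for $(\pm)$-holomorphic $f$); $E_i=f_*e_i$. $f$ is constant along $D^M$ if $f_*X=0$ for all $X\in\Gamma(D^M)$; harmonic if its tension field vanishes. $f$ is weakly conformal if $h(f_*X,f_*Y)=\mu^2g(X,Y)$ for all $X,Y$ and some function $\mu\ge0$, homothetic if moreover $\mu$ is constant. $f$ is horizontally weakly conformal if for some function $\mu\ge0$, $h(f_*X,f_*Y)=\mu(p)^2g(X,Y)$ for all $p$ and $X,Y\in\mathcal H_p=(\ker f_{*p})^\perp$, and $f_{*p}:\mathcal H_p\to T_{f(p)}N$ is surjective where $\mu(p)>0$. A harmonic morphism is a harmonic horizontally weakly conformal map.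
   Formalization: M is assumed connected and m ≥ 1: on a disconnected M a locally constant map with two values is harmonic, ±-holomorphic and non-constant, so the constancy and homothety claims fail; the harmonicity criteria for disconnected M follow on each component. *)

(* Defs.v *)
(* Differential geometry in charts over MathComp-Analysis.  A manifold is a
   topological space with a smooth atlas, and a tensor field is the family of
   its component functions in the charts, subject to the transformation laws.
   Vectors are row vectors, and endomorphisms act on them on the right. *)
From HB Require Import structures.
From mathcomp Require Import all_boot all_order all_algebra all_fingroup.
From mathcomp Require Import all_classical all_reals all_analysis.

Set Implicit Arguments.
Unset Strict Implicit.
Unset Printing Implicit Defensive.

Import Order.TTheory GRing.Theory Num.Theory.
Import numFieldNormedType.Exports.

Local Open Scope classical_set_scope.
Local Open Scope ring_scope.

Section Calculus.
Context {R : realType} {d : nat}.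

Definition coord (i : 'I_d) : 'rV[R]_d := delta_mx 0 i.

Definition iter_partial {W : normedModType R} (s : seq 'I_d)
    (f : 'rV[R]_d -> W) : 'rV[R]_d -> W :=
  foldr (fun i h => fun x => 'D_(coord i) h x) f s.

(* C^infinity on the open set U: all iterated partial derivatives exist and are
   continuous on U. *)
Definition smooth_on {W : normedModType R} (U : set 'rV[R]_d)
    (f : 'rV[R]_d -> W) : Prop :=
  forall (s : seq 'I_d) (x : 'rV[R]_d), U x ->
    {for x, continuous (iter_partial s f)} /\
    forall i, derivable (iter_partial s f) x (coord i).

Definition lie_bracket (X Y : 'rV[R]_d -> 'rV[R]_d) : 'rV[R]_d -> 'rV[R]_d :=
  fun x => 'D_(X x) Y x - 'D_(Y x) X x.

Definition dird (X : 'rV[R]_d -> 'rV[R]_d) (u : 'rV[R]_d -> R) : 'rV[R]_d -> R :=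
  fun x => 'D_(X x) u x.

Definition appl (A : 'rV[R]_d -> 'M[R]_d) (X : 'rV[R]_d -> 'rV[R]_d) :
    'rV[R]_d -> 'rV[R]_d :=
  fun x => X x *m A x.

(* [A, A](X, Y) = A^2 [X, Y] + [A X, A Y] - A [A X, Y] - A [X, A Y] *)
Definition nijenhuis (A : 'rV[R]_d -> 'M[R]_d) (X Y : 'rV[R]_d -> 'rV[R]_d) :
    'rV[R]_d -> 'rV[R]_d :=
  appl A (appl A (lie_bracket X Y)) + lie_bracket (appl A X) (appl A Y)
  - appl A (lie_bracket (appl A X) Y) - appl A (lie_bracket X (appl A Y)).

End Calculus.

Section LocalRiemann.
Context {R : realType} {d : nat}.
Variable g : 'rV[R]_d -> 'M[R]_d.

Definition ip (x v w : 'rV[R]_d) : R := (v *m g x *m w^T) 0 0.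

Definition riemannian_on (U : set 'rV[R]_d) : Prop :=
  smooth_on U g /\
  forall x, U x -> (g x)^T = g x /\ forall v, v != 0 -> 0 < ip x v v.

Definition christoffel (x : 'rV[R]_d) (i j k : 'I_d) : R :=
  2^-1 * \sum_(l < d) invmx (g x) k l *
    ('D_(coord i) (fun y => g y j l) x + 'D_(coord j) (fun y => g y i l) x
     - 'D_(coord l) (fun y => g y i j) x).

Definition gamma (x v w : 'rV[R]_d) : 'rV[R]_d :=
  \row_k \sum_(i < d) \sum_(j < d) v 0 i * w 0 j * christoffel x i j k.

Definition nabla (X Y : 'rV[R]_d -> 'rV[R]_d) : 'rV[R]_d -> 'rV[R]_d :=
  fun x => 'D_(X x) Y x + gamma x (X x) (Y x).

Definition divergence (X : 'rV[R]_d -> 'rV[R]_d) : 'rV[R]_d -> R :=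
  fun x => \sum_(i < d) (nabla (fun=> coord i) X x) 0 i.

(* (nabla_X A) Y *)
Definition nabla_end (A : 'rV[R]_d -> 'M[R]_d) (X Y : 'rV[R]_d -> 'rV[R]_d) :
    'rV[R]_d -> 'rV[R]_d :=
  nabla X (appl A Y) - appl A (nabla X Y).

(* the fundamental 2-form g(X, A Y), its covariant derivative, and its exterior
   derivative as the cyclic sum of (nabla_X Om)(Y, Z) *)
Definition fund (A : 'rV[R]_d -> 'M[R]_d) (X Y : 'rV[R]_d -> 'rV[R]_d) :
    'rV[R]_d -> R :=
  fun x => ip x (X x) (appl A Y x).

Definition nabla_fund A (X Y Z : 'rV[R]_d -> 'rV[R]_d) : 'rV[R]_d -> R :=
  dird X (fund A Y Z) - fund A (nabla X Y) Z - fund A Y (nabla X Z).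

Definition d_fund A (X Y Z : 'rV[R]_d -> 'rV[R]_d) : 'rV[R]_d -> R :=
  nabla_fund A X Y Z + nabla_fund A Y Z X + nabla_fund A Z X Y.

End LocalRiemann.

(* F is the expression in charts of a map, g and h are the metrics. *)
Section LocalMaps.
Context {R : realType} {d e : nat}.
Variables (g : 'rV[R]_d -> 'M[R]_d) (h : 'rV[R]_e -> 'M[R]_e).
Variable F : 'rV[R]_d -> 'rV[R]_e.

Definition push (X : 'rV[R]_d -> 'rV[R]_d) : 'rV[R]_d -> 'rV[R]_e :=
  fun x => 'D_(X x) F x.

(* the connection induced on the pull-back of the tangent bundle by F *)
Definition nabla_along (X : 'rV[R]_d -> 'rV[R]_d) (Z : 'rV[R]_d -> 'rV[R]_e) :
    'rV[R]_d -> 'rV[R]_e :=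
  fun x => 'D_(X x) Z x + gamma h (F x) (push X x) (Z x).

Definition second_fund (X Y : 'rV[R]_d -> 'rV[R]_d) : 'rV[R]_d -> 'rV[R]_e :=
  nabla_along X (push Y) - push (nabla g X Y).

Definition tension : 'rV[R]_d -> 'rV[R]_e :=
  fun x => \sum_(i < d) \sum_(j < d)
    invmx (g x) i j *: second_fund (fun=> coord i) (fun=> coord j) x.

End LocalMaps.

Section LocalContact.
Context {R : realType} {d : nat}.

(* eta is stored as a column vector: eta(X) = X *m eta. *)
Record lacm := LACM {
  phi : 'rV[R]_d -> 'M[R]_d;
  xi : 'rV[R]_d -> 'rV[R]_d;
  eta : 'rV[R]_d -> 'cV[R]_d;
  met : 'rV[R]_d -> 'M[R]_d
}.

Variable S : lacm.

Definition etav (x v : 'rV[R]_d) : R := (v *m eta S x) 0 0.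

Definition etaf (X : 'rV[R]_d -> 'rV[R]_d) : 'rV[R]_d -> R :=
  fun x => etav x (X x).

Definition acm_on (U : set 'rV[R]_d) : Prop :=
  [/\ smooth_on U (phi S), smooth_on U (xi S), smooth_on U (eta S),
      riemannian_on (met S) U &
      forall x, U x ->
      [/\ forall v, v *m phi S x *m phi S x = - v + etav x v *: xi S x,
          etav x (xi S x) = 1 &
          forall v w, ip (met S) x (v *m phi S x) (w *m phi S x) =
                      ip (met S) x v w - etav x v * etav x w]].

Definition nphi (X Y : 'rV[R]_d -> 'rV[R]_d) : 'rV[R]_d -> 'rV[R]_d :=
  nabla_end (met S) (phi S) X Y.

Definition Om (X Y : 'rV[R]_d -> 'rV[R]_d) : 'rV[R]_d -> R :=
  fund (met S) (phi S) X Y.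

Definition dOm (X Y Z : 'rV[R]_d -> 'rV[R]_d) : 'rV[R]_d -> R :=
  d_fund (met S) (phi S) X Y Z.

Definition Pten (X Y : 'rV[R]_d -> 'rV[R]_d) : 'rV[R]_d -> 'rV[R]_d :=
  nphi X Y + nphi (appl (phi S) X) (appl (phi S) Y).

(* one half of the Lie derivative of phi along xi *)
Definition hten (X : 'rV[R]_d -> 'rV[R]_d) : 'rV[R]_d -> 'rV[R]_d :=
  fun x => 2^-1 *: (lie_bracket (xi S) (appl (phi S) X)
                    - appl (phi S) (lie_bracket (xi S) X)) x.

Definition deta (X Y : 'rV[R]_d -> 'rV[R]_d) : 'rV[R]_d -> R :=
  fun x => 2^-1 * (dird X (etaf Y) x - dird Y (etaf X) x
                   - etaf (lie_bracket X Y) x).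

Definition eta_wedge_Om (X Y Z : 'rV[R]_d -> 'rV[R]_d) : 'rV[R]_d -> R :=
  etaf X * Om Y Z + etaf Y * Om Z X + etaf Z * Om X Y.

(* (d eta)^k and eta /\ (d eta)^k, up to a nonzero constant factor: they are
   only used for vanishing and nonvanishing. *)
Definition deta_pow (k : nat) (X : 'I_(k + k) -> 'rV[R]_d -> 'rV[R]_d)
    (x : 'rV[R]_d) : R :=
  \sum_(s : 'S_(k + k)) (-1) ^+ s *
    \prod_(l < k) deta (X (s (lshift k l))) (X (s (rshift k l))) x.

Definition eta_deta_pow (k : nat)
    (X : 'I_(1 + (k + k)) -> 'rV[R]_d -> 'rV[R]_d) (x : 'rV[R]_d) : R :=
  \sum_(s : 'S_(1 + (k + k))) (-1) ^+ s *
    (etaf (X (s (lshift (k + k) ord0))) x *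
     \prod_(l < k) deta (X (s (rshift 1 (lshift k l))))
                        (X (s (rshift 1 (rshift k l)))) x).

(* local orthonormal frames {e_i; phi e_i; xi} on an open set V *)
Definition phi_frame (m : nat) (V : set 'rV[R]_d)
    (e : 'I_m -> 'rV[R]_d -> 'rV[R]_d) : Prop :=
  [/\ open V, forall k, smooth_on V (e k) &
      forall x, V x ->
      [/\ forall k l, ip (met S) x (e k x) (e l x) = (k == l)%:R,
          forall k l, ip (met S) x (e k x) (appl (phi S) (e l) x) = 0,
          forall k l, ip (met S) x (appl (phi S) (e k) x)
                                   (appl (phi S) (e l) x) = (k == l)%:R,
          forall k, ip (met S) x (e k x) (xi S x) = 0 /\
                    ip (met S) x (appl (phi S) (e k) x) (xi S x) = 0 &
          ip (met S) x (xi S x) (xi S x) = 1]].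

Definition codiff_eta : 'rV[R]_d -> R :=
  fun x => - divergence (met S) (xi S) x.

(* delta Om (X), computed in the frame e *)
Definition codiff_Om (m : nat) (e : 'I_m -> 'rV[R]_d -> 'rV[R]_d)
    (X : 'rV[R]_d -> 'rV[R]_d) : 'rV[R]_d -> R :=
  fun x => ip (met S) x
    (- appl (phi S) (nabla (met S) (xi S) (xi S)) x
     + \sum_(k < m) Pten (e k) (e k) x) (X x).

End LocalContact.
Arguments lacm : clear implicits.

Section Manifolds.
Context {R : realType}.

(* chart_inv i is only meaningful on img i, and chart i on dom i. *)
Record manifold (d : nat) := Manifold {
  carrier :> topologicalType;
  chart_ix : Type;
  dom : chart_ix -> set carrier;
  img : chart_ix -> set 'rV[R]_d;
  chart : chart_ix -> carrier -> 'rV[R]_d;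
  chart_inv : chart_ix -> 'rV[R]_d -> carrier;
  manifold_hausdorff : hausdorff_space carrier;
  manifold_second_countable : @second_countable carrier;
  dom_open : forall i, open (dom i);
  img_open : forall i, open (img i);
  dom_cover : forall p, exists i, dom i p;
  chart_img : forall i p, dom i p -> img i (chart i p);
  chart_inv_dom : forall i x, img i x -> dom i (chart_inv i x);
  chartK : forall i p, dom i p -> chart_inv i (chart i p) = p;
  chart_invK : forall i x, img i x -> chart i (chart_inv i x) = x;
  chart_continuous : forall i p, dom i p -> {for p, continuous (chart i)};
  chart_inv_continuous :
    forall i x, img i x -> {for x, continuous (chart_inv i)};
  transition_smooth : forall i j,
    smooth_on (img i `&` chart_inv i @^-1` dom j) (chart j \o chart_inv i)
}.

Definition overlap d (M : manifold d) (i j : chart_ix M) : set 'rV[R]_d :=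
  img i `&` chart_inv i @^-1` dom j.

Definition transition d (M : manifold d) (i j : chart_ix M) :
    'rV[R]_d -> 'rV[R]_d :=
  chart j \o chart_inv i.

Definition smooth_fun d (M : manifold d) (u : M -> R) : Prop :=
  forall i, smooth_on (img i) (u \o chart_inv i).

Section Maps.
Context {d e : nat} {M : manifold d} {N : manifold e}.

Definition map_dom (f : M -> N) (i : chart_ix M) (j : chart_ix N) :
    set 'rV[R]_d :=
  img i `&` (f \o chart_inv i) @^-1` dom j.

Definition map_rep (f : M -> N) (i : chart_ix M) (j : chart_ix N) :
    'rV[R]_d -> 'rV[R]_e :=
  chart j \o f \o chart_inv i.

Definition smooth_map (f : M -> N) : Prop :=
  continuous f /\ forall i j, smooth_on (map_dom f i j) (map_rep f i j).

End Maps.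

Definition is_constant (A B : Type) (f : A -> B) : Prop :=
  forall p q, f p = f q.

(* compatible families of metrics; the positivity is in riemannian_on *)
Definition metric_family d (M : manifold d) := chart_ix M -> 'rV[R]_d -> 'M[R]_d.

Definition metric_compat d (M : manifold d) (g : metric_family M) : Prop :=
  forall i j x, overlap i j x -> forall v w,
    ip (g i) x v w = ip (g j) (transition i j x)
      ('D_v (transition i j) x) ('D_w (transition i j) x).

Definition endo_compat d (M : manifold d)
    (A : chart_ix M -> 'rV[R]_d -> 'M[R]_d) : Prop :=
  forall i j x, overlap i j x -> forall v,
    'D_(v *m A i x) (transition i j) x =
    'D_v (transition i j) x *m A j (transition i j x).

Record acm_structure (m : nat) (M : manifold (m.*2.+1)) := ACMStructure {
  acm :> chart_ix M -> lacm R (m.*2.+1);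
  acm_axioms : forall i, acm_on (acm i) (img i);
  acm_phi_compat : endo_compat (fun i => phi (acm i));
  acm_xi_compat : forall i j x, overlap i j x ->
    'D_(xi (acm i) x) (transition i j) x = xi (acm j) (transition i j x);
  acm_eta_compat : forall i j x, overlap i j x -> forall v,
    etav (acm i) x v =
    etav (acm j) (transition i j x) ('D_v (transition i j) x);
  acm_met_compat : metric_compat (fun i => met (acm i))
}.

Definition acm_metric m (M : manifold (m.*2.+1)) (S : acm_structure M) :
    metric_family M :=
  fun i => met (S i).

Record ah_structure (n : nat) (H : manifold (n.*2)) := AHStructure {
  cplx : chart_ix H -> 'rV[R]_(n.*2) -> 'M[R]_(n.*2);
  ah_metric : metric_family H;
  ah_smooth : forall i, smooth_on (img i) (cplx i);
  ah_riemannian : forall i, riemannian_on (ah_metric i) (img i);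
  ah_square : forall i x, img i x ->
    forall v : 'rV[R]_(n.*2), v *m cplx i x *m cplx i x = - v;
  ah_hermitian : forall i x, img i x -> forall v w : 'rV[R]_(n.*2),
    ip (ah_metric i) x (v *m cplx i x) (w *m cplx i x) = ip (ah_metric i) x v w;
  ah_cplx_compat : endo_compat cplx;
  ah_metric_compat : metric_compat ah_metric
}.

(* "for all vector fields X (and Y, Z), at every point", read in every chart *)
Definition forall_vf1 d (M : manifold d)
    (Q : chart_ix M -> ('rV[R]_d -> 'rV[R]_d) -> 'rV[R]_d -> Prop) : Prop :=
  forall i X, smooth_on (img i) X -> forall x, img i x -> Q i X x.

Definition forall_vf2 d (M : manifold d)
    (Q : chart_ix M -> ('rV[R]_d -> 'rV[R]_d) -> ('rV[R]_d -> 'rV[R]_d) ->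
         'rV[R]_d -> Prop) : Prop :=
  forall i X Y, smooth_on (img i) X -> smooth_on (img i) Y ->
  forall x, img i x -> Q i X Y x.

Definition forall_vf3 d (M : manifold d)
    (Q : chart_ix M -> ('rV[R]_d -> 'rV[R]_d) -> ('rV[R]_d -> 'rV[R]_d) ->
         ('rV[R]_d -> 'rV[R]_d) -> 'rV[R]_d -> Prop) : Prop :=
  forall i X Y Z, smooth_on (img i) X -> smooth_on (img i) Y ->
  smooth_on (img i) Z -> forall x, img i x -> Q i X Y Z x.

Section ContactClasses.
Context {m : nat} {M : manifold (m.*2.+1)}.
Variable S : acm_structure M.

Let g (i : chart_ix M) (X Y : 'rV[R]_(m.*2.+1) -> 'rV[R]_(m.*2.+1)) x : R :=
  ip (met (S i)) x (X x) (Y x).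
Let pull (u : M -> R) (i : chart_ix M) : 'rV[R]_(m.*2.+1) -> R :=
  u \o chart_inv i.

Definition normal_acm : Prop := forall_vf2 (fun i X Y x =>
  nijenhuis (phi (S i)) X Y x + (2 * deta (S i) X Y x) *: xi (S i) x = 0).

Definition eta_closed : Prop := forall_vf2 (fun i X Y x => deta (S i) X Y x = 0).

Definition Om_closed : Prop := forall_vf3 (fun i X Y Z x => dOm (S i) X Y Z x = 0).

Definition almost_semi_sasakian : Prop :=
  forall i (V : set 'rV[R]_(m.*2.+1)) (e : 'I_m -> _),
    V `<=` img i -> phi_frame (S i) V e ->
    forall X, smooth_on V X -> forall x, V x ->
      codiff_Om (S i) e X x = m.*2%:R * etaf (S i) X x.

Definition semi_sasakian : Prop := almost_semi_sasakian /\ normal_acm.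

Definition alpha_contact (alpha : R) : Prop :=
  alpha != 0 /\
  forall_vf2 (fun i X Y x => deta (S i) X Y x = alpha * Om (S i) X Y x).

Definition quasi_contact : Prop := forall_vf2 (fun i X Y x =>
  Pten (S i) X Y x =
  (2 * g i X Y x) *: xi (S i) x
  - etaf (S i) Y x *:
      (X x + etaf (S i) X x *: xi (S i) x + hten (S i) X x)).

Definition quasi_K_sasakian : Prop := forall_vf2 (fun i X Y x =>
  Pten (S i) X Y x =
  (2 * g i X Y x) *: xi (S i) x - (2 * etaf (S i) Y x) *: X x
  + etaf (S i) Y x *: nabla (met (S i)) (appl (phi (S i)) X) (xi (S i)) x).

Definition strongly_pseudoconvex_CR : Prop :=
  forall_vf2 (fun i X Y x => deta (S i) X Y x = Om (S i) X Y x) /\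
  forall_vf2 (fun i X Y x =>
    nphi (S i) X Y x =
    g i (X + hten (S i) X) Y x *: xi (S i) x
    - etaf (S i) Y x *: (X x + hten (S i) X x)).

Definition alpha_sasakian (alpha : R) : Prop :=
  alpha_contact alpha /\ normal_acm.

Definition class_A1 : Prop :=
  [\/ (exists alpha, alpha_contact alpha),
      quasi_contact,
      quasi_K_sasakian |
      strongly_pseudoconvex_CR \/ exists alpha, alpha_sasakian alpha].

Definition trans_sasakian (wp theta : M -> R) : Prop :=
  [/\ normal_acm,
      smooth_fun wp /\ smooth_fun theta,
      (forall p, wp p != 0) /\ (forall p, theta p != 0),
      forall_vf2 (fun i X Y x =>
        nphi (S i) X Y x =
        pull wp i x *: (g i X Y x *: xi (S i) x - etaf (S i) Y x *: X x)
        + pull theta i x *: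
            (g i (appl (phi (S i)) X) Y x *: xi (S i) x
             - etaf (S i) Y x *: appl (phi (S i)) X x)) &
      (forall i (V : set 'rV[R]_(m.*2.+1)) (e : 'I_m -> _),
         V `<=` img i -> phi_frame (S i) V e -> forall x, V x ->
         m.*2%:R * pull wp i x = codiff_Om (S i) e (xi (S i)) x) /\
      (forall i x, img i x ->
         m.*2%:R * pull theta i x = - codiff_eta (S i) x)].

Definition class_A4 : Prop :=
  [/\ normal_acm, Om_closed &
      exists r : nat, [/\ (1 <= r)%N, (r <= m.-1)%N,
        (forall i x, img i x ->
           exists2 X : 'I_(1 + (r + r)) -> 'rV[R]_(m.*2.+1) -> 'rV[R]_(m.*2.+1),
             (forall a, smooth_on (img i) (X a)) &
             eta_deta_pow (S i) X x != 0) &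
        (forall i (X : 'I_(r.+1 + r.+1) -> 'rV[R]_(m.*2.+1) -> 'rV[R]_(m.*2.+1)),
           (forall a, smooth_on (img i) (X a)) ->
           forall x, img i x -> deta_pow (S i) X x = 0)]].

Definition almost_cosymplectic : Prop := eta_closed /\ Om_closed.

Definition cosymplectic : Prop := [/\ eta_closed, Om_closed & normal_acm].

Definition nearly_cosymplectic : Prop :=
  forall_vf1 (fun i X x => nphi (S i) X X x = 0).

Definition nearly_K_cosymplectic : Prop :=
  nearly_cosymplectic /\ forall_vf1 (fun i X x => nphi (S i) X (xi (S i)) x = 0).

Definition quasi_K_cosymplectic : Prop := forall_vf2 (fun i X Y x =>
  Pten (S i) X Y x =
  etaf (S i) Y x *: nabla (met (S i)) (appl (phi (S i)) X) (xi (S i)) x).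

Definition class_B1 : Prop :=
  [\/ cosymplectic, almost_cosymplectic, nearly_cosymplectic |
      nearly_K_cosymplectic \/ quasi_K_cosymplectic].

Definition almost_beta_kenmotsu (beta : M -> R) : Prop :=
  [/\ smooth_fun beta /\ (forall p, beta p != 0),
      forall_vf3 (fun i X Y Z x =>
        dOm (S i) X Y Z x = 2 * pull beta i x * eta_wedge_Om (S i) X Y Z x),
      eta_closed &
      forall_vf2 (fun i X Y x =>
        dird X (pull beta i) x * etaf (S i) Y x
        - dird Y (pull beta i) x * etaf (S i) X x = 0)].

Definition beta_kenmotsu (beta : M -> R) : Prop :=
  almost_beta_kenmotsu beta /\ normal_acm.

Definition CR_integrable_kenmotsu (beta : M -> R) : Prop :=
  almost_beta_kenmotsu beta /\
  forall_vf2 (fun i X Y x =>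
    nphi (S i) X Y x =
    g i (hten (S i) X) Y x *: xi (S i) x
    - etaf (S i) Y x *: hten (S i) X x
    + pull beta i x *:
        (g i (appl (phi (S i)) X) Y x *: xi (S i) x
         - etaf (S i) Y x *: appl (phi (S i)) X x)).

Definition class_B3 : Prop :=
  exists beta, [\/ almost_beta_kenmotsu beta, beta_kenmotsu beta |
                   CR_integrable_kenmotsu beta].

End ContactClasses.

Section HermitianClasses.
Context {n : nat} {H : manifold (n.*2)}.
Variable K : ah_structure H.

Let nJ i X Y := nabla_end (ah_metric K i) (cplx K i) X Y.

Definition kahler : Prop := forall_vf2 (fun i X Y x => nJ i X Y x = 0).

Definition nearly_kahler : Prop := forall_vf1 (fun i X x => nJ i X X x = 0).

Definition almost_kahler : Prop := forall_vf3 (fun i X Y Z x =>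
  d_fund (ah_metric K i) (cplx K i) X Y Z x = 0).

Definition quasi_kahler : Prop := forall_vf1 (fun i X x =>
  nJ i (appl (cplx K i) X) X x - nJ i X (appl (cplx K i) X) x = 0).

Definition class_C1 : Prop :=
  [\/ kahler, nearly_kahler, almost_kahler | quasi_kahler].

End HermitianClasses.

Section RiemannianMaps.
Context {d e : nat} {M : manifold d} {N : manifold e}.
Variables (g : metric_family M) (h : metric_family N) (f : M -> N).

Definition harmonic_map : Prop :=
  forall i j x, map_dom f i j x -> tension (g i) (h j) (map_rep f i j) x = 0.

Definition conformal_factor (mu : M -> R) : Prop :=
  (forall p, 0 <= mu p) /\
  forall i j x, map_dom f i j x -> forall v w,
    ip (h j) (map_rep f i j x) ('D_v (map_rep f i j) x) ('D_w (map_rep f i j) x)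
    = mu (chart_inv i x) ^+ 2 * ip (g i) x v w.

Definition weakly_conformal : Prop := exists mu, conformal_factor mu.

Definition homothetic : Prop :=
  exists2 mu, conformal_factor mu & is_constant mu.

Definition horizontal i j (x : 'rV[R]_d) : set 'rV[R]_d :=
  [set v | forall w, 'D_w (map_rep f i j) x = 0 -> ip (g i) x v w = 0].

Definition horizontally_weakly_conformal : Prop :=
  exists mu : M -> R, (forall p, 0 <= mu p) /\
  forall i j x, map_dom f i j x ->
    (forall v w, horizontal i j x v -> horizontal i j x w ->
       ip (h j) (map_rep f i j x)
          ('D_v (map_rep f i j) x) ('D_w (map_rep f i j) x)
       = mu (chart_inv i x) ^+ 2 * ip (g i) x v w) /\
    (0 < mu (chart_inv i x) ->
       forall z, exists2 v, horizontal i j x v & 'D_v (map_rep f i j) x = z).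

Definition harmonic_morphism : Prop :=
  harmonic_map /\ horizontally_weakly_conformal.

(* The fibres are submanifolds on the set of points where f is a submersion.
   Near such a point, E is an orthonormal frame of ker f_*, and the normal
   component of \sum_a nabla_{E_a} E_a is the trace of the second fundamental
   form of the fibre. *)
Definition minimal_fibres : Prop :=
  forall i j (V : set 'rV[R]_d) (r : nat) (E : 'I_r -> 'rV[R]_d -> 'rV[R]_d),
    open V -> V `<=` map_dom f i j ->
    (forall x, V x -> forall z, exists v, 'D_v (map_rep f i j) x = z) ->
    (forall a, smooth_on V (E a)) ->
    (forall x, V x ->
       [/\ forall a b, ip (g i) x (E a x) (E b x) = (a == b)%:R,
           forall a, 'D_(E a x) (map_rep f i j) x = 0 &
           forall v, 'D_v (map_rep f i j) x = 0 ->
             exists c : 'I_r -> R, v = \sum_(a < r) c a *: E a x]) ->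
    forall x, V x -> forall w, horizontal i j x w ->
      ip (g i) x (\sum_(a < r) nabla (g i) (E a) (E a) x) w = 0.

Definition immersion : Prop :=
  forall i j x, map_dom f i j x -> forall v,
    'D_v (map_rep f i j) x = 0 -> v = 0.

(* Either the image is a point, or f is an immersion whose mean curvature
   vanishes: for a local frame E that is orthonormal for the induced metric
   f^*h, the component of \sum_a nabla_{E_a} (f_* E_a) normal to the image is
   the trace of the second fundamental form of the image. *)
Definition minimal_image : Prop :=
  is_constant f \/
  immersion /\
  forall i j (V : set 'rV[R]_d) (E : 'I_d -> 'rV[R]_d -> 'rV[R]_d),
    open V -> V `<=` map_dom f i j ->
    (forall a, smooth_on V (E a)) ->
    (forall x, V x -> forall a b,
       ip (h j) (map_rep f i j x)
          (push (map_rep f i j) (E a) x) (push (map_rep f i j) (E b) x)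
       = (a == b)%:R) ->
    forall x, V x -> forall z : 'rV[R]_e,
      (forall v, ip (h j) (map_rep f i j x) z ('D_v (map_rep f i j) x) = 0) ->
      ip (h j) (map_rep f i j x)
         (\sum_(a < d) nabla_along (h j) (map_rep f i j) (E a)
                         (push (map_rep f i j) (E a)) x) z = 0.

End RiemannianMaps.

Section HolomorphicMaps.
Context {m e : nat} {M : manifold (m.*2.+1)} {N : manifold e}.
Variables (SM : acm_structure M) (psi : chart_ix N -> 'rV[R]_e -> 'M[R]_e).
Variable f : M -> N.

(* s = false is the holomorphic case, s = true the (-)-holomorphic one *)
Definition pm_holomorphic : Prop :=
  smooth_map f /\
  exists s : bool, forall i j x, map_dom f i j x -> forall v,
    'D_(v *m phi (SM i) x) (map_rep f i j) x =
    (-1) ^+ s *: ('D_v (map_rep f i j) x *m psi j (map_rep f i j x)).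

Definition constant_along_D : Prop :=
  forall i j x, map_dom f i j x -> forall v,
    etav (SM i) x v = 0 -> 'D_v (map_rep f i j) x = 0.

(* d u (xi), in the chart i *)
Definition reeb_derivative (u : M -> R) (i : chart_ix M)
    (x : 'rV[R]_(m.*2.+1)) : R :=
  'D_(xi (SM i) x) (u \o chart_inv i) x.

Definition constant_along_xi (u : M -> R) : Prop :=
  forall i x, img i x -> reeb_derivative u i x = 0.

End HolomorphicMaps.

Section ContactMaps.
Context {m n : nat} {M : manifold (m.*2.+1)} {N : manifold (n.*2.+1)}.
Variables (SM : acm_structure M) (SN : acm_structure N) (f : M -> N).

Definition contact_holomorphic : Prop :=
  pm_holomorphic SM (fun j => phi (SN j)) f.

Definition contact_harmonic : Prop :=
  harmonic_map (acm_metric SM) (acm_metric SN) f.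

(* f_* xi = lam * gamma *)
Definition reeb_factor (lam : M -> R) : Prop :=
  smooth_fun lam /\
  forall i j x, map_dom f i j x ->
    'D_(xi (SM i) x) (map_rep f i j) x =
    lam (chart_inv i x) *: xi (SN j) (map_rep f i j x).

(* \sum_i h(E_i, E_i) with E_i = f_* e_i *)
Definition frame_energy i j (e : 'I_m -> 'rV[R]_(m.*2.+1) -> 'rV[R]_(m.*2.+1))
    (x : 'rV[R]_(m.*2.+1)) : R :=
  \sum_(k < m) ip (met (SN j)) (map_rep f i j x)
    (push (map_rep f i j) (e k) x) (push (map_rep f i j) (e k) x).

End ContactMaps.

End Manifolds.
Arguments manifold : clear implicits.

(* Main.v *)
(* Everything is computed in charts, from the pointwise values of g, phi, xi and
   of their covariant derivatives. Tracing the derivative of f_* phi = +-psi f_*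
   over a frame {e_i, phi e_i, xi} gives psi(tau(f)) in terms of
   sum_i P(e_i, e_i) - phi nabla_xi xi = delta Omega = 2m xi and of the values of
   P on the E_i = f_* e_i. The remaining component h(tau(f), gamma) is
   d lambda(xi) minus a trace of nabla gamma over the E_i, because xi is
   divergence free: 2m xi is the codifferential of Omega, and delta^2 = 0. Each
   class of targets prescribes P and nabla gamma on D^N, which yields tau(f).
   When M and N are normal, d lambda = d lambda(xi) eta, and the symmetry of the
   Hessian of lambda kills d lambda since d eta does not vanish. For weakly
   conformal maps and for maps with minimal fibres, h(tau(f), f_* .) is computed
   from the divergence of the stress-energy tensor, that is, from the covariant
   derivative of f^* h. *)
Require Import Defs.
From HB Require Import structures.
From mathcomp Require Import all_boot all_order all_algebra all_fingroup.
From mathcomp Require Import all_classical all_reals all_analysis.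
Import Order.TTheory GRing.Theory Num.Theory.
Import numFieldNormedType.Exports.
Local Open Scope classical_set_scope.
Local Open Scope ring_scope.
From mathcomp Require Import ring lra.

Set Implicit Arguments.
Unset Strict Implicit.
Unset Printing Implicit Defensive.

(** The work is split in two layers. The records [contact_point], [hermitian_point] and
    [holomorphic_jet] list the algebraic relations between the values at one point of the metric,
    phi, xi, f_* and their covariant derivatives; the tension formulas follow from them over an
    abstract module. The analytic layer produces the records: [cov] differentiates matrix functions
    with a connection matrix on each side, so each relation is the derivative of one matrix
    identity, such as phi^2 = -1 + eta xi or f_* phi = s phi f_* . The conformal factor mu is an
    arbitrary function, with nothing to differentiate. Lambda removes this obstacle: f_* xi = lambda
    gamma has length |lambda|, so mu^2 = lambda^2, and lambda is smooth. The stress-energy argument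
    then gives multiples of lambda d lambda with coefficient 1 - 2m or 1 - 2n, nonzero because the
    manifolds have odd dimension; in dimension 2 it would say nothing. Zeros of lambda and targets
    of dimension 1 (n = 0) need separate arguments. *)

Local Notation crd := Defs.coord.

(** * Calculus on open subsets of R^d *)

Section LineCalculus.
Context {R : realType} {d : nat}.
Implicit Types (x v : 'rV[R]_d).

Lemma is_derive_line {W : normedModType R} (f : 'rV[R]_d -> W) x v (s : R) :
  derivable f (x + s *: v) v ->
  is_derive s 1 (fun t : R => f (x + t *: v)) ('D_v f (x + s *: v)).
Proof.
have E : (fun h : R => h^-1 *: (((fun t : R => f (x + t *: v)) \o shift s) (h *: 1)
    - f (x + s *: v)))
  = (fun h : R => h^-1 *: ((f \o shift (x + s *: v)) (h *: v) - f (x + s *: v))).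
  apply/funext => h /=; congr (_ *: (f _ - _)).
  by rewrite [h *: 1]mulr1 scalerDl addrCA addrC -addrA addrC -addrA [h *: v + _]addrC.
by move=> df; apply: DeriveDef; rewrite /derivable /derive E.
Qed.

Lemma line_MVT (f : 'rV[R]_d -> R) x v (t : R) : 0 < t ->
  (forall s, 0 <= s <= t -> derivable f (x + s *: v) v) ->
  exists2 s, 0 < s < t & f (x + t *: v) - f x = t * 'D_v f (x + s *: v).
Proof.
move=> t0 df.
have dl s : 0 <= s <= t -> is_derive s 1 (fun t : R => f (x + t *: v))
    ('D_v f (x + s *: v)) by move=> /df; exact: is_derive_line.
have [||c cI E] := @MVT R (fun t : R => f (x + t *: v))
  (fun s => 'D_v f (x + s *: v)) 0 t t0.
- by move=> s; rewrite in_itv /= => /andP[s0 st]; apply: dl; rewrite !ltW.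
- apply: derivable_within_continuous => s; rewrite in_itv /= => sI.
  by have [] := dl s sI.
exists c; first by move: cI; rewrite in_itv.
by move: E; rewrite scale0r addr0 subr0 mulrC => ->.
Qed.

Lemma le_rV_norm (v : 'rV[R]_d) i : `|v 0 i| <= `|v|.
Proof. by rewrite [leRHS]/Num.Def.normr /= mx_normrE; apply: (le_bigmax _ _ (0, i)). Qed.

(** The corners of the broken line from 0 to v that moves one coordinate at a time. *)
Definition trunc_rV (k : nat) (v : 'rV[R]_d) : 'rV[R]_d :=
  \row_i (if (i < k)%N then v 0 i else 0).

(** The norm is the sup norm, so moving the next coordinate within its range does not leave the ball
    of radius |v|: the broken line stays where the partial derivatives are controlled. *)
Lemma trunc_rVS (k : 'I_d) v (s : R) : `|s| <= `|v 0 k| ->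
  `|trunc_rV k v + s *: crd k| <= `|v|.
Proof.
move=> sv; rewrite [leLHS]/Num.Def.normr /= mx_normrE; apply: bigmax_le => // -[a b] _ /=.
rewrite !mxE (ord1 a) /=; have [->|nbk] := eqVneq b k.
  by rewrite ltnn add0r mulr1 (le_trans sv) // le_rV_norm.
by rewrite /= mulr0 addr0; case: ifP => _; rewrite ?normr0 // le_rV_norm.
Qed.

Lemma trunc_rV_step (k : 'I_d) v : trunc_rV k.+1 v = trunc_rV k v + v 0 k *: crd k.
Proof.
apply/rowP => b; rewrite !mxE eqxx /= ltnS leq_eqVlt; have [->|nbk] := eqVneq b k.
  by rewrite eqxx ltnn /= add0r mulr1.
by rewrite -val_eqE in nbk; rewrite (negbTE nbk) /= mulr0 addr0.
Qed.

End LineCalculus.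

Section ContDiff.
Context {R : realType} {d : nat}.
Variables (U : set 'rV[R]_d) (f : 'rV[R]_d -> R).
Hypothesis oU : open U.
Hypothesis df : forall x i, U x -> derivable f x (crd i).

(** The coordinates of an increment may be negative, hence a mean value theorem for t of either
    sign. *)
Lemma MVT_signed x v (t : R) :
  (forall s : R, `|s| <= `|t| -> derivable f (x + s *: v) v) ->
  exists2 s : R, `|s| <= `|t| & f (x + t *: v) - f x = t * 'D_v f (x + s *: v).
Proof.
move=> dv; have [t0|t0|t0] := ltgtP 0 t; last first.
- by rewrite -t0; exists 0; rewrite // scale0r addr0 subrr mul0r.
- have nt0 : 0 < - t by rewrite oppr_gt0.
  have [|s /andP[s0 st]] := @line_MVT R d f (x + t *: v) v (- t) nt0.
    move=> s /andP[s0 st]; rewrite -addrA -scalerDl; apply: dv.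
    by rewrite (ltr0_norm t0); rewrite ler_norml; apply/andP; split; lra.
  rewrite scaleNr addrK -addrA -scalerDl => E; exists (t + s).
    by rewrite (ltr0_norm t0); rewrite ler_norml; apply/andP; split; lra.
  by rewrite -opprB E; ring.
- have [|s /andP[s0 st] E] := @line_MVT R d f x v t t0.
    move=> s /andP[s0 st]; apply: dv; rewrite (gtr0_norm t0) ger0_norm //.
  by exists s => //; rewrite (gtr0_norm t0) gtr0_norm // ltW.
Qed.

Hypothesis cdf : forall x i, U x -> {for x, continuous ('D_(crd i) f)}.

(** Continuous partial derivatives give total differentiability: f(x + v) - f(x) telescopes along
    the [trunc_rV], and on each segment the mean value theorem produces a partial derivative taken
    near x. *)
Lemma C1_increment x : U x -> forall e : R, 0 < e ->
  \forall v \near (0 : 'rV[R]_d),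
    `|f (x + v) - f x - \sum_(i < d) v 0 i * 'D_(crd i) f x| <= e * `|v|.
Proof.
move=> Ux e e0.
(* Each of the d segments costs at most e / (d + 1) times |v|; the successor keeps the quotient
   positive when d = 0. *)
have e'0 : 0 < e / d.+1%:R by rewrite divr_gt0.
have near_x : \forall y \near x, U y /\
    forall i, `|'D_(crd i) f x - 'D_(crd i) f y| <= e / d.+1%:R.
  apply: filterI; first exact: open_nbhs_nbhs.
  apply: (@filter_forall _ _ (fun (i : 'I_d) (y : 'rV[R]_d) =>
    `|'D_(crd i) f x - 'D_(crd i) f y| <= e / d.+1%:R) (nbhs x)) => i.
  by have /cvgrPdist_le := cdf (i := i) Ux; apply.
have /nbhs_ballP[r /= r0 ball_r] := near_x.
have inr (w : 'rV[R]_d) : `|w| < r -> U (x + w) /\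
    forall i, `|'D_(crd i) f x - 'D_(crd i) f (x + w)| <= e / d.+1%:R.
  move=> wr; apply: ball_r; rewrite -ball_normE /=.
  by rewrite opprD addrA subrr sub0r normrN.
near=> v.
have vr : `|v| < r.
  near: v; apply/nbhs_ballP; exists r => //= w; rewrite -ball_normE /=.
  by rewrite sub0r normrN.
suff H k : (k <= d)%N -> `|f (x + trunc_rV k v) - f x -
    \sum_(i < d | (i < k)%N) v 0 i * 'D_(crd i) f x| <= k%:R * (e / d.+1%:R * `|v|).
  have := H d (leqnn d); rewrite (_ : trunc_rV d v = v); last first.
    by apply/rowP => i; rewrite mxE ltn_ord.
  have -> : \sum_(i < d | (i < d)%N) v 0 i * 'D_(crd i) f x =
      \sum_(i < d) v 0 i * 'D_(crd i) f x.
    by apply: eq_bigl => i; rewrite ltn_ord.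
  move=> Hd; apply: le_trans Hd _; rewrite mulrA ler_wpM2r //.
  rewrite mulrCA ger_pMr // ler_pdivrMr // mul1r ler_nat //.
elim: k => [_|k IH kd].
  rewrite mul0r big1; last by move=> i; rewrite ltn0.
  rewrite subr0 (_ : trunc_rV 0 v = 0) ?addr0 ?subrr ?normr0 //.
  by apply/rowP => i; rewrite !mxE.
have := IH (ltnW kd); pose K := Ordinal kd => {}IH.
have [s sv E] : exists2 s : R, `|s| <= `|v 0 K| &
   f (x + trunc_rV K v + v 0 K *: crd K) - f (x + trunc_rV K v) =
   v 0 K * 'D_(crd K) f (x + trunc_rV K v + s *: crd K).
  apply: MVT_signed => s sv; apply: df; rewrite -addrA.
  by have [] := inr (trunc_rV K v + s *: crd K) (le_lt_trans (trunc_rVS sv) vr).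
have [_ /(_ K)] := inr (trunc_rV K v + s *: crd K) (le_lt_trans (trunc_rVS sv) vr).
rewrite !addrA => dK.
have -> : \sum_(i < d | (i < k.+1)%N) v 0 i * 'D_(crd i) f x =
    v 0 K * 'D_(crd K) f x + \sum_(i < d | (i < k)%N) v 0 i * 'D_(crd i) f x.
  rewrite (bigD1 K) //=; congr (_ + _); apply: eq_bigl => i.
  by rewrite ltnS leq_eqVlt -val_eqE /=; case: ltngtP.
rewrite (trunc_rV_step K) addrA /=.
set S := \sum_(_ < _ | _) _ in IH *.
have -> : f (x + trunc_rV k v + v 0 K *: crd K) - f x - (v 0 K * 'D_(crd K) f x + S)
  = (f (x + trunc_rV k v) - f x - S) -
    v 0 K * ('D_(crd K) f x - 'D_(crd K) f (x + trunc_rV k v + s *: crd K)).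
  have -> : f (x + trunc_rV k v + v 0 K *: crd K) =
    f (x + trunc_rV k v) + v 0 K * 'D_(crd K) f (x + trunc_rV K v + s *: crd K).
    by rewrite -E; ring.
  by rewrite mulrBr /=; ring.
apply: le_trans (ler_normB _ _) _; rewrite -[k.+1%:R]natr1 mulrDl mul1r lerD //.
by rewrite normrM mulrC ler_pM // le_rV_norm.
Unshelve. all: by end_near. Qed.

Lemma C1_differentiable x : U x -> differentiable f x.
Proof.
move=> Ux.
pose L (v : 'rV[R]_d) : R := \sum_(i < d) v 0 i * 'D_(crd i) f x.
have Llin : linear L.
  move=> a u v; rewrite /L /GRing.scale /= mulr_sumr -big_split; apply: eq_bigr => i _ /=.
  by rewrite !mxE /=; ring.
pose LM := GRing.isLinear.Build _ _ _ _ _ Llin.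
pose LL : {linear 'rV[R]_d -> R} := HB.pack L LM.
have cL : continuous LL.
  suff -> : (LL : 'rV[R]_d -> R) = \sum_(i < d) (fun v : 'rV[R]_d => 'D_(crd i) f x *: (v 0 i : R)).
    apply: (big_ind (fun g : 'rV[R]_d -> R => continuous g)).
    - by move=> y; exact: cst_continuous.
    - by move=> g h cg ch y; apply: continuousD; [exact: cg|exact: ch].
    - by move=> i _ y; apply: continuousZr; exact: coord_continuous.
  by apply/funext => v; rewrite fct_sumE /= /L; apply: eq_bigr => i _; rewrite mulrC.
have E : f \o shift x = cst (f x) + LL +o_ (0 : 'rV[R]_d) id.
  apply/eqaddoP => _/posnumP[e].
  apply: filterS (C1_increment Ux (gt0 e)) => v.
  rewrite [X in _ -> `|X| <= _](_ : _ = f (v + x) - (f x + LL v)) //.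
  by rewrite opprD addrA [v + x]addrC.
apply/diff_locallyP; rewrite (diff_unique cL E); split => //.
Qed.

End ContDiff.

(** Made for the symmetry of second derivatives: the mean value theorem gives equal values of the
    two mixed derivatives, but at two different points, both close to x. *)
Lemma continuous_eq_close {R : realType} {T : pseudoMetricType R} (p q : T -> R) (x : T) :
  {for x, continuous p} -> {for x, continuous q} ->
  (forall r : R, 0 < r -> exists y z, [/\ ball x r y, ball x r z & p y = q z]) ->
  p x = q x.
Proof.
move=> cp cq H; apply/eqP; rewrite -subr_eq0 -normr_le0.
apply/ler_addgt0Pl => e e0; rewrite addr0.
have e2 : 0 < e / 2 by rewrite divr_gt0.
move/cvgrPdist_le : cp => /(_ _ e2) /nbhs_ballP[r1 /= r10 cp].
move/cvgrPdist_le : cq => /(_ _ e2) /nbhs_ballP[r2 /= r20 cq].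
have [|y [z [By Bz E]]] := H (Num.min r1 r2); first by rewrite lt_min r10.
have /cp H1 : ball x r1 y by move: By; apply: le_ball; rewrite ge_min lexx.
have /cq : ball x r2 z by move: Bz; apply: le_ball; rewrite ge_min lexx orbT.
rewrite -E distrC => H2; rewrite (splitr e) (le_trans _ (lerD H1 H2)) //.
by rewrite (le_trans _ (ler_normD _ _)) // addrA subrK.
Qed.

Section Schwarz.
Context {R : realType} {d : nat}.
Variables (U : set 'rV[R]_d) (f : 'rV[R]_d -> R).

(** The mean value theorem twice: for y |-> f(y + t v) - f(y) along u, then for the u-derivative of
    f along v. *)
Lemma second_difference (x : 'rV[R]_d) (u v : 'rV[R]_d) (t : R) : 0 < t ->
  (forall a b : R, 0 <= a <= t -> 0 <= b <= t ->
    derivable f (x + a *: u + b *: v) u /\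
    derivable ('D_u f) (x + a *: u + b *: v) v) ->
  exists a b, [/\ 0 <= a <= t, 0 <= b <= t &
    f (x + t *: u + t *: v) - f (x + t *: u) - (f (x + t *: v) - f x) =
    t * (t * 'D_v ('D_u f) (x + a *: u + b *: v))].
Proof.
move=> t0 df.
pose q y := f (y + t *: v) - f y.
have shiftE y : (fun h : R => h^-1 *: (((fun y => f (y + t *: v)) \o shift y) (h *: u)
    - f (y + t *: v))) =
  (fun h : R => h^-1 *: ((f \o shift (y + t *: v)) (h *: u) - f (y + t *: v))).
  by apply/funext => h /=; rewrite addrA.
have tt : 0 <= t <= t by rewrite lexx ltW.
have t00 : 0 <= (0 : R) <= t by rewrite lexx ltW.
have dq a : 0 <= a <= t -> is_derive (x + a *: u) u q
    ('D_u f (x + a *: u + t *: v) - 'D_u f (x + a *: u)).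
  move=> at_; have [d1 _] := df a t at_ tt.
  have [+ _] := df a 0 at_ t00; rewrite scale0r addr0 => d2.
  have d1' : is_derive (x + a *: u) u (fun y => f (y + t *: v)) ('D_u f (x + a *: u + t *: v)).
    by split; rewrite /derivable /derive shiftE; have [] := derivableP d1.
  by apply: is_deriveB; exact: derivableP.
have [|a /andP[a0 at_] E] := @line_MVT R d q x u t t0.
  by move=> a at_; have [] := dq a at_.
have aI : 0 <= a <= t by rewrite !ltW.
have [|b /andP[b0 bt] E'] := @line_MVT R d ('D_u f) (x + a *: u) v t t0.
  by move=> b bt; have [] := df a b aI bt.
exists a, b; split => //; first by rewrite !ltW.
by rewrite -E' -[in RHS](@derive_val _ _ _ _ _ _ _ (dq a aI)) -E /q.
Qed.

Hypothesis oU : open U.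

(** The second difference over a parallelogram does not depend on the order of its two directions,
    so both mixed derivatives, at points of the parallelogram, equal its quotient by t^2. *)
Lemma Schwarz_coord (i j : 'I_d) x : U x ->
  (forall y, U y -> derivable f y (crd i) /\ derivable f y (crd j)) ->
  (forall y, U y -> derivable ('D_(crd i) f) y (crd j) /\
                    derivable ('D_(crd j) f) y (crd i)) ->
  {for x, continuous ('D_(crd j) ('D_(crd i) f))} ->
  {for x, continuous ('D_(crd i) ('D_(crd j) f))} ->
  'D_(crd j) ('D_(crd i) f) x = 'D_(crd i) ('D_(crd j) f) x.
Proof.
move=> Ux d1 d2 c1 c2; apply: (continuous_eq_close c1 c2) => e e0.
have /nbhs_ballP[r' /= r'0 ball_r'] : nbhs x U by exact: (open_nbhs_nbhs (conj oU Ux)).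
pose r := Num.min e r'; have r0 : 0 < r by rewrite lt_min e0.
have re y : ball x r y -> ball x e y by apply: le_ball; rewrite ge_min lexx.
have ball_r y : ball x r y -> U y.
  by move=> By; apply: ball_r'; move: By; apply: le_ball; rewrite ge_min lexx orbT.
pose C : R := `|crd i : 'rV[R]_d| + `|crd j : 'rV[R]_d| + 1.
have C0 : 0 < C by rewrite ltr_wpDl // addr_ge0.
(* With this t every point of the parallelogram is at distance at most t C = r / 2 from x. *)
pose t := r / (2 * C).
have t0 : 0 < t by rewrite divr_gt0 // mulr_gt0.
have inr (a b : R) : 0 <= a <= t -> 0 <= b <= t -> ball x r (x + a *: crd i + b *: crd j).
  move=> /andP[a0 at_] /andP[b0 bt]; rewrite -ball_normE /= !opprD !addrA subrr sub0r.
  rewrite -opprD normrN (le_lt_trans (ler_normD _ _)) // !normrZ !ger0_norm //.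
  apply: (@le_lt_trans _ _ (t * C)).
    apply: (@le_trans _ _ (t * `|crd i : 'rV[R]_d| + t * `|crd j : 'rV[R]_d|)).
      by rewrite lerD // ler_wpM2r.
    by rewrite /C !mulrDr mulr1 lerDl ltW.
  by rewrite /t invfM mulrA mulfVK ?gt_eqF // ltr_pdivrMr // ltr_pMr // ltr1n.
have inr' (a b : R) : 0 <= a <= t -> 0 <= b <= t -> ball x r (x + a *: crd j + b *: crd i).
  by move=> ha hb; rewrite addrAC; exact: inr.
have [|a [b [aI bI E1]]] := @second_difference x (crd i) (crd j) t t0.
  move=> a b ha hb; have Uy := ball_r _ (inr a b ha hb).
  by split; [have [] := d1 _ Uy|have [] := d2 _ Uy].
have [|a' [b' [aI' bI' E2]]] := @second_difference x (crd j) (crd i) t t0.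
  move=> a' b' ha hb; have Uy := ball_r _ (inr' a' b' ha hb).
  by split; [have [] := d1 _ Uy|have [] := d2 _ Uy].
exists (x + a *: crd i + b *: crd j), (x + a' *: crd j + b' *: crd i).
split; [exact: re (inr a b aI bI)|exact: re (inr' a' b' aI' bI')|].
move: E1 E2; set A := 'D_(crd j) _ _; set B := 'D_(crd i) _ _; clearbody A B.
rewrite [x + t *: crd j + _]addrAC => E1 E2.
have E : t * (t * A) = t * (t * B) by rewrite -E1 -E2; ring.
exact: (mulfI (lt0r_neq0 t0) (mulfI (lt0r_neq0 t0) E)).
Qed.

End Schwarz.

Section MatrixDerivatives.
Context {R : realType} {d : nat}.
Implicit Types (x v : 'rV[R]_d).

Lemma is_derive_mxP {p q} (A : 'rV[R]_d -> 'M[R]_(p, q)) x v (dA : 'M[R]_(p, q)) :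
  is_derive x v A dA <-> forall i j, is_derive x v (fun y => A y i j) (dA i j).
Proof.
split=> [[dv <-] i j|H].
  by rewrite derive_mx // mxE; apply: derivableP; move/derivable_mxP : dv; apply.
have dv : derivable A x v by apply/derivable_mxP => i j; have [] := H i j.
split=> //; rewrite derive_mx //; apply/matrixP => i j.
by rewrite mxE; have [] := H i j.
Qed.

Lemma is_derive_big {W : normedModType R} (I : Type) (r : seq I) (F : I -> 'rV[R]_d -> W) x v
    (dF : I -> W) :
  (forall i, is_derive x v (F i) (dF i)) ->
  is_derive x v (fun y => \sum_(i <- r) F i y) (\sum_(i <- r) dF i).
Proof.
move=> H; elim: r => [|i r IH].
  rewrite big_nil (_ : (fun _ => _) = cst 0); first exact: is_derive_cst.
  by apply/funext => y; rewrite big_nil.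
rewrite big_cons (_ : (fun _ => _) = F i + (fun y => \sum_(i <- r) F i y)).
  exact: is_deriveD.
by apply/funext => y; rewrite big_cons.
Qed.

Lemma is_derive_mulmx {p q r} (A : 'rV[R]_d -> 'M[R]_(p, q)) (B : 'rV[R]_d -> 'M[R]_(q, r))
    x v dA dB : is_derive x v A dA -> is_derive x v B dB ->
  is_derive x v (fun y => A y *m B y) (dA *m B x + A x *m dB).
Proof.
move=> /is_derive_mxP HA /is_derive_mxP HB; apply/is_derive_mxP => i j.
rewrite (_ : (fun _ => _) = fun y => \sum_k A y i k * B y k j); last first.
  by apply/funext => y; rewrite mxE.
rewrite mxE !mxE -big_split /=; apply: is_derive_big => k.
have := is_deriveM (HA i k) (HB k j); rewrite addrC /GRing.scale /= [B x k j * _]mulrC.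
exact.
Qed.

Lemma is_derive_trmx {p q} (A : 'rV[R]_d -> 'M[R]_(p, q)) x v dA :
  is_derive x v A dA -> is_derive x v (fun y => (A y)^T) dA^T.
Proof.
move=> /is_derive_mxP HA; apply/is_derive_mxP => i j; rewrite mxE.
by rewrite (_ : (fun _ => _) = fun y => A y j i) //; apply/funext => y; rewrite mxE.
Qed.

Lemma is_derive_scalemx {p q} (u : 'rV[R]_d -> R) (A : 'rV[R]_d -> 'M[R]_(p, q)) x v du dA :
  is_derive x v u du -> is_derive x v A dA ->
  is_derive x v (fun y => u y *: A y) (du *: A x + u x *: dA).
Proof.
move=> Hu /is_derive_mxP HA; apply/is_derive_mxP => i j; rewrite !mxE.
rewrite (_ : (fun _ => _) = fun y => u y * A y i j); last by apply/funext => y; rewrite mxE.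
by have := is_deriveM Hu (HA i j); rewrite addrC /GRing.scale /= [A x i j * _]mulrC.
Qed.

Lemma differentiable_mx {p q} (A : 'rV[R]_d -> 'M[R]_(p, q)) x :
  (forall i j, differentiable (fun y => A y i j) x) -> differentiable A x.
Proof.
move=> H; have -> : A = \sum_(ij : 'I_p * 'I_q) (fun y => A y ij.1 ij.2 *: (delta_mx ij.1 ij.2 : 'M[R]_(p,q))).
  apply/funext => y; rewrite fct_sumE /= [LHS]matrix_sum_delta pair_bigA /=.
  by [].
apply: (big_ind (fun g : 'rV[R]_d -> 'M[R]_(p, q) => differentiable g x)).
- exact: differentiable_cst.
- by move=> g h; exact: differentiableD.
- by move=> [i j] _; apply: differentiableZl; exact: H.
Qed.

Lemma differentiable_mx_entry {p q} (A : 'rV[R]_d -> 'M[R]_(p, q)) x i j :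
  differentiable A x -> differentiable (fun y => A y i j : R) x.
Proof. by move=> dA; exact: (differentiable_comp dA (differentiable_coord _ i j)). Qed.

Lemma derive_comp {e} {W : normedModType R} (F : 'rV[R]_d -> 'rV[R]_e) (H : 'rV[R]_e -> W) x v :
  differentiable F x -> differentiable H (F x) ->
  is_derive x v (H \o F) ('D_('D_v F x) H (F x)).
Proof.
move=> dF dH; have dHF := differentiable_comp dF dH.
split; first exact: diff_derivable.
by rewrite deriveE // diff_comp // !deriveE.
Qed.

Lemma derive_linear {W : normedModType R} (f : 'rV[R]_d -> W) x : differentiable f x ->
  forall (a : R) u v, 'D_(a *: u + v) f x = a *: 'D_u f x + 'D_v f x.
Proof. by move=> df a u v; rewrite !deriveE // linearP. Qed.

Lemma deriveDv {W : normedModType R} (f : 'rV[R]_d -> W) x u v : differentiable f x ->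
  'D_(u + v) f x = 'D_u f x + 'D_v f x.
Proof. by move=> df; rewrite -[u]scale1r derive_linear // !scale1r. Qed.

Lemma deriveZv {W : normedModType R} (f : 'rV[R]_d -> W) x (a : R) u : differentiable f x ->
  'D_(a *: u) f x = a *: 'D_u f x.
Proof. by move=> df; rewrite -[a *: u]addr0 derive_linear // derive0 addr0. Qed.

Lemma rV_sum_coord v : v = \sum_i v 0 i *: crd i.
Proof. exact: row_sum_delta. Qed.

Lemma derive_coord {W : normedModType R} (f : 'rV[R]_d -> W) x v : differentiable f x ->
  'D_v f x = \sum_i v 0 i *: 'D_(crd i) f x.
Proof.
move=> df; rewrite {1}(rV_sum_coord v).
elim/big_ind2: _ => [|a u b w <- <-|i _]; first by rewrite derive0.
  by rewrite deriveDv.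
by rewrite deriveZv.
Qed.

End MatrixDerivatives.

Section Smoothness.
Context {R : realType} {d : nat}.
Implicit Types (x v : 'rV[R]_d) (U : set 'rV[R]_d).

(** A finite-order form of [smooth_on]: the derivative of a product, inverse, root or composite is
    built from functions already known at order k - 1, so closure goes by induction on the order. *)
Fixpoint Ck {W : normedModType R} (k : nat) U (f : 'rV[R]_d -> W) : Prop :=
  (forall x, U x -> {for x, continuous f}) /\
  if k is k'.+1 then
    forall i, (forall x, U x -> derivable f x (crd i)) /\ Ck k' U ('D_(crd i) f)
  else True.

Lemma smooth_onS {W : normedModType R} U (f : 'rV[R]_d -> W) : smooth_on U f ->
  [/\ forall x, U x -> {for x, continuous f},
      forall i x, U x -> derivable f x (crd i) &
      forall i, smooth_on U ('D_(crd i) f)].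
Proof.
move=> sf; split=> [x Ux|i x Ux|i s x Ux]; first by have [] := sf [::] x Ux.
  by have [_] := sf [::] x Ux; exact.
have -> : iter_partial s ('D_(crd i) f) = iter_partial (rcons s i) f.
  by rewrite /iter_partial foldr_rcons.
exact: sf.
Qed.

Lemma smooth_onP {W : normedModType R} U (f : 'rV[R]_d -> W) :
  smooth_on U f <-> forall k, Ck k U f.
Proof.
split=> [sf k|].
  elim: k f sf => [|k IH] f /smooth_onS[cf df sf]; split=> // i.
  by split; [exact: df|exact: IH].
(* [foldr] applies the last index first, so the derivative peeled off f sits at the end of the
   list. *)
move=> H s; elim/last_ind: s f H => [|s i IH] f H x Ux.
  by have [cf df] := H 1%N; split; [exact: cf|move=> i; have [+ _] := df i; exact].
have -> : iter_partial (rcons s i) f = iter_partial s ('D_(crd i) f).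
  by rewrite /iter_partial foldr_rcons.
by apply: IH => // k; have [_ /(_ i)[]] := H k.+1.
Qed.

Lemma Ck_continuous {W : normedModType R} k U (f : 'rV[R]_d -> W) :
  Ck k U f -> forall x, U x -> {for x, continuous f}.
Proof. by case: k => [|k] []. Qed.

Lemma CkS {W : normedModType R} k U (f : 'rV[R]_d -> W) : Ck k.+1 U f -> Ck k U f.
Proof.
elim: k f => [|k IH] f [cf df]; split=> // i; have [d1 d2] := df i.
by split => //; exact: IH.
Qed.

Lemma Ck1 {W : normedModType R} k U (f : 'rV[R]_d -> W) : Ck k.+1 U f -> Ck 1 U f.
Proof. by elim: k => // k IH /CkS. Qed.

Lemma near_eq_continuous {W : normedModType R} (f g : 'rV[R]_d -> W) x :
  (\near x, f x = g x) -> {for x, continuous f} -> {for x, continuous g}.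
Proof.
move=> fg cf; have E : f x = g x := nbhs_singleton fg.
suff : g @ x --> g x by [].
by rewrite -E; exact: (cvg_trans (near_eq_cvg fg) cf).
Qed.

Section Open.
Variable U : set 'rV[R]_d.
Hypothesis oU : open U.

Lemma open_near_eq {W : normedModType R} (f g : 'rV[R]_d -> W) :
  (forall x, U x -> f x = g x) -> forall x, U x -> \near x, f x = g x.
Proof.
move=> fg x Ux; have := open_nbhs_nbhs (conj oU Ux).
by apply: filterS => y; exact: fg.
Qed.

Lemma Ck_eq {W : normedModType R} k (f g : 'rV[R]_d -> W) :
  (forall x, U x -> f x = g x) -> Ck k U f -> Ck k U g.
Proof.
elim: k f g => [|k IH] f g fg [cf df]; split=> //.
- by move=> x Ux; apply: near_eq_continuous (open_near_eq fg Ux) (cf x Ux).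
- by move=> x Ux; apply: near_eq_continuous (open_near_eq fg Ux) (cf x Ux).
move=> i; have [d1 d2] := df i; split.
  by move=> x Ux; apply: near_eq_derivable (open_near_eq fg Ux) (d1 x Ux).
apply: IH d2 => x Ux; exact: near_eq_derive (open_near_eq fg Ux).
Qed.

Lemma Ck_cst {W : normedModType R} k (a : W) : Ck k U (cst a).
Proof.
elim: k a => [|k IH] a; split=> //.
- by move=> x _; exact: cst_continuous.
- by move=> x _; exact: cst_continuous.
move=> i; split; first by move=> x _; exact: derivable_cst.
by apply: Ck_eq (IH 0) => x _; rewrite derive_cst.
Qed.

Lemma CkD {W : normedModType R} k (f g : 'rV[R]_d -> W) : Ck k U f -> Ck k U g ->
  Ck k U (fun x => f x + g x).
Proof.
elim: k f g => [|k IH] f g [cf df] [cg dg].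
  by split=> // x Ux; apply: (continuousD (cf x Ux) (cg x Ux)).
split=> [x Ux|i]; first by apply: (continuousD (cf x Ux) (cg x Ux)).
have [df1 df2] := df i; have [dg1 dg2] := dg i; split.
  by move=> x Ux; apply: (derivableD (df1 x Ux) (dg1 x Ux)).
apply: Ck_eq (IH _ _ df2 dg2) => x Ux.
by rewrite [RHS](deriveD (df1 x Ux) (dg1 x Ux)).
Qed.

Lemma CkM k (f g : 'rV[R]_d -> R) : Ck k U f -> Ck k U g ->
  Ck k U (fun x => f x * g x).
Proof.
elim: k f g => [|k IH] f g.
  move=> [cf df] [cg dg]; split=> // x Ux.
  by have := @continuousM _ _ f g x (cf x Ux) (cg x Ux).
move=> /[dup] /CkS Cf [cf df] /[dup] /CkS Cg [cg dg].
split=> [x Ux|i].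
  by have := @continuousM _ _ f g x (cf x Ux) (cg x Ux).
have [df1 df2] := df i; have [dg1 dg2] := dg i; split.
  by move=> x Ux; apply: (derivableM (df1 x Ux) (dg1 x Ux)).
apply: Ck_eq (CkD (IH _ _ Cf dg2) (IH _ _ Cg df2)) => x Ux.
by rewrite [RHS](deriveM (df1 x Ux) (dg1 x Ux)).
Qed.

Lemma Ck_sum {W : normedModType R} k (I : Type) (r : seq I) (P : pred I)
    (F : I -> 'rV[R]_d -> W) : (forall i, P i -> Ck k U (F i)) ->
  Ck k U (fun x => \sum_(i <- r | P i) F i x).
Proof.
move=> H; elim: r => [|i r IH].
  by apply: Ck_eq (Ck_cst k 0) => x _; rewrite big_nil.
case Pi : (P i); last by apply: Ck_eq IH => x _; rewrite big_cons Pi.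
by apply: Ck_eq (CkD (H i Pi) IH) => x _; rewrite big_cons Pi.
Qed.

Lemma Ck_prod k (I : Type) (r : seq I) (F : I -> 'rV[R]_d -> R) :
  (forall i, Ck k U (F i)) -> Ck k U (fun x => \prod_(i <- r) F i x).
Proof.
move=> H; elim: r => [|i r IH].
  apply: (Ck_eq (f := cst (1 : R))); last exact: Ck_cst.
  by move=> x _; rewrite big_nil.
by apply: Ck_eq (CkM (H i) IH) => x _; rewrite big_cons.
Qed.

Lemma continuous_mxP {p q} (A : 'rV[R]_d -> 'M[R]_(p, q)) x :
  {for x, continuous A} <-> forall i j, {for x, continuous (fun y => A y i j)}.
Proof.
split=> [cA i j|cA].
  apply: (@continuous_comp _ _ _ A (fun M : 'M[R]_(p, q) => M i j : R) x cA).
  exact: coord_continuous.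
have -> : A = \sum_(ij : 'I_p * 'I_q)
    (fun y => A y ij.1 ij.2 *: (delta_mx ij.1 ij.2 : 'M[R]_(p,q))).
  by apply/funext => y; rewrite fct_sumE /= [LHS]matrix_sum_delta pair_bigA.
apply: (big_ind (fun g : 'rV[R]_d -> 'M[R]_(p, q) => {for x, continuous g})).
- exact: cst_continuous.
- by move=> g h cg ch; apply: continuousD.
- by move=> [i j] _; apply: continuousZl; exact: cA.
Qed.

Lemma Ck_mxP {p q} k (A : 'rV[R]_d -> 'M[R]_(p, q)) :
  Ck k U A <-> forall i j, Ck k U (fun x => A x i j).
Proof.
elim: k A => [|k IH] A.
  split=> [[cA _] i j|H]; split=> // x Ux.
    by move/continuous_mxP : (cA x Ux) => /(_ i j).
  by apply/continuous_mxP => i j; have [+ _] := H i j; exact.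
split=> [[cA dA] i j|H]; split.
- by move=> x Ux; move/continuous_mxP : (cA x Ux) => /(_ i j).
- move=> l; have [d1 d2] := dA l; split.
    by move=> x Ux; move/derivable_mxP : (d1 x Ux); exact.
  move/IH : d2 => /(_ i j); apply: Ck_eq => x Ux.
  by rewrite derive_mx ?mxE //; exact: d1.
- by move=> x Ux; apply/continuous_mxP => i j; have [+ _] := H i j; exact.
move=> l; have d1 x : U x -> derivable A x (crd l).
  by move=> Ux; apply/derivable_mxP => i j; have [_ /(_ l)[+ _]] := H i j; exact.
split => //; apply/IH => i j; have [_ /(_ l)[_]] := H i j; apply: Ck_eq => x Ux.
by rewrite derive_mx ?mxE //; exact: d1.
Qed.

Lemma Ck_differentiable (f : 'rV[R]_d -> R) : Ck 1 U f -> forall x, U x -> differentiable f x.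
Proof.
move=> [cf df] x Ux; apply: (C1_differentiable oU) Ux => y i Uy.
  by have [+ _] := df i; exact.
by have [_ []] := df i; move/(_ y Uy).
Qed.

Lemma Ck_mx_differentiable {p q} (A : 'rV[R]_d -> 'M[R]_(p, q)) :
  Ck 1 U A -> forall x, U x -> differentiable A x.
Proof.
move=> /Ck_mxP H x Ux; apply: differentiable_mx => i j.
exact: Ck_differentiable (H i j) x Ux.
Qed.

Lemma CkV k (f : 'rV[R]_d -> R) : (forall x, U x -> f x != 0) -> Ck k U f ->
  Ck k U (fun x => (f x)^-1).
Proof.
move=> f0; elim: k => [|k IH]; first by move=> [cf _]; split=> // x Ux;
  apply: continuousV (f0 x Ux) (cf x Ux).
move=> /[dup] /CkS /IH Cf [cf df]; split=> [x Ux|i].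
  exact: continuousV (f0 x Ux) (cf x Ux).
have [df1 df2] := df i; split.
  by move=> x Ux; apply: derivableV (f0 x Ux) (df1 x Ux).
apply: (Ck_eq _ (CkM (@Ck_cst R k (- 1)) (CkM (CkM Cf Cf) df2))) => x Ux.
rewrite [RHS](deriveV (f0 x Ux) (df1 x Ux)) /GRing.scale /=.
by rewrite mulN1r mulNr expr2 invfM.
Qed.

(** Needed to normalise frame vectors. The derivative Df / (2 sqrt f) involves sqrt f only at the
    previous order. *)
Lemma Ck_sqrt k (f : 'rV[R]_d -> R) : (forall x, U x -> 0 < f x) -> Ck k U f ->
  Ck k U (fun x => Num.sqrt (f x)).
Proof.
move=> f0.
have csq x : U x -> {for x, continuous f} -> {for x, continuous (fun x => Num.sqrt (f x))}.
  by move=> Ux cf; apply: (continuous_comp cf); exact: sqrt_continuous.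
elim: k => [|k IH]; first by move=> [cf _]; split=> // x Ux; exact: csq (cf x Ux).
move=> H; have Cf := IH (CkS H); have [cf df] := H.
split=> [x Ux|i]; first exact: csq (cf x Ux).
have dsq x : U x -> is_derive x (crd i) (fun x => Num.sqrt (f x))
     ((2 * Num.sqrt (f x))^-1 * 'D_(crd i) f x).
  move=> Ux; have dfx := Ck_differentiable (Ck1 H) Ux.
  have ds := is_derive1_sqrt (f0 x Ux).
  have dS : differentiable (Num.sqrt : R -> R) (f x) by apply/derivable1_diffP; case: ds.
  have dc := differentiable_comp dfx dS.
  split; first exact: diff_derivable.
  have E (c : R) : 'd (Num.sqrt : R -> R) (f x) c = c * (2 * Num.sqrt (f x))^-1.
    rewrite -[c in LHS]mulr1 -[c * 1]/(c *: (1 : R)) linearZ /=; congr (_ * _).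
    by rewrite -deriveE // derive_val.
  by rewrite deriveE // diff_comp //= E mulrC deriveE.
split; first by move=> x /dsq [].
have [_ df2] := df i.
have nz x : U x -> 2 * Num.sqrt (f x) != 0.
  by move=> Ux; rewrite mulf_neq0 // gt_eqF // sqrtr_gt0 f0.
have CV := CkV nz (CkM (@Ck_cst R k 2) Cf).
by apply: Ck_eq (CkM CV df2) => x Ux; have [_ ->] := dsq x Ux.
Qed.

End Open.

End Smoothness.

Section SmoothComp.
Context {R : realType} {d e : nat}.
Variables (U : set 'rV[R]_d) (V : set 'rV[R]_e).
Hypotheses (oU : open U) (oV : open V).
Variable F : 'rV[R]_d -> 'rV[R]_e.
Hypothesis FUV : forall x, U x -> V (F x).

Lemma Ck_comp k (g : 'rV[R]_e -> R) : Ck k V g -> Ck k U F -> Ck k U (g \o F).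
Proof.
have cc (h : 'rV[R]_e -> R) : (forall y, V y -> {for y, continuous h}) ->
    (forall x, U x -> {for x, continuous F}) ->
    forall x, U x -> {for x, continuous (h \o F)}.
  by move=> ch cF x Ux; exact: (continuous_comp (cF x Ux) (ch _ (FUV Ux))).
elim: k g => [|k IH] g Cg CF.
  by split=> //; exact: cc (Ck_continuous Cg) (Ck_continuous CF).
split=> [|i]; first exact: cc (Ck_continuous Cg) (Ck_continuous CF).
have dF := Ck_mx_differentiable oU (Ck1 CF).
have dg := Ck_differentiable oV (Ck1 Cg).
have dgF x : U x -> is_derive x (crd i) (g \o F) ('D_('D_(crd i) F x) g (F x)).
  by move=> Ux; apply: derive_comp (dF x Ux) (dg _ (FUV Ux)).
split; first by move=> x /dgF [].
have [_ /(_ i)[_ /(Ck_mxP oU) CDF]] := CF.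
have CDg j : Ck k U ('D_(crd j) g \o F).
  by apply: IH (CkS CF); have [_ /(_ j)[]] := Cg.
apply: Ck_eq (Ck_sum oU (index_enum _) (P := xpredT)
  (fun j _ => CkM oU (CDF 0 j) (CDg j))) => // x Ux.
by have [_ ->] := dgF x Ux; rewrite (derive_coord _ (dg _ (FUV Ux))).
Qed.

End SmoothComp.

Section SmoothOn.
Context {R : realType} {d : nat}.
Variable U : set 'rV[R]_d.
Hypothesis oU : open U.

Lemma smooth_eq {W : normedModType R} (f g : 'rV[R]_d -> W) :
  (forall x, U x -> f x = g x) -> smooth_on U f -> smooth_on U g.
Proof. by move=> fg /smooth_onP H; apply/smooth_onP => k; exact: Ck_eq (H k). Qed.

Lemma smooth_sub {W : normedModType R} (V : set 'rV[R]_d) (f : 'rV[R]_d -> W) :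
  V `<=` U -> smooth_on U f -> smooth_on V f.
Proof. by move=> VU sf s x /VU; exact: sf. Qed.

Lemma smooth_cst {W : normedModType R} (a : W) : smooth_on U (fun=> a).
Proof. by apply/smooth_onP => k; exact: Ck_cst. Qed.

Lemma smoothD {W : normedModType R} (f g : 'rV[R]_d -> W) :
  smooth_on U f -> smooth_on U g -> smooth_on U (fun x => f x + g x).
Proof.
by move=> /smooth_onP Hf /smooth_onP Hg; apply/smooth_onP => k; exact: CkD.
Qed.

Lemma smooth_sum {W : normedModType R} (I : Type) (r : seq I) (P : pred I)
    (F : I -> 'rV[R]_d -> W) : (forall i, P i -> smooth_on U (F i)) ->
  smooth_on U (fun x => \sum_(i <- r | P i) F i x).
Proof.
move=> H; apply/smooth_onP => k; apply: Ck_sum => // i Pi.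
by move/smooth_onP : (H i Pi).
Qed.

Lemma smoothM (f g : 'rV[R]_d -> R) :
  smooth_on U f -> smooth_on U g -> smooth_on U (fun x => f x * g x).
Proof.
by move=> /smooth_onP Hf /smooth_onP Hg; apply/smooth_onP => k; exact: CkM.
Qed.

Lemma smoothV (f : 'rV[R]_d -> R) : (forall x, U x -> f x != 0) ->
  smooth_on U f -> smooth_on U (fun x => (f x)^-1).
Proof. by move=> f0 /smooth_onP Hf; apply/smooth_onP => k; exact: CkV. Qed.

Lemma smooth_sqrt (f : 'rV[R]_d -> R) : (forall x, U x -> 0 < f x) ->
  smooth_on U f -> smooth_on U (fun x => Num.sqrt (f x)).
Proof. by move=> f0 /smooth_onP Hf; apply/smooth_onP => k; exact: Ck_sqrt. Qed.

Lemma smooth_mxP {p q} (A : 'rV[R]_d -> 'M[R]_(p, q)) :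
  smooth_on U A <-> forall i j, smooth_on U (fun x => A x i j).
Proof.
split=> [/smooth_onP H i j|H].
  by apply/smooth_onP => k; move/(Ck_mxP oU) : (H k); exact.
apply/smooth_onP => k; apply/(Ck_mxP oU) => i j.
by move/smooth_onP : (H i j).
Qed.

Lemma smooth_mulmx {p q r} (A : 'rV[R]_d -> 'M[R]_(p, q)) (B : 'rV[R]_d -> 'M[R]_(q, r)) :
  smooth_on U A -> smooth_on U B -> smooth_on U (fun x => A x *m B x).
Proof.
move=> /smooth_mxP sA /smooth_mxP sB; apply/smooth_mxP => i j.
apply: (smooth_eq (f := fun x => \sum_k A x i k * B x k j)).
  by move=> x _; rewrite mxE.
by apply: smooth_sum => k _; exact: smoothM.
Qed.

Lemma smooth_trmx {p q} (A : 'rV[R]_d -> 'M[R]_(p, q)) :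
  smooth_on U A -> smooth_on U (fun x => (A x)^T).
Proof.
move=> /smooth_mxP sA; apply/smooth_mxP => i j.
by apply: smooth_eq (sA j i) => x _; rewrite mxE.
Qed.

Lemma smooth_scalemx {p q} (u : 'rV[R]_d -> R) (A : 'rV[R]_d -> 'M[R]_(p, q)) :
  smooth_on U u -> smooth_on U A -> smooth_on U (fun x => u x *: A x).
Proof.
move=> su /smooth_mxP sA; apply/smooth_mxP => i j.
by apply: smooth_eq (smoothM su (sA i j)) => x _; rewrite mxE.
Qed.

Lemma smooth_det {n} (A : 'rV[R]_d -> 'M[R]_n) :
  smooth_on U A -> smooth_on U (fun x => \det (A x)).
Proof.
move=> /smooth_mxP sA; apply: smooth_sum => s _; apply: smoothM.
  exact: smooth_cst.
apply/smooth_onP => k; apply: Ck_prod => // i.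
by move/smooth_onP : (sA i (s i)).
Qed.

Lemma smooth_invmx {n} (A : 'rV[R]_d -> 'M[R]_n) :
  (forall x, U x -> A x \in unitmx) -> smooth_on U A -> smooth_on U (fun x => invmx (A x)).
Proof.
move=> uA sA; apply: (smooth_eq (f := fun x => (\det (A x))^-1 *: \adj (A x))).
  by move=> x Ux; rewrite /invmx uA.
apply: smooth_scalemx.
  apply: smoothV (smooth_det sA) => x /uA; by rewrite unitmxE unitfE.
apply/smooth_mxP => i j.
apply: (smooth_eq (f := fun x => (-1) ^+ (j + i) * \det (row' j (col' i (A x))))).
  by move=> x _; rewrite !mxE.
apply: smoothM; first exact: smooth_cst.
apply: smooth_det; apply/smooth_mxP => a b.
move/smooth_mxP : sA => /(_ (lift j a) (lift i b)).
by apply: smooth_eq => x _; rewrite !mxE.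
Qed.

Lemma smooth_derive {W : normedModType R} (f : 'rV[R]_d -> W) (i : 'I_d) :
  smooth_on U f -> smooth_on U ('D_(crd i) f).
Proof. by move=> /smooth_onS[]. Qed.

Lemma smooth_differentiable {p q} (A : 'rV[R]_d -> 'M[R]_(p, q)) x :
  smooth_on U A -> U x -> differentiable A x.
Proof. by move=> /smooth_onP/(_ 1%N) H; exact: Ck_mx_differentiable. Qed.

Lemma smooth_fun_differentiable (f : 'rV[R]_d -> R) x :
  smooth_on U f -> U x -> differentiable f x.
Proof. by move=> /smooth_onP/(_ 1%N) H; exact: Ck_differentiable. Qed.

Lemma smooth_jacobian {e} (F : 'rV[R]_d -> 'rV[R]_e) :
  smooth_on U F -> smooth_on U (jacobian F).
Proof.
move=> sF; apply/smooth_mxP => i j.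
have /smooth_mxP/(_ 0 j) := smooth_derive i sF.
apply: smooth_eq => x Ux; rewrite deriveEjacobian; last exact: smooth_differentiable.
by rewrite /Defs.coord -rowE mxE.
Qed.

Lemma Schwarz (f : 'rV[R]_d -> R) x u v : smooth_on U f -> U x ->
  'D_u ('D_v f) x = 'D_v ('D_u f) x.
Proof.
move=> sf Ux.
have E w : forall y, U y -> 'D_w f y = \sum_i w 0 i * 'D_(crd i) f y.
  by move=> y Uy; rewrite (derive_coord _ (smooth_fun_differentiable sf Uy)).
have EE w z : 'D_z ('D_w f) x =
    \sum_i \sum_j w 0 i * (z 0 j * 'D_(crd j) ('D_(crd i) f) x).
  rewrite (near_eq_derive _ (open_near_eq oU (E w) Ux)).
  have D i : is_derive x z (fun y => w 0 i * 'D_(crd i) f y) (w 0 i * 'D_z ('D_(crd i) f) x).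
    apply: is_deriveZ; apply: derivableP.
    by apply: diff_derivable; apply: smooth_fun_differentiable (smooth_derive _ sf) Ux.
  have [_ ->] := is_derive_big (index_enum _) D.
  apply: eq_bigr => i _; rewrite -mulr_sumr; congr (_ * _).
  by rewrite (derive_coord _ (smooth_fun_differentiable (smooth_derive _ sf) Ux)).
rewrite !EE exchange_big /=; apply: eq_bigr => i _; apply: eq_bigr => j _.
suff -> : 'D_(crd i) ('D_(crd j) f) x = 'D_(crd j) ('D_(crd i) f) x by rewrite mulrCA.
have [_ d1 s1] := smooth_onS sf.
apply: (Schwarz_coord oU Ux).
- by move=> y Uy; split; exact: d1.
- by move=> y Uy; split; [have [_ + _] := smooth_onS (s1 j)|have [_ + _] := smooth_onS (s1 i)]; exact.
- by have [_ _ /(_ i) /smooth_onS[+ _ _]] := smooth_onS (s1 j); exact.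
- by have [_ _ /(_ j) /smooth_onS[+ _ _]] := smooth_onS (s1 i); exact.
Qed.

Lemma smooth_derivev (f : 'rV[R]_d -> R) v : smooth_on U f -> smooth_on U ('D_v f).
Proof.
move=> sf; have := smooth_sum (index_enum 'I_d) (P := xpredT)
  (fun i _ => smoothM (smooth_cst (v 0 i)) (smooth_derive i sf)).
apply: smooth_eq => y Uy.
by rewrite (derive_coord _ (smooth_fun_differentiable sf Uy)).
Qed.

Lemma Schwarz_mx {p q} (A : 'rV[R]_d -> 'M[R]_(p, q)) x u v : smooth_on U A -> U x ->
  'D_u ('D_v A) x = 'D_v ('D_u A) x.
Proof.
move=> sA Ux; have sAe i j : smooth_on U (fun y => A y i j) by move/smooth_mxP : sA; exact.
have De w i j y : U y -> 'D_w A y i j = 'D_w (fun y => A y i j) y.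
  by move=> Uy; rewrite (derive_mx (diff_derivable (smooth_differentiable sA Uy))) mxE.
have sD w : smooth_on U ('D_w A).
  by apply/smooth_mxP => i j; apply: smooth_eq (smooth_derivev w (sAe i j)) => y /De ->.
have DDe w t i j : ('D_w ('D_t A) x) i j = 'D_w ('D_t (fun y => A y i j)) x.
  rewrite (derive_mx (diff_derivable (smooth_differentiable (sD t) Ux))) mxE.
  exact: (near_eq_derive w (open_near_eq oU (De t i j) Ux)).
apply/matrixP => i j; apply: (etrans (DDe u v i j)); apply: (etrans _ (esym (DDe v u i j))).
exact: (Schwarz u v (sAe i j) Ux).
Qed.

End SmoothOn.

Lemma smooth_comp {R : realType} {d e : nat} (U : set 'rV[R]_d) (V : set 'rV[R]_e)
    (F : 'rV[R]_d -> 'rV[R]_e) {p q} (A : 'rV[R]_e -> 'M[R]_(p, q)) :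
  open U -> open V -> (forall x, U x -> V (F x)) ->
  smooth_on V A -> smooth_on U F -> smooth_on U (A \o F).
Proof.
move=> oU oV UV /(smooth_mxP oV) sA /smooth_onP sF; apply/(smooth_mxP oU) => i j.
move/smooth_onP : (sA i j) => H; apply/smooth_onP => k.
by have := Ck_comp oU oV UV (H k) (sF k).
Qed.

Section LocallyConstant.
Context {R : realType}.

Lemma derive0_locally_constant {d e : nat} (U : set 'rV[R]_d) (F : 'rV[R]_d -> 'rV[R]_e) x :
  open U -> U x -> (forall y, U y -> differentiable F y) ->
  (forall y v, U y -> 'D_v F y = 0) -> \forall y \near x, F y = F x.
Proof.
move=> oU Ux dF F0.
have /nbhs_ballP[r /= r0 ball_r] : nbhs x U by exact: (open_nbhs_nbhs (conj oU Ux)).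
apply/nbhs_ballP; exists r => //= y By; apply/rowP => j.
have seg (s : R) : 0 <= s <= 1 -> U (x + s *: (y - x)).
  move=> /andP[s0 s1]; apply: ball_r; move: By; rewrite -!ball_normE /=.
  rewrite distrC opprD addrA subrr sub0r normrN => By.
  by rewrite normrZ ger0_norm // (le_lt_trans _ By) // ler_piMl.
have [|s s01] := @line_MVT R d (fun y => F y 0 j) x (y - x) 1 ltr01.
  move=> s s01; apply: diff_derivable; apply: differentiable_mx_entry.
  by apply: dF; exact: seg.
have Us : U (x + s *: (y - x)) by apply: seg; case/andP: s01 => *; rewrite !ltW.
have /is_derive_mxP/(_ 0 j)[_ ->] := derivableP (diff_derivable (v := y - x) (dF _ Us)).
by rewrite F0 // mxE mulr0 scale1r subrKC => /eqP; rewrite subr_eq0 => /eqP.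
Qed.

(** The level set of u through p is open, and so is its complement. *)
Lemma locally_constant {T : topologicalType} {Y : Type} (u : T -> Y) :
  connected [set: T] -> (forall p, \forall q \near p, u q = u p) -> is_constant u.
Proof.
move=> cT H p q; pose A := [set r | u r = u p].
suff : A = setT by move=> AT; have : A q by rewrite AT.
apply: cT.
- by exists p.
- exists A; rewrite ?setTI // openE => r /= Ar.
  by rewrite /interior; apply: filterS (H r) => s /= us; rewrite /A /= us.
- exists A; rewrite ?setTI //; rewrite -[A]setCK; apply: open_closedC; rewrite openE => r /= nAr.
  by rewrite /interior; apply: filterS (H r) => s /= us; rewrite /A /= us.
Qed.

End LocallyConstant.

(** * Almost contact and Hermitian algebra at a point *)

Section LinearFacts.
Context {R : pzRingType} {V W : lmodType R}.
Variable f : V -> W.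
Hypothesis lf : linear f.

Lemma lin0 : f 0 = 0.
Proof.
have := lf 1 0 0; rewrite !scale1r addr0 => /esym/eqP.
by rewrite -subr_eq0 addrK => /eqP.
Qed.
Lemma linZ a v : f (a *: v) = a *: f v.
Proof. by have := lf a v 0; rewrite !addr0 lin0 addr0. Qed.
Lemma linD u v : f (u + v) = f u + f v.
Proof. by have := lf 1 u v; rewrite !scale1r. Qed.
Lemma linN v : f (- v) = - f v.
Proof. by rewrite -!scaleN1r linZ. Qed.
Lemma lin_sum (I : Type) (r : seq I) (F : I -> V) : f (\sum_(i <- r) F i) = \sum_(i <- r) f (F i).
Proof. by elim/big_rec2: _ => [|i x y _ <-]; rewrite ?lin0 ?linD. Qed.
End LinearFacts.

Section BilinearForms.
Context {R : realFieldType} {V : lmodType R}.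
Variable g : V -> V -> R.

Record inner_product : Prop := InnerProduct {
  inner_linear : forall a u v w, g (a *: u + v) w = a * g u w + g v w;
  inner_sym : forall u v, g u v = g v u;
  inner_pos : forall v, v != 0 -> 0 < g v v }.

Hypothesis ig : inner_product.

Lemma innerDl u v w : g (u + v) w = g u w + g v w.
Proof. by rewrite -[u]scale1r (inner_linear ig) mul1r scale1r. Qed.
Lemma innerDr u v w : g w (u + v) = g w u + g w v.
Proof. by rewrite !(inner_sym ig w) innerDl. Qed.
Lemma inner0l w : g 0 w = 0.
Proof. by have := innerDl 0 0 w; rewrite addr0 => /esym/eqP; rewrite -subr_eq0 addrK => /eqP. Qed.
Lemma inner0r w : g w 0 = 0.
Proof. by rewrite (inner_sym ig) inner0l. Qed.
Lemma innerZl a u w : g (a *: u) w = a * g u w.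
Proof. by rewrite -[a *: u]addr0 (inner_linear ig) inner0l addr0. Qed.
Lemma innerZr a u w : g w (a *: u) = a * g w u.
Proof. by rewrite !(inner_sym ig w) innerZl. Qed.
Lemma innerNl u w : g (- u) w = - g u w.
Proof. by rewrite -scaleN1r innerZl mulN1r. Qed.
Lemma innerNr u w : g w (- u) = - g w u.
Proof. by rewrite !(inner_sym ig w) innerNl. Qed.
Lemma inner_suml (I : Type) (r : seq I) (F : I -> V) w :
  g (\sum_(i <- r) F i) w = \sum_(i <- r) g (F i) w.
Proof. by elim/big_rec2: _ => [|i x y _ <-]; rewrite ?inner0l ?innerDl. Qed.
Lemma inner_sumr (I : Type) (r : seq I) (F : I -> V) w :
  g w (\sum_(i <- r) F i) = \sum_(i <- r) g w (F i).
Proof. by elim/big_rec2: _ => [|i x y _ <-]; rewrite ?inner0r ?innerDr. Qed.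
Lemma inner_eq0 v : (g v v == 0) = (v == 0).
Proof.
have [->|v0] := eqVneq v 0; first by rewrite inner0l eqxx.
by rewrite gt_eqF // (inner_pos ig).
Qed.
Lemma inner_ge0 v : 0 <= g v v.
Proof. by have [->|/(inner_pos ig)/ltW//] := eqVneq v 0; rewrite inner0l. Qed.
Lemma inner_nondeg v : (forall w, g v w = 0) -> v = 0.
Proof. by move=> H; apply/eqP; rewrite -inner_eq0 H. Qed.

Definition innerE := (innerDl, innerDr, innerZl, innerZr, innerNl, innerNr, inner0l, inner0r).
End BilinearForms.

Section ContactAlgebra.
Context {R : realFieldType} {V : lmodType R}.
Variables (g : V -> V -> R) (p : V -> V) (z : V) (np : V -> V -> V) (nz : V -> V).

(* The pointwise values of g, phi, xi, nabla phi and nabla xi. *)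
Record contact_point : Prop := ContactPoint {
  cp_inner : inner_product g;
  cp_p : linear p;
  cp_pp : forall v, p (p v) = - v + g v z *: z;
  cp_gpp : forall v w, g (p v) (p w) = g v w - g v z * g w z;
  cp_zz : g z z = 1;
  cp_pz : p z = 0;
  cp_npl : forall w, linear (np ^~ w);
  cp_npr : forall v, linear (np v);
  cp_nz : linear nz;
  cp_skew : forall v w u, g (np v w) u = - g w (np v u);
  cp_npp : forall v w, np v (p w) + p (np v w) = g (nz v) w *: z + g w z *: nz v;
  cp_npz : forall v, np v z = - p (nz v);
  cp_nzz : forall v, g (nz v) z = 0 }.

Definition Pquad E := np E E + np (p E) (p E).
Definition xi_trace E := g (nz E) E + g (nz (p E)) (p E).
(** The value 2 d eta(v, w): for a torsion free connection the bracket term cancels and only nabla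
    xi remains. *)
Definition two_deta v w := g (nz v) w - g (nz w) v.
(** The cyclic sum of (nabla_v Omega)(w, u), which is g(w, (nabla_v phi) u) because nabla g = 0. *)
Definition dOmega v w u := g w (np v u) + g u (np w v) + g v (np u w).
(** Half of L_xi phi: the brackets in [xi, phi v] - phi [xi, v] are rewritten with a torsion free
    connection. *)
Definition htensor v := 2^-1 *: (np z v - nz (p v) + p (nz v)).

Hypothesis cp : contact_point.
Let ig := cp_inner cp.
Let iE := innerE ig.

(** Two computations of phi^3 v leave g(phi v, xi) xi = 0. *)
Lemma cp_gpz v : g (p v) z = 0.
Proof.
have E : p (p (p v)) = - p v.
  by rewrite [p (p v)](cp_pp cp) (linD (cp_p cp)) (linN (cp_p cp)) (linZ (cp_p cp)) (cp_pz cp) scaler0 addr0.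
have := cp_pp cp (p v); rewrite E => /eqP; rewrite eq_sym addrC -subr_eq0 opprK addrNK.
move=> /eqP/(congr1 (g ^~ z)); by rewrite !iE (cp_zz cp) mulr1.
Qed.

Lemma cp_gskew v w : g (p v) w = - g v (p w).
Proof.
have := cp_gpp cp v (p w); rewrite (cp_pp cp) !iE !cp_gpz !mulr0; lra.
Qed.

Lemma cp_ppE v : g v z = 0 -> p (p v) = - v.
Proof. by move=> vz; rewrite (cp_pp cp) vz scale0r addr0. Qed.

(** For w orthogonal to xi, the derivative of phi^2 at w is a multiple of xi. So nabla_v phi
    anticommutes with phi up to xi, and pairing with phi u leaves a sign. *)
Lemma cp_npp_perp v w u : g w z = 0 -> g u z = 0 -> g (np v (p w)) (p u) = - g (np v w) u.
Proof.
move=> wz uz; have := congr1 (g ^~ (p u)) (cp_npp cp v w).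
rewrite !iE wz [g z _](inner_sym ig) cp_gpz (cp_gpp cp) uz; lra.
Qed.

Lemma cp_np_p v E : g E z = 0 -> g E (np v (p E)) = 0.
Proof.
move=> Ez; have := congr1 (g ^~ E) (cp_npp cp v E).
rewrite !iE Ez [g z E](inner_sym ig) Ez cp_gskew (cp_skew cp) (inner_sym ig (p E)).
rewrite (cp_skew cp) => H; have := cp_skew cp v E (p E); rewrite [g _ E](inner_sym ig) in H *; lra.
Qed.

Lemma cp_npz_inner v w : g (np v w) z = - g (p w) (nz v).
Proof. by rewrite (cp_skew cp) (cp_npz cp) iE cp_gskew; ring. Qed.

(** By skewness only (nabla_v phi) xi = - phi nabla_v xi enters the component along xi. *)
Lemma Pquad_xi E : g E z = 0 -> g (Pquad E) z = - two_deta E (p E).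
Proof.
move=> Ez; rewrite /Pquad iE !cp_npz_inner (cp_ppE Ez) iE /two_deta.
by rewrite [g (nz E) _](inner_sym ig) [g (nz (p E)) _](inner_sym ig); ring.
Qed.

(** One term of the cyclic sum vanishes by [cp_np_p]; the other two become the two terms of P
    because nabla phi anticommutes with phi. Every class with closed Omega rests on this
    identity. *)
Lemma Pquad_dOmega E Z : g E z = 0 -> g Z z = 0 ->
  g (Pquad E) Z = dOmega E (p E) (p Z).
Proof.
move=> Ez Zz; rewrite /Pquad /dOmega cp_np_p // iE addr0 [g (p E) (np _ _)](inner_sym ig).
have -> : g (np E (p Z)) (p E) = g (np E E) Z.
  by rewrite cp_npp_perp // (cp_skew cp) opprK (inner_sym ig).
rewrite [g (p Z) _](inner_sym ig).
have := @cp_npp_perp (p E) (p E) Z (cp_gpz _) Zz; rewrite (cp_ppE Ez) (linN (cp_npr cp _)) iE; lra.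
Qed.

(** The term differentiated along xi vanishes; the two others pair (nabla phi) with xi and so
    express nabla xi on the plane of E and phi E. *)
Lemma xi_trace_dOmega E : g E z = 0 -> dOmega z E (p E) = - xi_trace E.
Proof.
move=> Ez; rewrite /dOmega cp_np_p // (cp_npz cp) iE [g z _](inner_sym ig) cp_npz_inner.
rewrite (cp_gpp cp) Ez mul0r subr0 /xi_trace (inner_sym ig (p E)) (inner_sym ig E); ring.
Qed.

(** As xi has unit length, nabla_v xi is orthogonal to xi, and 2 d eta(xi, v) is just g(nabla_xi xi,
    v). *)
Lemma xi_geodesic : (forall v, two_deta z v = 0) -> nz z = 0.
Proof.
move=> H; apply: (inner_nondeg ig) => w.
by have := H w; rewrite /two_deta (cp_nzz cp) subr0.
Qed.

Lemma cp_decomp v : v = - p (p v) + g v z *: z.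
Proof. by rewrite (cp_pp cp) opprD opprK -addrA addNr addr0. Qed.

Lemma cp_perp0 v : (forall w, g w z = 0 -> g v w = 0) -> v = g v z *: z.
Proof.
move=> H; apply/eqP; rewrite -subr_eq0 -(inner_eq0 ig) !iE.
set c := g v z; have := H (v - c *: z); rewrite !iE (cp_zz cp) -/c => ->; last by ring.
by rewrite (inner_sym ig z) -/c; apply/eqP; ring.
Qed.

(* The consequences of the class hypotheses on N that the tension field of a
   holomorphic map into N depends on. *)
Definition Pquad_along_xi := forall E, g E z = 0 -> exists c, Pquad E = c *: z.

Definition contact_like :=
  [/\ nz z = 0, Pquad_along_xi & forall E, g E z = 0 -> xi_trace E = 0].

Lemma closed_Pquad : (forall u v w, dOmega u v w = 0) -> Pquad_along_xi.
Proof.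
move=> H E Ez; exists (g (Pquad E) z); apply: cp_perp0 => w wz.
by rewrite Pquad_dOmega.
Qed.

Lemma closed_xi_trace : (forall u v w, dOmega u v w = 0) ->
  forall E, g E z = 0 -> xi_trace E = 0.
Proof. by move=> H E /xi_trace_dOmega; rewrite H => /esym/eqP; rewrite oppr_eq0 => /eqP. Qed.

Lemma geodesic_contact_like : (forall u v w, dOmega u v w = 0) -> nz z = 0 -> contact_like.
Proof. by move=> H H'; split=> //; [exact: closed_Pquad|exact: closed_xi_trace]. Qed.

Lemma almost_cosymplectic_point : (forall u v w, dOmega u v w = 0) ->
  (forall v w, two_deta v w = 0) ->
  forall E, g E z = 0 -> Pquad E = 0 /\ xi_trace E = 0.
Proof.
move=> H H' E Ez; split; last exact: closed_xi_trace.
rewrite (cp_perp0 (v := Pquad E)); last by move=> w wz; rewrite Pquad_dOmega.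
by rewrite Pquad_xi // H' oppr0 scale0r.
Qed.

Lemma nz_perp v : nz v = - p (p (nz v)).
Proof. by rewrite {1}(cp_decomp (nz v)) (cp_nzz cp) scale0r addr0. Qed.

(** The multiple of E disappears against phi E because phi is skew; the rest of nabla_{phi E} xi
    cancels nabla_E xi because phi is an isometry on the complement of xi. *)
Lemma xi_trace_of_Pxi (c : R) E : g E z = 0 ->
  nz (p E) = - p (nz E) + c *: E -> xi_trace E = 0.
Proof.
move=> Ez H; rewrite /xi_trace H !iE (cp_gpp cp) Ez mulr0 subr0.
by rewrite [g E (p E)](_ : _ = 0); [ring|have := cp_gskew E E; rewrite (inner_sym ig (p E)); lra].
Qed.

Lemma nearly_cosymplectic_point : (forall v, np v v = 0) ->
  forall E, g E z = 0 -> Pquad E = 0 /\ xi_trace E = 0.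
Proof.
move=> H E Ez; split; first by rewrite /Pquad !H addr0.
have H2 v w : np v w = - np w v.
  apply/eqP; rewrite -subr_eq0 opprK; have := H (v + w).
  rewrite (linD (cp_npr cp _)) !(linD (cp_npl cp _)) !H add0r addr0 => /eqP.
  by rewrite addrC.
(* After polarisation (nabla_xi phi) F = phi nabla_F xi, and its pairing with phi F is zero by
   [cp_np_p]. *)
have key F : g F z = 0 -> g (nz F) F = 0.
  move=> Fz; have : g (np z F) (p F) = 0.
    by have := cp_skew cp z F (p F); rewrite cp_np_p // oppr0.
  by rewrite H2 (cp_npz cp) opprK (cp_gpp cp) Fz mulr0 subr0.
by rewrite /xi_trace key // key ?addr0 // cp_gpz.
Qed.

Lemma quasi_K_cosymplectic_point :
  (forall v w, np v w + np (p v) (p w) = g w z *: nz (p v)) ->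
  forall E, g E z = 0 -> Pquad E = 0 /\ xi_trace E = 0.
Proof.
move=> H E Ez; split; first by rewrite /Pquad H Ez scale0r.
apply: (@xi_trace_of_Pxi 0) => //.
have := H E z; rewrite (cp_pz cp) (lin0 (cp_npr cp _)) addr0 (cp_npz cp) (cp_zz cp) scale1r => <-.
by rewrite scale0r addr0.
Qed.

Lemma quasi_K_sasakian_point :
  (forall v w, np v w + np (p v) (p w) =
    (2 * g v w) *: z - (2 * g w z) *: v + g w z *: nz (p v)) ->
  contact_like.
Proof.
move=> H; have Hz v := H v z.
have zz0 : nz z = 0.
  have := Hz z; rewrite (cp_pz cp) (lin0 (cp_npr cp _)) addr0 (cp_npz cp) (cp_zz cp).
  rewrite (lin0 (cp_nz cp)) scaler0 addr0 subrr => /eqP; rewrite oppr_eq0 => /eqP E.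
  by rewrite nz_perp E (lin0 (cp_p cp)) oppr0.
split=> // E Ez.
  by exists (2 * g E E); rewrite /Pquad H Ez mulr0 !scale0r subr0 addr0.
(* The class identity at w = xi reads nabla_{phi E} xi = - phi nabla_E xi + 2 E. *)
apply: (@xi_trace_of_Pxi 2) => //.
have := Hz E; rewrite (cp_pz cp) (lin0 (cp_npr cp _)) addr0 (cp_npz cp) (cp_zz cp).
by rewrite Ez !mulr0 mulr1 scale0r scale1r sub0r addrC => ->; rewrite addrNK.
Qed.

(** At w = xi the identity becomes phi nabla_F xi = F + h F for F orthogonal to xi. The trace of
    nabla xi is then g(h E, phi E) - g(h phi E, E), which vanishes since h anticommutes with phi. *)
Lemma quasi_contact_point :
  (forall v w, np v w + np (p v) (p w) =
    (2 * g v w) *: z - g w z *: (v + g v z *: z + htensor v)) ->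
  contact_like.
Proof.
move=> H; have Hz v := H v z.
have zz0 : nz z = 0.
  have := Hz z; rewrite (cp_pz cp) (lin0 (cp_npr cp _)) addr0 (cp_npz cp) (cp_zz cp).
  have -> : htensor z = 0.
    by rewrite /htensor (cp_npz cp) (cp_pz cp) (lin0 (cp_nz cp)) subr0 addNr scaler0.
  rewrite !scale1r addr0 mulr1 [2]mulr2n scalerDl scale1r subrr => /eqP.
  rewrite oppr_eq0 => /eqP E; by rewrite nz_perp E (lin0 (cp_p cp)) oppr0.
split=> // E Ez.
  by exists (2 * g E E); rewrite /Pquad H Ez !scale0r subr0.
have Hp F : g F z = 0 -> p (nz F) = F + htensor F.
  move=> Fz; have := Hz F; rewrite (cp_pz cp) (lin0 (cp_npr cp _)) addr0 (cp_npz cp) (cp_zz cp).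
  by rewrite Fz mulr0 !scale0r scale1r addr0 sub0r => /oppr_inj.
have nF F : g F z = 0 -> g (nz F) F = g (htensor F) (p F).
  move=> Fz; have := congr1 (g ^~ (p F)) (Hp F Fz).
  rewrite /= (cp_gpp cp) Fz mulr0 subr0 !iE => ->.
  by have := cp_gskew F F; rewrite (inner_sym ig (p F)); lra.
(* As nabla_xi xi = 0, differentiating phi^2 along xi shows that nabla_xi phi anticommutes with phi
   on E; the other terms cancel in pairs. *)
have anti : htensor (p E) + p (htensor E) = 0.
  rewrite /htensor (linZ (cp_p cp)) !(linD (cp_p cp)) (linN (cp_p cp)) -scalerDr (cp_ppE Ez).
  rewrite (linN (cp_nz cp)) opprK.
  have := cp_npp cp z E; rewrite Ez scale0r addr0 zz0 (inner0l ig) scale0r => E1.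
  have E2 : p (p (nz E)) = - nz E by rewrite {2}nz_perp opprK.
  rewrite E2; apply/eqP; rewrite scaler_eq0; apply/orP; right; apply/eqP.
  rewrite -[RHS]E1; set a := np z (p E); set b := p (np z E); set c := p (nz (p E)).
  by rewrite [b - c - _]addrAC addrACA subrr addr0 addrACA subrr addr0.
rewrite /xi_trace nF // nF ?cp_gpz // (cp_ppE Ez) iE.
have -> : htensor (p E) = - p (htensor E) by apply/eqP; rewrite -subr_eq0 opprK anti.
by rewrite iE cp_gskew; ring.
Qed.

(** The formula at w = xi gives phi nabla xi, hence nabla xi: on the complement of xi it is - a phi
    + b id, whose trace over E and phi E sees only b. *)
Lemma trans_sasakian_point (a b : R) :
  (forall v w, np v w = a *: (g v w *: z - g w z *: v)
                      + b *: (g (p v) w *: z - g w z *: p v)) ->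
  nz z = 0 /\ forall E, g E z = 0 ->
    Pquad E = (2 * a * g E E) *: z /\ xi_trace E = 2 * b * g E E.
Proof.
move=> H.
have Hz v : p (nz v) = a *: (v - g v z *: z) + b *: p v.
  have := cp_npz cp v; rewrite H (cp_zz cp) cp_gpz !scale1r scale0r sub0r => E.
  by rewrite -[p (nz v)]opprK -E opprD scalerN opprK -scalerN opprB.
split; first by rewrite nz_perp Hz (cp_zz cp) (cp_pz cp) scale1r subrr !scaler0 addr0 (lin0 (cp_p cp)) oppr0.
move=> E Ez.
have EpE : g (p E) E = 0 by have := cp_gskew E E; rewrite (inner_sym ig (p E)); lra.
split.
  rewrite /Pquad !H Ez !cp_gpz EpE (cp_gpp cp) Ez mulr0 !scale0r !subr0 (cp_ppE Ez) iE.
  rewrite [g E (p E)](inner_sym ig) EpE oppr0 !scale0r !scaler0 !addr0 -scalerDl scalerA.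
  by congr (_ *: _); ring.
have n F : g F z = 0 -> g (nz F) F = b * g F F.
  move=> Fz; rewrite nz_perp Hz Fz scale0r subr0 (linD (cp_p cp)) !(linZ (cp_p cp)).
  rewrite (cp_ppE Fz) !iE [g (p F) F](_ : _ = 0); first by ring.
  by have := cp_gskew F F; rewrite (inner_sym ig (p F)); lra.
by rewrite /xi_trace !n ?cp_gpz // (cp_gpp cp) Ez; ring.
Qed.

End ContactAlgebra.

Section HermitianAlgebra.
Context {R : realFieldType} {V : lmodType R}.
Variables (g : V -> V -> R) (p : V -> V) (np : V -> V -> V).

Record hermitian_point : Prop := HermitianPoint {
  hp_inner : inner_product g;
  hp_p : linear p;
  hp_pp : forall v, p (p v) = - v;
  hp_gpp : forall v w, g (p v) (p w) = g v w;
  hp_npl : forall w, linear (np ^~ w);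
  hp_npr : forall v, linear (np v);
  hp_skew : forall v w u, g (np v w) u = - g w (np v u);
  hp_npp : forall v w, np v (p w) + p (np v w) = 0 }.

Hypothesis hp : hermitian_point.
Let ig := hp_inner hp.
Let iE := innerE ig.

Lemma hp_npN v w : np v (p w) = - p (np v w).
Proof. by apply/eqP; rewrite -subr_eq0 opprK (hp_npp hp). Qed.

Lemma hp_gskew v w : g (p v) w = - g v (p w).
Proof. by have := hp_gpp hp v (p w); rewrite (hp_pp hp) !iE; lra. Qed.

Lemma quasi_kahler_point : (forall v, np (p v) v - np v (p v) = 0) ->
  forall v, Pquad p np v = 0.
Proof.
move=> H v; rewrite /Pquad hp_npN.
have /eqP := H v; rewrite subr_eq0 => /eqP ->.
by rewrite hp_npN (linN (hp_p hp)) (hp_pp hp) opprK addrN.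
Qed.

(** The form evaluated on (v, J v, J w) is g(P(v, v), w): the third term of the cyclic sum vanishes
    since nabla J is skew and anticommutes with J. *)
Lemma almost_kahler_point : (forall u v w, dOmega g np u v w = 0) ->
  forall v, Pquad p np v = 0.
Proof.
move=> H v; apply: (inner_nondeg ig) => w.
have := H v (p v) (p w); rewrite /dOmega /Pquad !hp_npN !iE (hp_gpp hp).
have -> : g v (p (np (p w) v)) = 0.
  have := hp_gskew v (np (p w) v); have := hp_skew hp (p w) v (p v).
  rewrite hp_npN iE (inner_sym ig (p v)); lra.
have := hp_gskew w (np (p v) v); have := hp_skew hp v v w.
rewrite (inner_sym ig (p w)) (inner_sym ig w); lra.
Qed.

End HermitianAlgebra.

(** * Holomorphic maps at a point *)

Section HolomorphicAlgebra.
Context {R : realFieldType} {V W : lmodType R}.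
Variables (g : V -> V -> R) (p : V -> V) (z : V) (np : V -> V -> V) (nz : V -> V).
Variables (q : W -> W) (nq : W -> W -> W).
Variables (A : V -> W) (B : V -> V -> W) (s : R).
Hypothesis cp : contact_point g p z np nz.
Hypotheses (lq : linear q) (nql : forall w, linear (nq ^~ w)) (nqr : forall v, linear (nq v)).

(* A and B are the values of f_* and of the second fundamental form of f, and
   s is the sign in the definition of a holomorphic map. *)
Record holomorphic_jet : Prop := HolomorphicJet {
  hj_A : linear A;
  hj_B : forall v, linear (B v);
  hj_Bsym : forall v w, B v w = B w v;
  hj_sign : s * s = 1;
  hj_Ap : forall v, A (p v) = s *: q (A v);
  hj_Bp : forall w v, B w (p v) + A (np w v) = s *: (q (B w v) + nq (A w) (A v)) }.

Hypothesis hj : holomorphic_jet.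
Variables (m : nat) (e : 'I_m -> V).
Hypothesis ez : forall k, g (e k) z = 0.

Definition frame_trace {U : zmodType} (Q : V -> V -> U) : U :=
  \sum_k (Q (e k) (e k) + Q (p (e k)) (p (e k))) + Q z z.

(** Add [hj_Bp] at (v, v) and at (phi v, phi v): since phi^2 v = - v, the mixed terms B(v, phi v)
    cancel by the symmetry of B. *)
Lemma q_trace_step v : g v z = 0 ->
  s *: q (B v v + B (p v) (p v)) = A (Pquad p np v) - s *: Pquad q nq (A v).
Proof.
move=> vz; have E1 := hj_Bp hj v v; have := hj_Bp hj (p v) (p v).
rewrite (cp_ppE cp vz) (linN (hj_B hj _)) (hj_Bsym hj (p v) v) (hj_Ap hj).
rewrite (linZ (nql _)) (linZ (nqr _)) scalerA (hj_sign hj) scale1r => E2.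
rewrite /Pquad (linD (hj_A hj)) (linD lq); move: E1 E2; rewrite !scalerDr.
set x := B v (p v); set y := A _; set a := s *: _; set c := s *: _ => E1.
set w := A _; set b := s *: _; set d := s *: _ => E2.
have -> : a = x + y - c by rewrite E1 addrK.
have -> : b = - x + w - d by rewrite E2 addrK.
by rewrite addrACA -opprD; congr (_ - _); rewrite [x + y]addrC -addrA addNKr.
Qed.

Lemma q_trace : s *: q (frame_trace B) =
  A (\sum_k Pquad p np (e k) - p (nz z))
  - s *: (\sum_k Pquad q nq (A (e k)) + nq (A z) (A z)).
Proof.
rewrite /frame_trace (linD lq) (lin_sum lq) scalerDr scaler_sumr.
rewrite (eq_bigr _ (fun k _ => q_trace_step (ez k))) sumrB.
have -> : s *: q (B z z) = - A (p (nz z)) - s *: nq (A z) (A z).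
  have := hj_Bp hj z z; rewrite (cp_pz cp) (lin0 (hj_B hj _)) add0r (cp_npz cp) scalerDr.
  by rewrite (linN (hj_A hj)) => ->; rewrite addrK.
rewrite (linD (hj_A hj)) (linN (hj_A hj)) (lin_sum (hj_A hj)) scalerDr scaler_sumr.
by rewrite addrACA opprD.
Qed.

Section ContactTarget.
Variables (h : W -> W -> R) (z' : W) (nz' : W -> W) (lam : R) (dl : V -> R).
Hypothesis cp' : contact_point h q z' nq nz'.
Let ig := cp_inner cp.
Let ih := cp_inner cp'.
Hypothesis Az : A z = lam *: z'.
Hypothesis dlam : forall w v,
  h (B w v) z' + h (A v) (nz' (A w)) = dl w * g v z + lam * g v (nz w).
Variable c : R.
Hypothesis c0 : c != 0.
Hypothesis semi : \sum_k Pquad p np (e k) - p (nz z) = c *: z.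
Hypothesis div0 : \sum_k xi_trace g p nz (e k) = 0.

Definition energy := \sum_k h (A (e k)) (A (e k)).

(** The complement of xi is sent into the image of q, which is orthogonal to z'. *)
Lemma hAz v : h (A v) z' = lam * g v z.
Proof.
rewrite {1}(cp_decomp cp v) (linD (hj_A hj)) (linN (hj_A hj)) (linZ (hj_A hj)) Az (hj_Ap hj).
by rewrite !(innerE ih) (cp_gpz cp') (cp_zz cp'); ring.
Qed.

Lemma hAe k : h (A (e k)) z' = 0.
Proof. by rewrite hAz ez mulr0. Qed.

Lemma qA v : q (A v) = s *: A (p v).
Proof. by rewrite (hj_Ap hj) scalerA (hj_sign hj) scale1r. Qed.

Lemma s_neq0 : s != 0.
Proof. by apply/eqP => s0; have /eqP := hj_sign hj; rewrite s0 mul0r eq_sym oner_eq0. Qed.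

Lemma q_tension : s *: q (frame_trace B) = (c * lam) *: z'
  - s *: (\sum_k Pquad q nq (A (e k)) - (lam * lam) *: q (nz' z')).
Proof.
rewrite q_trace semi (linZ (hj_A hj)) Az scalerA; congr (_ - _ *: (_ + _)).
by rewrite (linZ (nql _)) (linZ (nqr _)) (cp_npz cp') scalerA -scalerN.
Qed.

(** The trace of [dlam] over the frame. Its lambda terms add up to lambda times the divergence of
    xi, zero by [div0]; the direction xi contributes only d lambda(xi), since nabla of a unit field
    is orthogonal to it. *)
Lemma h_tension_xi : h (frame_trace B) z' = dl z - \sum_k xi_trace h q nz' (A (e k)).
Proof.
have D v : h (B v v) z' = dl v * g v z + lam * g (nz v) v - h (nz' (A v)) (A v).
  by have := dlam v v; rewrite (inner_sym ih (A v)) (inner_sym ig _ (nz v)); lra.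
have xiA k : xi_trace h q nz' (A (e k)) =
    h (nz' (A (e k))) (A (e k)) + h (nz' (A (p (e k)))) (A (p (e k))).
  rewrite /xi_trace qA (linZ (cp_nz cp')) (innerZl ih) (innerZr ih).
  by rewrite mulrA (hj_sign hj) mul1r.
rewrite /frame_trace (innerDl ih) (inner_suml ih) D (cp_zz cp) (cp_nzz cp).
rewrite Az (linZ (cp_nz cp')) (innerZl ih) (innerZr ih) (cp_nzz cp') !mulr0 mulr1 subr0 addr0.
rewrite addrC; congr (_ + _).
transitivity (\sum_k (lam * xi_trace g p nz (e k) - xi_trace h q nz' (A (e k)))); last first.
  by rewrite sumrB -mulr_sumr div0 mulr0 add0r.
apply: eq_bigr => k _; rewrite xiA (innerDl ih) !D ez (cp_gpz cp) /xi_trace; ring.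
Qed.

Lemma tension_decomp : q (frame_trace B) = 0 ->
  frame_trace B = h (frame_trace B) z' *: z'.
Proof. by move=> q0; rewrite {1}(cp_decomp cp' (frame_trace B)) q0 (lin0 lq) oppr0 add0r. Qed.

(** The vector q(tau) is orthogonal to z' as an image of q, and a multiple of z' by [q_tension]. It
    is zero, and tau keeps only its component along z'. *)
Lemma tension_contact_like : contact_like h q z' nq nz' -> frame_trace B = dl z *: z'.
Proof.
move=> [nzz' Pz tr0]; have [cc ccE] : exists cc, \sum_k Pquad q nq (A (e k)) = cc *: z'.
  exists (h (\sum_k Pquad q nq (A (e k))) z').
  rewrite (inner_suml ih) scaler_suml; apply: eq_bigr => k _.
  have [a ->] := Pz _ (hAe k); by rewrite (innerZl ih) (cp_zz cp') mulr1.
have := q_tension; rewrite ccE nzz' (lin0 lq) scaler0 subr0 scalerA -scalerBl => E.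
have := congr1 (h ^~ z') E; rewrite /= !(innerZl ih) (cp_gpz cp') (cp_zz cp') mulr0 mulr1 => E'.
move: E; rewrite -E' scale0r => /eqP; rewrite scaler_eq0 (negPf s_neq0) => /eqP q0.
rewrite (tension_decomp q0) h_tension_xi big1 ?subr0 // => k _.
by apply: tr0; exact: hAe.
Qed.

(** The z' component of [q_tension], whose left side has none. It forces lambda = 0 whenever P(E, E)
    has no Reeb component. *)
Lemma lam_Pquad : c * lam = s * \sum_k h (Pquad q nq (A (e k))) z'.
Proof.
have := congr1 (h ^~ z') q_tension.
rewrite !(innerE ih) (inner_suml ih) !(cp_gpz cp') (cp_zz cp') !mulr0 mulr1 oppr0 addr0 => /eqP.
by rewrite eq_sym subr_eq0 => /eqP.
Qed.

Lemma lam_eq0 : (forall E, h E z' = 0 -> h (Pquad q nq E) z' = 0) -> lam = 0.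
Proof.
move=> H; have /eqP := lam_Pquad; rewrite big1 ?mulr0 ?mulf_eq0 ?(negPf c0) //= => [/eqP//|].
by move=> k _; apply: H; exact: hAe.
Qed.

Lemma tension_cosymplectic :
  (forall E, h E z' = 0 -> Pquad q nq E = 0 /\ xi_trace h q nz' E = 0) ->
  dl z = 0 -> frame_trace B = 0.
Proof.
move=> H dlz; have l0 : lam = 0.
  by apply: lam_eq0 => E /H[-> _]; rewrite (inner0l ih).
have := q_tension; rewrite l0 mulr0 mul0r !scale0r subr0 big1.
  rewrite scaler0 subrr => /eqP; rewrite scaler_eq0 (negPf s_neq0) => /eqP q0.
  rewrite (tension_decomp q0) h_tension_xi dlz big1 ?subrr ?scale0r // => k _.
  by have [] := H _ (hAe k).
by move=> k _; have [] := H _ (hAe k).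
Qed.

Lemma tension_trans (a b : R) :
  nz' z' = 0 -> (forall E, h E z' = 0 ->
    Pquad q nq E = (2 * a * h E E) *: z' /\ xi_trace h q nz' E = 2 * b * h E E) ->
  c * lam = s * (2 * a * energy) /\
  frame_trace B = (dl z - 2 * b * energy) *: z'.
Proof.
move=> nzz' H.
have PE : \sum_k Pquad q nq (A (e k)) = (2 * a * energy) *: z'.
  rewrite /energy mulr_sumr scaler_suml; apply: eq_bigr => k _.
  by have [] := H _ (hAe k).
have E1 : c * lam = s * (2 * a * energy).
  rewrite lam_Pquad -(inner_suml ih) PE (innerZl ih) (cp_zz cp'); ring.
split=> //; have := q_tension.
rewrite PE nzz' (lin0 lq) scaler0 subr0 scalerA -E1 subrr => /eqP.
rewrite scaler_eq0 (negPf s_neq0) => /eqP q0.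
rewrite (tension_decomp q0) h_tension_xi; congr ((_ - _) *: _).
rewrite /energy mulr_sumr; apply: eq_bigr => k _.
by have [] := H _ (hAe k).
Qed.

Lemma tension_xi_kenmotsu (b : R) :
  (forall E, h E z' = 0 -> xi_trace h q nz' E = 2 * b * h E E) ->
  h (frame_trace B) z' = dl z - 2 * b * energy.
Proof.
move=> H; rewrite h_tension_xi; congr (_ - _); rewrite /energy mulr_sumr.
by apply: eq_bigr => k _; rewrite H // hAe.
Qed.

Lemma energy_eq0 : energy = 0 -> forall k, A (e k) = 0 /\ A (p (e k)) = 0.
Proof.
move=> E k; have : h (A (e k)) (A (e k)) = 0.
  by apply: (psumr_eq0P _ E) => // i _; exact: (inner_ge0 ih).
move/eqP; rewrite (inner_eq0 ih) => /eqP A0.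
by rewrite (hj_Ap hj) A0 (lin0 lq) scaler0.
Qed.

Lemma energy0 : (forall k, A (e k) = 0) -> energy = 0.
Proof. by move=> H; rewrite /energy big1 // => k _; rewrite H (inner0l ih). Qed.

End ContactTarget.

(** * The tension field from the derivative of the pulled back metric *)

Section StressEnergy.
Variable h : W -> W -> R.
Hypothesis ih : inner_product h.
Let ig := cp_inner cp.

(* The covariant derivative of the pulled back metric. *)
Definition dpull w v u := h (B w v) (A u) + h (A v) (B w u).

(** Since B is symmetric, h(B(v, v), A u) is recovered from the derivative of the pulled back metric
    by the same polarisation as in the Koszul formula. *)
Lemma stress_energy u : h (frame_trace B) (A u) =
  frame_trace (fun v w => dpull v w u) - 2^-1 * frame_trace (dpull u).
Proof.
have D v : h (B v v) (A u) = dpull v v u - 2^-1 * dpull u v v.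
  by rewrite /dpull (hj_Bsym hj u v) (inner_sym ih (A v)); field.
rewrite /frame_trace (innerDl ih) (inner_suml ih) mulrDr opprD addrACA D.
congr (_ + _); rewrite mulr_sumr -sumrB; apply: eq_bigr => k _.
by rewrite (innerDl ih) !D; ring.
Qed.

Hypothesis frame_complete : forall u, u =
  \sum_k (g u (e k) *: e k + g u (p (e k)) *: p (e k)) + g u z *: z.

Lemma frame_expand {U : lmodType R} (f : V -> U) u : linear f ->
  frame_trace (fun v w => g u v *: f w) = f u.
Proof.
move=> lf; rewrite {2}(frame_complete u) (linD lf) (lin_sum lf) (linZ lf) /frame_trace.
by congr (_ + _); apply: eq_bigr => k _; rewrite (linD lf) !(linZ lf).
Qed.

Lemma frame_expandR (f : V -> R) u : (forall a v w, f (a *: v + w) = a * f v + f w) ->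
  frame_trace (fun v w => g u v * f w) = f u.
Proof. by move=> lf; rewrite -(@frame_expand R^o f u lf). Qed.

Lemma frame_traceD {U : zmodType} (Q Q' : V -> V -> U) :
  frame_trace (fun v w => Q v w + Q' v w) = frame_trace Q + frame_trace Q'.
Proof.
rewrite /frame_trace addrACA -big_split /=; congr (_ + _).
by apply: eq_bigr => k _; rewrite addrACA.
Qed.

Lemma frame_traceZ a (Q : V -> V -> R) :
  frame_trace (fun v w => a * Q v w) = a * frame_trace Q.
Proof.
rewrite /frame_trace mulrDr mulr_sumr; congr (_ + _).
by apply: eq_bigr => k _; rewrite mulrDr.
Qed.

Lemma frame_trace_sum {U : zmodType} (r : nat) (Q : 'I_r -> V -> V -> U) :
  frame_trace (fun v w => \sum_a Q a v w) = \sum_a frame_trace (Q a).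
Proof.
rewrite /frame_trace [RHS]big_split /=; congr (_ + _).
rewrite [RHS]exchange_big; apply: eq_bigr => k _; by rewrite [RHS]big_split.
Qed.

Lemma eq_frame_trace {U : zmodType} (Q Q' : V -> V -> U) :
  (forall v, Q v v = Q' v v) -> frame_trace Q = frame_trace Q'.
Proof.
by move=> H; rewrite /frame_trace !H; congr (_ + _); apply: eq_bigr => k _; rewrite !H.
Qed.

Hypothesis e_unit : forall k, g (e k) (e k) = 1.

Lemma frame_trace_metric : frame_trace g = (m.*2.+1)%:R.
Proof.
rewrite /frame_trace (cp_zz cp) (eq_bigr (fun=> 2)); last first.
  by move=> k _; rewrite (cp_gpp cp) ez e_unit mulr0 subr0.
by rewrite sumr_const card_ord -[m.*2.+1%:R]natr1 -muln2 natrM mulr_natl.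
Qed.

Variable dm : V -> R.
Hypothesis ldm : forall a v w, dm (a *: v + w) = a * dm v + dm w.

(** In [stress_energy] the first trace gives dm(u) and the second gives dm(u) times the
    dimension. *)
Lemma conformal_tension u : (forall w v v', dpull w v v' = dm w * g v v') ->
  h (frame_trace B) (A u) = (1 - 2^-1 * (m.*2.+1)%:R) * dm u.
Proof.
move=> H; rewrite stress_energy.
rewrite (eq_frame_trace (Q' := fun v w => g u v * dm w)); last first.
  by move=> v; rewrite H mulrC (inner_sym ig).
rewrite frame_expandR // (eq_frame_trace (Q' := fun v w => dm u * g v w)); last by move=> v.
by rewrite frame_traceZ frame_trace_metric; ring.
Qed.

Variables (r : nat) (E : 'I_r -> V) (nE : V -> 'I_r -> V) (mu2 : R).
Hypotheses (Ez : forall a, g (E a) z = 0) (EE : forall a, g (E a) (E a) = 1).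
Hypotheses (nEE : forall w a, g (nE w a) (E a) = 0) (lnE : forall a, linear (nE ^~ a)).
Hypothesis minE : \sum_a g (nE (E a) a) z = 0.

(* The E a span the kernel of f_*: only the horizontal directions contribute to
   the trace of the pulled back metric. *)
Lemma minimal_fibre_tension :
  (forall w v u, dpull w v u =
     dm w * (g v u - \sum_a g v (E a) * g u (E a))
     - mu2 * \sum_a (g v (nE w a) * g u (E a) + g v (E a) * g u (nE w a))) ->
  h (frame_trace B) (A z) = (1 - 2^-1 * ((m.*2.+1)%:R - r%:R)) * dm z.
Proof.
move=> H; rewrite stress_energy.
have zE a : g z (E a) = 0 by rewrite (inner_sym ig).
rewrite (eq_frame_trace (Q' := fun v w => g z v * dm w +
    (- mu2) * \sum_a g (E a) v * g (nE w a) z)); last first.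
  move=> v; rewrite H big1 ?subr0; last by move=> a _; rewrite zE mulr0.
  rewrite mulrC (inner_sym ig) mulNr; congr (_ - _ * _); apply: eq_bigr => a _.
  by rewrite zE mulr0 add0r (inner_sym ig v) (inner_sym ig z).
rewrite frame_traceD frame_expandR // frame_traceZ frame_trace_sum.
rewrite [X in - mu2 * X](eq_bigr (fun a => g (nE (E a) a) z)); last first.
  move=> a _; rewrite (@frame_expandR (fun w => g (nE w a) z)) //.
  by move=> c v w; rewrite (lnE a) !(innerE ig).
(* This sum is the mean curvature of the fibre tested on xi. *)
rewrite minE mulr0 addr0.
rewrite (eq_frame_trace (Q' := fun v w => dm z * g v w + ((- dm z) * \sum_a g (E a) v * g w (E a)
   + (- 2 * mu2) * \sum_a g (E a) v * g w (nE z a)))); last first.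
  move=> v; rewrite H.
  have -> : \sum_a (g v (nE z a) * g v (E a) + g v (E a) * g v (nE z a)) =
            2 * \sum_a g (E a) v * g v (nE z a).
    by rewrite mulr_sumr; apply: eq_bigr => a _; rewrite (inner_sym ig (E a)); ring.
  have -> : \sum_a g v (E a) * g v (E a) = \sum_a g (E a) v * g v (E a).
    by apply: eq_bigr => a _; rewrite (inner_sym ig (E a)).
  ring.
rewrite !frame_traceD !frame_traceZ frame_trace_metric !frame_trace_sum.
have gl u : forall c v w, g (c *: v + w) u = c * g v u + g w u.
  by move=> c v w; rewrite !(innerE ig).
(* Each unit vector E a contributes 1, which turns the dimension 2m + 1 into 2m + 1 - r; the
   derivative of a unit field is orthogonal to it, so the next sum vanishes. *)
rewrite (eq_bigr (fun=> 1)); last by move=> a _; rewrite frame_expandR.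
rewrite [X in - 2 * mu2 * X]big1; last first.
  by move=> a _; rewrite frame_expandR // (inner_sym ig).
by rewrite sumr_const card_ord; ring.
Qed.

End StressEnergy.
End HolomorphicAlgebra.

(** * The Levi-Civita connection in a chart *)

Section DifferentiableProducts.
Context {R : realType} {d : nat}.
Implicit Types x : 'rV[R]_d.

Lemma differentiable_trmx {p q} (A : 'rV[R]_d -> 'M[R]_(p, q)) x :
  differentiable A x -> differentiable (fun y => (A y)^T) x.
Proof.
move=> dA; apply: differentiable_mx => i j; have := differentiable_mx_entry j i dA.
by under [X in _ -> differentiable X _]eq_fun do rewrite mxE.
Qed.

Lemma differentiable_mulmx {p q r} (A : 'rV[R]_d -> 'M[R]_(p, q))
    (B : 'rV[R]_d -> 'M[R]_(q, r)) x :
  differentiable A x -> differentiable B x -> differentiable (fun y => A y *m B y) x.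
Proof.
move=> dA dB; apply: differentiable_mx => i j.
rewrite (_ : (fun _ => _) = \sum_k (fun y => A y i k * B y k j)); last first.
  by apply/funext => y; rewrite mxE fct_sumE.
apply: (big_ind (fun f : 'rV[R]_d -> R => differentiable f x)).
- exact: differentiable_cst.
- by move=> f h; exact: differentiableD.
- by move=> k _; apply: differentiableM; exact: differentiable_mx_entry.
Qed.

End DifferentiableProducts.

Section Covariant.
Context {R : realType} {d : nat}.
Implicit Types (x w : 'rV[R]_d).

(* L and M are the connection matrices acting on the row and on the column
   indices of A; with this convention they cancel in the product rule. *)
Definition cov {p q} (L : 'M[R]_p) (M : 'M[R]_q) w (A : 'rV[R]_d -> 'M[R]_(p, q)) x :=
  'D_w A x - L *m A x + A x *m M.

Lemma cov_mulmx {p q r} (L : 'M[R]_p) (M : 'M[R]_q) (N : 'M[R]_r) w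
    (A : 'rV[R]_d -> 'M[R]_(p, q)) (B : 'rV[R]_d -> 'M[R]_(q, r)) x :
  differentiable A x -> differentiable B x ->
  cov L N w (fun y => A y *m B y) x = cov L M w A x *m B x + A x *m cov M N w B x.
Proof.
move=> dA dB; rewrite /cov.
have [_ ->] := is_derive_mulmx (derivableP (diff_derivable (v := w) dA))
                               (derivableP (diff_derivable (v := w) dB)).
rewrite !(mulmxDl, mulmxDr, mulmxBl, mulmxBr, mulmxN, mulNmx) !mulmxA.
set b := L *m A x *m B x; set c := A x *m _.
set e := A x *m M *m B x; set f := A x *m B x *m N.
rewrite [c - e]addrC -[- e + c + f]addrA [RHS]addrA addrK.
by rewrite [_ + c - b]addrAC addrA.
Qed.

Lemma cov_trmx {p q} (L : 'M[R]_p) (M : 'M[R]_q) w (A : 'rV[R]_d -> 'M[R]_(p, q)) x :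
  differentiable A x ->
  cov (- M^T) (- L^T) w (fun y => (A y)^T) x = (cov L M w A x)^T.
Proof.
move=> dA; rewrite /cov.
have [_ ->] := is_derive_trmx (derivableP (diff_derivable (v := w) dA)).
by rewrite [RHS]raddfD raddfB /= !trmx_mul mulNmx mulmxN opprK addrAC.
Qed.

Lemma cov_scalemx {p q} (L : 'M[R]_p) (M : 'M[R]_q) w (u : 'rV[R]_d -> R)
    (A : 'rV[R]_d -> 'M[R]_(p, q)) x :
  differentiable u x -> differentiable A x ->
  cov L M w (fun y => u y *: A y) x = 'D_w u x *: A x + u x *: cov L M w A x.
Proof.
move=> du dA; rewrite /cov.
have [_ ->] := is_derive_scalemx (derivableP (diff_derivable (v := w) du))
                                 (derivableP (diff_derivable (v := w) dA)).
by rewrite -scalemxAr -scalemxAl !scalerDr scalerN !addrA.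
Qed.

Lemma covD {p q} (L : 'M[R]_p) (M : 'M[R]_q) w (A B : 'rV[R]_d -> 'M[R]_(p, q)) x :
  differentiable A x -> differentiable B x ->
  cov L M w (fun y => A y + B y) x = cov L M w A x + cov L M w B x.
Proof.
move=> dA dB; rewrite /cov [X in X - _ + _](deriveD (diff_derivable dA) (diff_derivable dB)).
rewrite mulmxDl mulmxDr opprD.
by rewrite [in RHS]addrACA; congr (_ + _); rewrite addrACA.
Qed.

Lemma covN {p q} (L : 'M[R]_p) (M : 'M[R]_q) w (A : 'rV[R]_d -> 'M[R]_(p, q)) x :
  differentiable A x -> cov L M w (fun y => - A y) x = - cov L M w A x.
Proof.
move=> dA; rewrite /cov [X in X - _ + _](deriveN (diff_derivable dA)).
by rewrite mulmxN mulNmx !opprD.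
Qed.

Lemma cov_sum {p q} (L : 'M[R]_p) (M : 'M[R]_q) w (r : nat)
    (A : 'I_r -> 'rV[R]_d -> 'M[R]_(p, q)) x :
  (forall a, differentiable (A a) x) ->
  cov L M w (fun y => \sum_a A a y) x = \sum_a cov L M w (A a) x.
Proof.
move=> dA; rewrite /cov.
have [_ ->] := is_derive_big (index_enum _)
  (fun a => derivableP (diff_derivable (v := w) (dA a))).
by rewrite big_split sumrB /= -mulmx_sumr -mulmx_suml.
Qed.

Lemma cov_cst {p q} (M : 'M[R]_q) w (A : 'M[R]_(p, q)) x : cov 0 M w (fun=> A) x = A *m M.
Proof. by rewrite /cov [X in X - _ + _]derive_cst mul0mx subr0 add0r. Qed.

Lemma cov_near {p q} (L : 'M[R]_p) (M : 'M[R]_q) w (A B : 'rV[R]_d -> 'M[R]_(p, q)) (U : set 'rV[R]_d) x :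
  open U -> U x -> (forall y, U y -> A y = B y) -> cov L M w A x = cov L M w B x.
Proof.
move=> oU Ux AB; have E := near_eq_derive w (open_near_eq oU AB Ux).
by rewrite /cov E (AB x Ux).
Qed.

Lemma cov_comp {e p q} (L : 'M[R]_p) (M : 'M[R]_q) w (F : 'rV[R]_d -> 'rV[R]_e)
    (A : 'rV[R]_e -> 'M[R]_(p, q)) x :
  differentiable F x -> differentiable A (F x) ->
  cov L M w (A \o F) x =
  'D_('D_w F x) A (F x) - L *m A (F x) + A (F x) *m M.
Proof. by move=> dF dA; rewrite /cov; have [_ ->] := derive_comp w dF dA. Qed.

End Covariant.

Section InnerProduct.
Context {R : realType} {d : nat}.
Variables (g : 'rV[R]_d -> 'M[R]_d) (x : 'rV[R]_d).
Implicit Types u v w : 'rV[R]_d.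

Lemma ip_tr u w : (g x)^T = g x -> ip g x u w = ip g x w u.
Proof.
move=> gT; have : (u *m g x *m w^T)^T = w *m g x *m u^T.
  by rewrite !trmx_mul trmxK gT mulmxA.
by move/(congr1 (fun M : 'M[R]_1 => M 0 0)); rewrite mxE.
Qed.

Lemma ip_inner_product : (g x)^T = g x -> (forall v, v != 0 -> 0 < ip g x v v) ->
  inner_product (ip g x).
Proof.
move=> gT pos; split=> // [a u v w|u v]; last exact: ip_tr.
by rewrite /ip !mulmxDl -!scalemxAl !mxE.
Qed.

Lemma mulmx_ip u (M : 'M[R]_d) w : ip g x (u *m M) w = (u *m (M *m g x) *m w^T) 0 0.
Proof. by rewrite /ip !mulmxA. Qed.

End InnerProduct.

Lemma rV_mulmx_inj {R : pzRingType} {p q} (A B : 'M[R]_(p, q)) :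
  (forall v : 'rV[R]_p, v *m A = v *m B) -> A = B.
Proof. by move=> H; apply/row_matrixP => i; rewrite !rowE H. Qed.

Lemma bilinear_mx_inj {R : pzRingType} {p q} (A B : 'M[R]_(p, q)) :
  (forall (v : 'rV[R]_p) (w : 'rV[R]_q), (v *m A *m w^T) 0 0 = (v *m B *m w^T) 0 0) -> A = B.
Proof.
move=> H; apply/matrixP => i j; have := H (delta_mx 0 i) (delta_mx 0 j).
by rewrite -!rowE trmx_delta -!colE !mxE.
Qed.

Section Metric.
Context {R : realType} {d : nat}.
Variables (g : 'rV[R]_d -> 'M[R]_d) (U : set 'rV[R]_d).
Hypotheses (oU : open U) (rg : riemannian_on g U).

Lemma met_smooth : smooth_on U g. Proof. by case: rg. Qed.
Lemma met_sym x : U x -> (g x)^T = g x. Proof. by move=> Ux; have [_ /(_ x Ux)[]] := rg. Qed.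
Lemma met_inner x : U x -> inner_product (ip g x).
Proof. by move=> Ux; have [_ /(_ x Ux)[gT pos]] := rg; exact: ip_inner_product. Qed.
Lemma met_unit x : U x -> g x \in unitmx.
Proof.
move=> Ux; rewrite -row_free_unit -kermx_eq0; apply/eqP/row_matrixP => i; rewrite row0.
apply/eqP/negPn/negP => v0; have [_ /(_ x Ux)[_ /(_ _ v0)]] := rg.
by rewrite /ip -row_mul mulmx_ker row0 mul0mx mxE ltxx.
Qed.
Lemma met_differentiable x : U x -> differentiable g x.
Proof. exact: smooth_differentiable met_smooth. Qed.

(** The connection matrix of nabla_v: its row j is the covariant derivative of the coordinate field
    j along v. *)
Definition gmx x (v : 'rV[R]_d) : 'M[R]_d :=
  \matrix_(j, k) \sum_i v 0 i * christoffel g x i j k.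

Lemma gammaE x v w : gamma g x v w = w *m gmx x v.
Proof.
apply/rowP => k; rewrite !mxE exchange_big /=; apply: eq_bigr => j _.
by rewrite !mxE mulr_sumr; apply: eq_bigr => i _; ring.
Qed.

Lemma gmx_linear x : linear (gmx x).
Proof.
move=> a u v; apply/matrixP => j k; rewrite !mxE mulr_sumr -big_split /=.
by apply: eq_bigr => i _; rewrite !mxE; ring.
Qed.

Lemma nablaE X Y x : nabla g X Y x = cov 0 (gmx x (X x)) (X x) Y x.
Proof. by rewrite /nabla gammaE /cov mul0mx subr0. Qed.

Section AtPoint.
Variable x : 'rV[R]_d.
Hypothesis Ux : U x.

Lemma met_entry_sym (i j l : 'I_d) :
  'D_(crd l) (fun y => g y i j) x = 'D_(crd l) (fun y => g y j i) x.
Proof.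
apply: near_eq_derive; apply: (open_near_eq oU _ Ux) => y Uy.
by rewrite -{1}(met_sym Uy) mxE.
Qed.

Lemma christoffel_sym i j k : christoffel g x i j k = christoffel g x j i k.
Proof.
rewrite /christoffel; congr (_ * _); apply: eq_bigr => l _; congr (_ * _).
by rewrite (met_entry_sym j i) [X in X - _]addrC.
Qed.

Lemma gmx_sym v w : v *m gmx x w = w *m gmx x v.
Proof.
rewrite -!gammaE; apply/rowP => k; rewrite !mxE exchange_big /=.
apply: eq_bigr => i _; apply: eq_bigr => j _; rewrite (christoffel_sym j i); ring.
Qed.

(** Multiplication by g cancels its inverse and leaves the Christoffel symbols of the first kind. *)
Lemma gmx_met v : gmx x v *m g x = \matrix_(j, l) (2^-1 * \sum_i v 0 i *
  ('D_(crd i) (fun y => g y j l) x + 'D_(crd j) (fun y => g y i l) x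
     - 'D_(crd l) (fun y => g y i j) x)).
Proof.
have -> : gmx x v = (\matrix_(j, l) (2^-1 * \sum_i v 0 i *
    ('D_(crd i) (fun y => g y j l) x + 'D_(crd j) (fun y => g y i l) x
     - 'D_(crd l) (fun y => g y i j) x))) *m invmx (g x).
  apply/matrixP => j k; rewrite !mxE.
  under [RHS]eq_bigr => l _ do rewrite mxE -mulrA mulr_suml mulr_sumr.
  rewrite exchange_big /=; apply: eq_bigr => i _.
  rewrite /christoffel mulrCA mulr_sumr mulr_sumr; apply: eq_bigr => l _.
  have -> : invmx (g x) k l = invmx (g x) l k by rewrite -{1}(met_sym Ux) -trmx_inv mxE.
  by ring.
by rewrite mulmxKV // met_unit.
Qed.

(** Compatibility with the metric: in the sum of the symbols of the first kind and their transpose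
    the antisymmetric differences cancel, and the derivative of g remains. *)
Lemma cov_met v : cov (gmx x v) (- (gmx x v)^T) v g x = 0.
Proof.
rewrite /cov mulmxN.
have -> : g x *m (gmx x v)^T = (gmx x v *m g x)^T by rewrite trmx_mul (met_sym Ux).
rewrite gmx_met; apply/matrixP => j l.
have dg := met_differentiable Ux.
rewrite derive_mx; last exact: diff_derivable.
rewrite !mxE -addrA -opprD -mulrDr -big_split /=.
rewrite (derive_coord _ (differentiable_mx_entry _ _ dg)) [X in X - _](_ : _ =
   \sum_i v 0 i * 'D_(crd i) (fun y => g y j l) x) //.
rewrite mulr_sumr -sumrB big1 // => i _.
rewrite (met_entry_sym l j) (met_entry_sym i l) (met_entry_sym i j) (met_entry_sym j i).
by rewrite (met_entry_sym i j); field.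
Qed.

Lemma cov_met_tr v (Y : 'rV[R]_d -> 'rV[R]_d) : differentiable Y x ->
  cov (gmx x v) 0 v (fun y => g y *m (Y y)^T) x = g x *m (cov 0 (gmx x v) v Y x)^T.
Proof.
move=> dY; rewrite (cov_mulmx _ (- (gmx x v)^T)) ?cov_met ?mul0mx ?add0r.
- by have := cov_trmx 0 (gmx x v) v dY; rewrite trmx0 oppr0 => ->.
- exact: met_differentiable.
- apply: differentiable_mx => i j; have := differentiable_mx_entry j i dY.
  by under [X in _ -> differentiable X _]eq_fun do rewrite mxE.
Qed.

End AtPoint.
End Metric.

Section Endomorphisms.
Context {R : realType} {d : nat}.
Variables (g : 'rV[R]_d -> 'M[R]_d) (A : 'rV[R]_d -> 'M[R]_d).

Definition jetn y (w v : 'rV[R]_d) : 'rV[R]_d := v *m cov (gmx g y w) (gmx g y w) w A y.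

Lemma jetn_linearr y v : linear (jetn y v).
Proof. by move=> a u w; rewrite /jetn mulmxDl scalemxAl. Qed.

Variable U : set 'rV[R]_d.
Hypotheses (oU : open U) (rg : riemannian_on g U) (sA : smooth_on U A).

Lemma jetn_linearl y (Uy : U y) w : linear (jetn y ^~ w).
Proof.
have dA := smooth_differentiable oU sA Uy.
move=> a u v; rewrite /jetn /cov (derive_linear dA) gmx_linear.
move: ('D_u A y) ('D_v A y) (gmx g y u) (gmx g y v) => a1 a2 b1 b2.
have -> : a *: a1 + a2 - (a *: b1 + b2) *m A y + A y *m (a *: b1 + b2) =
    a *: (a1 - b1 *m A y + A y *m b1) + (a2 - b2 *m A y + A y *m b2).
  rewrite mulmxDr mulmxDl -scalemxAr -scalemxAl !scalerDr scalerN opprD [RHS]addrACA.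
  by congr (_ + _); rewrite [RHS]addrACA.
by rewrite mulmxDr -scalemxAr.
Qed.

Section At.
Variable x : 'rV[R]_d.
Hypothesis Ux : U x.
Let dA := smooth_differentiable oU sA Ux.
Let dg := met_differentiable oU rg Ux.

(** The matrix A g is skew on all of U, hence so is its derivative, which by nabla g = 0 is that of
    A times g. *)
Lemma jetn_skew v w u : (forall y, U y -> A y *m g y = - (A y *m g y)^T) ->
  ip g x (jetn x v w) u = - ip g x w (jetn x v u).
Proof.
move=> skA; have dAg := differentiable_mulmx dA dg.
have E : cov (gmx g x v) (- (gmx g x v)^T) v (fun y => A y *m g y) x =
    cov (gmx g x v) (gmx g x v) v A x *m g x.
  by rewrite (cov_mulmx _ (gmx g x v)) // (cov_met oU rg Ux) mulmx0 addr0.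
have N : cov (gmx g x v) (gmx g x v) v A x *m g x = - (cov (gmx g x v) (gmx g x v) v A x *m g x)^T.
  rewrite -E -[in RHS]cov_trmx // linearN /= trmxK opprK -covN.
    by apply: cov_near oU Ux _ => y; exact: skA.
  exact: differentiable_trmx.
rewrite (ip_tr w _ (met_sym rg Ux)) /jetn !mulmx_ip.
rewrite {1}N mulmxN mulNmx mxE; congr (- _); set M := _ *m g x.
have : (w *m M^T *m u^T)^T = u *m M *m w^T by rewrite !trmx_mul !trmxK mulmxA.
by move/(congr1 (fun B : 'M[R]_1 => B 0 0)); rewrite mxE.
Qed.

Lemma nabla_endE X Y : differentiable Y x -> nabla_end g A X Y x = jetn x (X x) (Y x).
Proof.
move=> dY; rewrite /nabla_end.
rewrite [LHS](_ : _ = nabla g X (appl A Y) x - nabla g X Y x *m A x) //.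
by rewrite !nablaE /appl (cov_mulmx _ (gmx g x (X x))) // addrC addKr.
Qed.

Lemma nabla_fundE u v w :
  nabla_fund g A (fun=> u) (fun=> v) (fun=> w) x = ip g x v (jetn x u w).
Proof.
have dAT := differentiable_trmx dA.
have dgA := differentiable_mulmx dg dAT.
have E : cov (gmx g x u) (- (gmx g x u)^T) u (fun y => g y *m (A y)^T) x =
   g x *m (cov (gmx g x u) (gmx g x u) u A x)^T.
  rewrite (cov_mulmx _ (- (gmx g x u)^T)) // (cov_met oU rg Ux) mul0mx add0r.
  by rewrite cov_trmx.
rewrite /nabla_fund.
rewrite [LHS](_ : _ = 'D_u (fund g A (fun=> v) (fun=> w)) x
   - fund g A (nabla g (fun=> u) (fun=> v)) (fun=> w) x
   - fund g A (fun=> v) (nabla g (fun=> u) (fun=> w)) x) //.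
have -> : 'D_u (fund g A (fun=> v) (fun=> w)) x =
    (v *m 'D_u (fun y => g y *m (A y)^T) x *m w^T) 0 0.
  have D := derivableP (diff_derivable (v := u) dgA).
  have D1 := is_derive_mulmx (is_derive_mulmx (is_derive_cst v x u) D) (is_derive_cst w^T x u).
  have /is_derive_mxP/(_ 0 0)[_] := D1.
  rewrite /cst mul0mx add0r mulmx0 addr0 => <-.
  congr ('D_u _ x); apply/funext => y.
  by rewrite /fund /appl /ip trmx_mul !mulmxA.
have N t : nabla g (fun=> u) (fun=> t) x = t *m gmx g x u.
  by rewrite nablaE /cov derive_cst mul0mx subr0 add0r.
rewrite /fund /appl !N /jetn /ip -!mulmxA !trmx_mul.
have -> : v *m (g x *m ((cov (gmx g x u) (gmx g x u) u A x)^T *m w^T)) =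
   v *m (g x *m (cov (gmx g x u) (gmx g x u) u A x)^T) *m w^T by rewrite !mulmxA.
rewrite -E /cov mulmxN; move: ('D_u _ x) => D.
rewrite !(mulmxDr, mulmxDl, mulmxN, mulNmx) !mulmxA.
move: (v *m D *m _) (v *m gmx g x u *m _ *m _ *m _) (v *m g x *m _ *m _ *m _) => a b c.
by rewrite !mxE.
Qed.

Lemma d_fundE u v w :
  d_fund g A (fun=> u) (fun=> v) (fun=> w) x = dOmega (ip g x) (jetn x) u v w.
Proof.
rewrite /d_fund /dOmega.
rewrite [LHS](_ : _ = nabla_fund g A (fun=> u) (fun=> v) (fun=> w) x
  + nabla_fund g A (fun=> v) (fun=> w) (fun=> u) x
  + nabla_fund g A (fun=> w) (fun=> u) (fun=> v) x) //.
by rewrite !nabla_fundE.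
Qed.

End At.
End Endomorphisms.

Section Structure.
Context {R : realType} {d : nat}.
Variable S : lacm R d.

Definition xnp x (v w : 'rV[R]_d) : 'rV[R]_d :=
  w *m cov (gmx (met S) x v) (gmx (met S) x v) v (phi S) x.
Definition xnz x (v : 'rV[R]_d) : 'rV[R]_d := cov 0 (gmx (met S) x v) v (xi S) x.
Definition xphi x (v : 'rV[R]_d) : 'rV[R]_d := v *m phi S x.

Variable U : set 'rV[R]_d.
Hypotheses (oU : open U) (aS : acm_on S U).

Let rg : riemannian_on (met S) U. Proof. by case: aS. Qed.
Lemma phi_smooth : smooth_on U (phi S). Proof. by case: aS. Qed.
Lemma xi_smooth : smooth_on U (xi S). Proof. by case: aS. Qed.

Section At.
Variable x : 'rV[R]_d.
Hypothesis Ux : U x.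
Let ig := met_inner rg Ux.
Let iE := innerE ig.

Lemma phi_differentiable : differentiable (phi S) x.
Proof. exact: smooth_differentiable phi_smooth Ux. Qed.
Lemma xi_differentiable : differentiable (xi S) x.
Proof. exact: smooth_differentiable xi_smooth Ux. Qed.

Let ax : [/\ forall v, v *m phi S x *m phi S x = - v + etav S x v *: xi S x,
          etav S x (xi S x) = 1 &
          forall v w, ip (met S) x (v *m phi S x) (w *m phi S x) =
                      ip (met S) x v w - etav S x v * etav S x w].
Proof. by case: aS => _ _ _ _; exact. Qed.

Lemma etav0 : etav S x 0 = 0.
Proof. by rewrite /etav mul0mx mxE. Qed.

(** Two computations of phi^3 give eta(v) phi xi = eta(phi v) xi. Applying phi once more, eta(phi v)
    or phi xi is zero, and the second alternative implies the first because xi is nonzero. *)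
Lemma etav_phi v : etav S x (v *m phi S x) = 0.
Proof.
have [h1 h2 _] := ax; have E := h1 (v *m phi S x); rewrite (h1 v) in E.
rewrite mulmxDl mulNmx -scalemxAl in E.
have E1 := h1 (xi S x); rewrite h2 scale1r addNr in E1.
have := congr1 (mulmx^~ (phi S x)) E.
rewrite !mulmxDl !mulNmx -!scalemxAl E1 scaler0 addr0 => /eqP.
rewrite -subr_eq0 opprD addrA subrr add0r oppr_eq0 scaler_eq0 => /orP[/eqP//|/eqP xp0].
move/eqP: E; rewrite xp0 scaler0 addr0 -subr_eq0 opprD addrA subrr add0r oppr_eq0.
rewrite scaler_eq0 => /orP[/eqP//|/eqP x0].
by move: h2; rewrite x0 etav0 => /eqP; rewrite eq_sym oner_eq0.
Qed.

Lemma xi_phi : xi S x *m phi S x = 0.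
Proof.
have [h1 h2 _] := ax; have E1 := h1 (xi S x); rewrite h2 scale1r addNr in E1.
have := h1 (xi S x *m phi S x); rewrite E1 mul0mx etav_phi scale0r addr0.
by move=> /esym/eqP; rewrite oppr_eq0 => /eqP.
Qed.

Lemma etavE v : etav S x v = ip (met S) x v (xi S x).
Proof.
have [_ h2 h3] := ax; have := h3 v (xi S x).
by rewrite xi_phi h2 mulr1 (inner0r ig) => /esym/eqP; rewrite subr_eq0 => /eqP.
Qed.

Lemma ip_phi_skew v w : ip (met S) x (v *m phi S x) w = - ip (met S) x v (w *m phi S x).
Proof.
have [h1 h2 h3] := ax; have := h3 v (w *m phi S x).
rewrite etav_phi mulr0 subr0 h1 !iE -etavE etav_phi; lra.
Qed.

Lemma etaE : Defs.eta S x = met S x *m (xi S x)^T.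
Proof.
apply: rV_mulmx_inj => v; apply/matrixP => i j; rewrite !ord1.
by have := etavE v; rewrite /etav /ip mulmxA.
Qed.

Lemma phi_met : phi S x *m met S x = - (phi S x *m met S x)^T.
Proof.
apply: bilinear_mx_inj => v w; have := ip_phi_skew v w.
rewrite /ip !mulmxA => ->; rewrite mulmxN mulNmx [RHS]mxE; congr (- _).
by rewrite !trmx_mul (met_sym rg Ux) !mulmxA.
Qed.

Lemma phi_sq : phi S x *m phi S x = - 1%:M + met S x *m (xi S x)^T *m xi S x.
Proof.
apply: rV_mulmx_inj => v; have [h1 _ _] := ax.
rewrite mulmxA h1 mulmxDr mulmxN mulmx1; congr (_ + _).
by rewrite etavE !mulmxA [in RHS](mx11_scalar (v *m _ *m _)) mul_scalar_mx.
Qed.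

Lemma ip_xi : xi S x *m met S x *m (xi S x)^T = 1%:M.
Proof.
have [_ h2 _] := ax; rewrite etavE in h2.
by rewrite (mx11_scalar (_ *m _)) -[X in X%:M]/(ip (met S) x (xi S x) (xi S x)) h2.
Qed.

End At.

Section Derivatives.
Variable x : 'rV[R]_d.
Hypothesis Ux : U x.
Let ig := met_inner rg Ux.
Let dg := met_differentiable oU rg Ux.
Let dphi := phi_differentiable Ux.
Let dxi := xi_differentiable Ux.
Local Notation G := (gmx (met S) x).
Local Notation Np v := (cov (G v) (G v) v (phi S) x).

(** The derivative of [phi_sq], where eta is written as g xi so that nabla g = 0 leaves only nabla
    xi. *)
Lemma xnp_phi v w : xnp x v (w *m phi S x) + xnp x v w *m phi S x =
  ip (met S) x (xnz x v) w *: xi S x + ip (met S) x w (xi S x) *: xnz x v.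
Proof.
have dxiT := differentiable_trmx dxi.
have E : cov (G v) (G v) v (fun y => phi S y *m phi S y) x =
    met S x *m (xnz x v)^T *m xi S x + met S x *m (xi S x)^T *m xnz x v.
  rewrite (cov_near (G v) (G v) v oU Ux (fun y Uy => phi_sq Uy)).
  rewrite covD; [|exact: differentiable_cst|]; last first.
    by do 2![apply: differentiable_mulmx => //].
  rewrite /cov [X in X - _ + _ + _]derive_cst mulmxN mulNmx mulmx1 mul1mx sub0r opprK subrr add0r.
  rewrite -[LHS]/(cov (G v) (G v) v (fun y => met S y *m (xi S y)^T *m xi S y) x).
  rewrite (cov_mulmx _ 0) //; last exact: differentiable_mulmx.
  by rewrite (cov_met_tr oU rg Ux).
rewrite (cov_mulmx _ (G v)) // in E; rewrite /xnp.
move: E; move: (Np v) (xnz x v) => N nzv E.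
have := congr1 (mulmx w) E; rewrite !mulmxDr !mulmxA addrC => ->.
rewrite (ip_tr _ w (met_sym rg Ux)) /ip.
set a := w *m _ *m nzv^T; set b := w *m _ *m (xi S x)^T.
by rewrite {1}(mx11_scalar a) {1}(mx11_scalar b) !mul_scalar_mx.
Qed.

Lemma xnp_xi v : xnp x v (xi S x) = - (xnz x v *m phi S x).
Proof.
have : cov 0 (G v) v (fun y => xi S y *m phi S y) x = 0.
  rewrite (cov_near 0 (G v) v oU Ux (fun y Uy => xi_phi Uy)).
  by rewrite (cov_cst (G v) v (0 : 'rV[R]_d)) mul0mx.
by rewrite (cov_mulmx _ (G v)) // => E; apply/eqP; rewrite -addr_eq0 addrC; apply/eqP.
Qed.

Lemma xnz_xi v : ip (met S) x (xnz x v) (xi S x) = 0.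
Proof.
have : cov 0 0 v (fun y => xi S y *m met S y *m (xi S y)^T) x = 0.
  rewrite (cov_near 0 0 v oU Ux (fun y Uy => ip_xi Uy)).
  by rewrite (cov_cst 0 v (1%:M : 'M[R]_1)) mulmx0.
rewrite (_ : (fun y => _) = (fun y => xi S y *m (met S y *m (xi S y)^T))); last first.
  by apply/funext => y; rewrite mulmxA.
rewrite (cov_mulmx _ (G v)) //; last first.
  by apply: differentiable_mulmx => //; exact: differentiable_trmx.
rewrite (cov_met_tr oU rg Ux) // !mulmxA => E.
have := congr1 (fun M : 'M[R]_1 => M 0 0) E; rewrite /= [X in X = _]mxE [X in _ = X]mxE.
rewrite -/(ip (met S) x (xnz x v) (xi S x)) -/(ip (met S) x (xi S x) (xnz x v)).
by rewrite (ip_tr (xi S x) _ (met_sym rg Ux)); lra.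
Qed.

Lemma xnz_linear : linear (xnz x).
Proof.
move=> a u v; have E w : xnz x w = 'D_w (xi S) x + xi S x *m G w by rewrite /xnz /cov mul0mx subr0.
rewrite !E (derive_linear dxi) gmx_linear.
move: ('D_u (xi S) x) ('D_v (xi S) x) (G u) (G v) => a1 a2 b1 b2.
by rewrite mulmxDr -scalemxAr scalerDr addrACA.
Qed.

(** The bridge to the pointwise algebra: each relation between the derivatives is the covariant
    derivative of an identity valid on all of U, namely [phi_met], [phi_sq], [xi_phi] or [ip_xi]. *)
Lemma xcp : contact_point (ip (met S) x) (xphi x) (xi S x) (xnp x) (xnz x).
Proof.
have [h1 h2 h3] : [/\ forall v, v *m phi S x *m phi S x = - v + etav S x v *: xi S x,
          etav S x (xi S x) = 1 &
          forall v w, ip (met S) x (v *m phi S x) (w *m phi S x) =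
                      ip (met S) x v w - etav S x v * etav S x w].
  by case: aS => _ _ _ _; exact.
split=> //.
- by move=> a u v; rewrite /xphi mulmxDl scalemxAl.
- by move=> v; rewrite /xphi h1 (etavE Ux).
- by move=> v w; rewrite /xphi h3 !(etavE Ux).
- by rewrite -(etavE Ux).
- exact: xi_phi.
- by move=> w; exact: (jetn_linearl (met S) oU phi_smooth Ux).
- exact: jetn_linearr.
- exact: xnz_linear.
- by move=> v w u; exact: (jetn_skew oU rg phi_smooth Ux v w u phi_met).
- exact: xnp_phi.
- exact: xnp_xi.
- exact: xnz_xi.
Qed.

End Derivatives.
End Structure.

Section Bridges.
Context {R : realType} {d : nat}.
Variables (S : lacm R d) (U : set 'rV[R]_d) (x : 'rV[R]_d).
Hypotheses (oU : open U) (aS : acm_on S U) (Ux : U x).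

Let rg : riemannian_on (met S) U. Proof. by case: aS. Qed.
Let dphi := phi_differentiable oU aS Ux.
Let dxi := xi_differentiable oU aS Ux.
Let dg := met_differentiable oU rg Ux.
Let ig := met_inner rg Ux.
Let cp := xcp oU aS Ux.
Local Notation G := (gmx (met S) x).
Local Notation g := (ip (met S) x).
Local Notation p := (xphi S x).
Local Notation z := (xi S x).
Local Notation np := (xnp S x).
Local Notation nz := (xnz S x).

Section Fields.
Variables X Y : 'rV[R]_d -> 'rV[R]_d.
Hypotheses (dX : differentiable X x) (dY : differentiable Y x).

Lemma differentiable_appl : differentiable (appl (phi S) X) x.
Proof. exact: differentiable_mulmx. Qed.

Lemma nphiE : nphi S X Y x = np (X x) (Y x).
Proof. exact: (nabla_endE (met S) oU (phi_smooth aS) Ux X dY). Qed.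

Lemma derive_appl v : 'D_v (appl (phi S) X) x = 'D_v X x *m phi S x + X x *m 'D_v (phi S) x.
Proof.
by have [_ ->] := is_derive_mulmx (derivableP (diff_derivable (v := v) dX))
                                  (derivableP (diff_derivable (v := v) dphi)).
Qed.

Lemma htenE : hten S X x = htensor p z np nz (X x).
Proof.
rewrite /hten /htensor.
rewrite [X in _ *: X](_ : _ = lie_bracket (xi S) (appl (phi S) X) x
   - lie_bracket (xi S) X x *m phi S x) //.
have nzE w : nz w = 'D_w (xi S) x + xi S x *m G w by rewrite /xnz /cov mul0mx subr0.
congr (_ *: _); rewrite /lie_bracket derive_appl /appl /xphi !nzE /xnp /cov.
rewrite (gmx_sym oU rg Ux z (X x *m phi S x)) (gmx_sym oU rg Ux z (X x)).
rewrite !(mulmxBl, mulmxDl, mulmxBr, mulmxDr) !mulmxA.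
move: ('D_z X x *m _) (X x *m 'D_z (phi S) x) ('D_(X x *m phi S x) (xi S) x) => a b c.
move: ('D_(X x) (xi S) x *m _) (X x *m G z *m _) (X x *m phi S x *m _) => e f h.
by apply/rowP => k; rewrite !mxE; ring.
Qed.

End Fields.

Lemma dird_etaf X v : differentiable X x -> 'D_v (etaf S X) x =
  (('D_v X x + X x *m G v) *m met S x *m (xi S x)^T) 0 0 + (X x *m met S x *m (nz v)^T) 0 0.
Proof.
move=> dX; have E : forall y, U y -> X y *m Defs.eta S y = X y *m (met S y *m (xi S y)^T).
  by move=> y Uy; rewrite (etaE aS Uy).
have dxiT := differentiable_trmx dxi.
have dgxi := differentiable_mulmx dg dxiT.
have deta_ : differentiable (Defs.eta S) x.
  by apply: (smooth_differentiable oU _ Ux); case: aS.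
have /is_derive_mxP/(_ 0 0)[_] := is_derive_mulmx (derivableP (diff_derivable (v := v) dX))
                                  (derivableP (diff_derivable (v := v) deta_)).
move=> H; rewrite [LHS]H.
transitivity (((('D_v X x + X x *m G v) *m met S x *m (xi S x)^T) + (X x *m met S x *m (nz v)^T)) 0 0); last by rewrite mxE.
congr (fun_of_matrix _ 0 0); have := cov_near 0 0 v oU Ux E.
rewrite [in RHS](cov_mulmx _ (G v)) // (cov_met_tr oU rg Ux) //.
rewrite /cov !mul0mx !mulmx0 !subr0 !addr0.
have [_ ->] := is_derive_mulmx (derivableP (diff_derivable (v := v) dX))
                                  (derivableP (diff_derivable (v := v) deta_)).
by move=> ->; rewrite !mulmxA /xnz /cov mul0mx subr0.
Qed.

(** By the symmetry of the Christoffel symbols, the derivatives of X and Y cancel against the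
    bracket. *)
Lemma detaE X Y : differentiable X x -> differentiable Y x ->
  deta S X Y x = 2^-1 * two_deta g nz (X x) (Y x).
Proof.
move=> dX dY; rewrite /deta /dird !dird_etaf //.
congr (_ * _).
rewrite /etaf (etavE aS Ux) /lie_bracket /two_deta !mulmxDl (gmx_sym oU rg Ux (X x) (Y x)).
rewrite (innerDl ig) (innerNl ig).
rewrite (inner_sym ig (nz (X x))) (inner_sym ig (nz (Y x))) /ip.
move: ('D_(X x) Y x *m _ *m _) ('D_(Y x) X x *m _ *m _) (Y x *m G _ *m _ *m _) => a b c.
move: (Y x *m _ *m _) (X x *m _ *m _) => e f.
by rewrite !mxE; ring.
Qed.

Lemma PtenE X Y : differentiable X x -> differentiable Y x ->
  Pten S X Y x = np (X x) (Y x) + np (p (X x)) (p (Y x)).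
Proof.
move=> dX dY; rewrite [LHS](_ : _ = nphi S X Y x + nphi S (appl (phi S) X) (appl (phi S) Y) x) //.
by rewrite !nphiE //; exact: differentiable_appl.
Qed.

Lemma dOmE u v w : dOm S (fun=> u) (fun=> v) (fun=> w) x = dOmega g np u v w.
Proof. exact: (d_fundE oU rg (phi_smooth aS) Ux). Qed.

Lemma OmE u v : Om S (fun=> u) (fun=> v) x = g u (p v).
Proof. by []. Qed.

Lemma etafE X : etaf S X x = g (X x) z.
Proof. by rewrite /etaf (etavE aS Ux). Qed.

(* The xi-component of the normality condition, for the fields v and xi. *)
Lemma normal_geodesic :
  (forall v, nijenhuis (phi S) (fun=> v) (xi S) x + (2 * deta S (fun=> v) (xi S) x) *: z = 0) ->
  nz z = 0.
Proof.
move=> H; apply: (xi_geodesic cp) => v; have dv : differentiable (fun=> v : 'rV[R]_d) x.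
  exact: differentiable_cst.
have := congr1 (fun w => g w z) (H v); rewrite /= (innerDl ig) (innerZl ig) (inner0l ig).
rewrite (cp_zz cp) mulr1 detaE // mulrA mulfV ?mul1r //.
(* phi xi vanishes on all of U, so this bracket is zero; the other three terms of the Nijenhuis
   tensor lie in the image of phi. *)
have Z : lie_bracket (appl (phi S) (fun=> v)) (appl (phi S) (xi S)) x = 0.
  rewrite /lie_bracket [X in _ - 'D_X _ _](_ : _ = 0) ?derive0 ?subr0; last exact: (xi_phi aS Ux).
  rewrite (near_eq_derive (g := cst 0)) ?derive_cst //.
  by apply: (open_near_eq oU _ Ux) => y Uy; exact: (xi_phi aS Uy).
rewrite [X in g X _ + _](_ : _ = appl (phi S) (lie_bracket (fun=> v) (xi S)) x *m phi S x
   + lie_bracket (appl (phi S) (fun=> v)) (appl (phi S) (xi S)) x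
   - lie_bracket (appl (phi S) (fun=> v)) (xi S) x *m phi S x
   - lie_bracket (fun=> v) (appl (phi S) (xi S)) x *m phi S x) //.
have gpz w : g (w *m phi S x) z = 0 by exact: (cp_gpz cp w).
rewrite Z addr0; move: (appl _ _ x) (lie_bracket _ _ x) (lie_bracket _ _ x) => a b c.
rewrite !(innerDl ig) !(innerNl ig) !gpz !subr0 add0r => E.
by have := E; rewrite /two_deta; lra.
Qed.

Lemma codiff_OmE (m : nat) (e : 'I_m -> 'rV[R]_d -> 'rV[R]_d) X :
  (forall k, differentiable (e k) x) ->
  codiff_Om S e X x = g (\sum_k Pquad p np (e k x) - p (nz z)) (X x).
Proof.
move=> de; rewrite /codiff_Om; congr (ip _ _ _ _).
rewrite [X in _ + X](_ : _ = \sum_k Pquad p np (e k x)).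
  by rewrite addrC; congr (_ - _); rewrite /appl nablaE.
by apply: eq_bigr => k _; rewrite PtenE.
Qed.

End Bridges.

(** * Adapted frames *)

Lemma mulmx1_square {R : comUnitRingType} {p q} (A : 'M[R]_(p, q)) (B : 'M[R]_(q, p)) :
  p = q -> A *m B = 1%:M -> B *m A = 1%:M.
Proof. by move=> pq; subst q; exact: mulmx1C. Qed.

Definition rows_mx {R : Type} {a d} (E : 'I_a -> 'rV[R]_d) : 'M[R]_(a, d) :=
  \matrix_(k < a, j < d) E k 0 j.

Lemma rows_mxK {R : Type} {a d} (E : 'I_a -> 'rV[R]_d) k : row k (rows_mx E) = E k.
Proof. by apply/rowP => j; rewrite !mxE. Qed.

Lemma mulmx_tr_ip {R : realType} {d} (g : 'rV[R]_d -> 'M[R]_d) x {a b}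
    (E : 'I_a -> 'rV[R]_d) (F : 'I_b -> 'rV[R]_d) :
  rows_mx E *m g x *m (rows_mx F)^T = \matrix_(k, l) ip g x (E k) (F l).
Proof.
apply/row_matrixP => k; rewrite !row_mul rows_mxK; apply/rowP => l.
by rewrite !mxE /ip mxE; apply: eq_bigr => j _; rewrite !mxE.
Qed.

Section PointFrames.
Context {R : realType} {m : nat}.
Local Notation d := (m.*2.+1).
Variables (S : lacm R d) (U : set 'rV[R]_d) (x : 'rV[R]_d).
Hypotheses (oU : open U) (aS : acm_on S U) (Ux : U x).

Let rg : riemannian_on (met S) U. Proof. by case: aS. Qed.
Let ig := met_inner rg Ux.
Let cp := xcp oU aS Ux.
Local Notation g := (ip (met S) x).
Local Notation p := (xphi S x).
Local Notation z := (xi S x).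

Variable e : 'I_m -> 'rV[R]_d.
Hypotheses (ee : forall k l, g (e k) (e l) = (k == l)%:R)
  (epe : forall k l, g (e k) (p (e l)) = 0) (ez : forall k, g (e k) z = 0).

(** The Gram matrix F g F^T of the frame is the identity. F is square, having 2m + 1 rows, so g F^T
    F is the identity as well, and this is the expansion. *)
Lemma frame_complete u : u =
  \sum_k (g u (e k) *: e k + g u (p (e k)) *: p (e k)) + g u z *: z.
Proof.
pose E := rows_mx e; pose P := rows_mx (p \o e); pose Z := rows_mx (fun _ : 'I_1 => z).
pose F := col_mx (col_mx E P) Z.
have H : F *m met S x *m F^T = 1%:M.
  rewrite /F !tr_col_mx !mul_col_mx !mul_mx_row !mulmx_tr_ip.
  rewrite (scalar_mx_block (m + m) 1) (scalar_mx_block m m) /block_mx.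
  have pe k l : g (p (e k)) (e l) = 0 by rewrite (inner_sym ig).
  have -> : \matrix_(k, l) g (e k) (e l) = 1%:M by apply/matrixP => k l; rewrite !mxE ee.
  have -> : \matrix_(k, l) g (e k) ((p \o e) l) = 0 by apply/matrixP => k l; rewrite !mxE epe.
  have -> : \matrix_(k, l) g ((p \o e) k) (e l) = 0 by apply/matrixP => k l; rewrite !mxE pe.
  have -> : \matrix_(k, l) g ((p \o e) k) ((p \o e) l) = 1%:M.
    by apply/matrixP => k l; rewrite !mxE /= (cp_gpp cp) ee !ez mulr0 subr0.
  have -> : \matrix_(k < m, l < 1) g (e k) z = 0 by apply/matrixP => k l; rewrite !mxE ez.
  have -> : \matrix_(k < m, l < 1) g ((p \o e) k) z = 0.
    by apply/matrixP => k l; rewrite !mxE /= (cp_gpz cp).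
  have -> : \matrix_(k < 1, l < m) g z (e l) = 0.
    by apply/matrixP => k l; rewrite !mxE (inner_sym ig) ez.
  have -> : \matrix_(k < 1, l < m) g z ((p \o e) l) = 0.
    by apply/matrixP => k l; rewrite !mxE (inner_sym ig) /= (cp_gpz cp).
  have -> : \matrix_(k < 1, l < 1) g z z = 1%:M.
    by apply/matrixP => k l; rewrite !mxE (cp_zz cp) !ord1.
  by rewrite -[X in col_mx X _]/(block_mx (row_mx 1%:M 0) 0 (row_mx 0 1%:M) 0) block_mxEh col_mx0 row_mx0.
have dim : (m + m + 1 = d)%N by rewrite addn1 addnn.
rewrite -mulmxA in H; have K := mulmx1_square dim H.
have row1 (a : nat) (A : 'I_a -> 'rV[R]_d) :
    u *m (met S x *m (rows_mx A)^T) *m rows_mx A = \sum_k g u (A k) *: A k.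
  rewrite mulmx_sum_row; apply: eq_bigr => k _; rewrite rows_mxK mulmxA /ip; congr (_ *: _).
  by rewrite !mxE; apply: eq_bigr => j _; rewrite !mxE.
rewrite -{1}[u]mulmx1 -K mulmxA /F !tr_col_mx !mul_mx_row !mul_row_col.
by rewrite /E /P /Z !row1 /= -big_split big_ord1.
Qed.

Local Notation trace := (frame_trace p z e).

(** The rows of the inverse metric are dual to the coordinates: this turns contractions with it into
    traces over a frame. *)
Lemma inverse_metric_row (i : 'I_d) w : g (row i (invmx (met S x))) w = w 0 i.
Proof.
rewrite /ip -row_mul mulVmx ?(met_unit rg) // row1 -rowE !mxE //.
Qed.

Lemma frame_trace_inv {V : lmodType R} (B : 'rV[R]_d -> 'rV[R]_d -> V) :
  (forall v, linear (B v)) -> (forall w, linear (B ^~ w)) ->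
  \sum_i \sum_j invmx (met S x) i j *: B (crd i) (crd j) = trace B.
Proof.
move=> Br Bl.
have rowE i : row i (invmx (met S x)) = \sum_j invmx (met S x) i j *: crd j.
  by rewrite [LHS]row_sum_delta; apply: eq_bigr => j _; rewrite mxE.
transitivity (\sum_i trace (fun v w => v 0 i *: B (crd i) w)).
  apply: eq_bigr => i _.
  rewrite -(eq_frame_trace p z e (Q := fun v w => g (row i (invmx (met S x))) v *: B (crd i) w)).
    rewrite (frame_expand frame_complete _ (Br (crd i))) rowE (lin_sum (Br _)).
    by apply: eq_bigr => j _; rewrite (linZ (Br _)).
  by move=> v; rewrite inverse_metric_row.
rewrite -frame_trace_sum; apply: eq_frame_trace => v.
have := lin_sum (Bl v) (index_enum _) (fun i => v 0 i *: crd i).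
rewrite /= -rV_sum_coord => ->; apply: eq_bigr => i _.
by rewrite (linZ (Bl v)).
Qed.

Lemma frame_trace_div (f : 'rV[R]_d -> 'rV[R]_d) : linear f ->
  \sum_i (f (crd i)) 0 i = trace (fun v w => g (f v) w).
Proof.
move=> lf; transitivity (\sum_i trace (fun v w => v 0 i * g (f (crd i)) w)).
  apply: eq_bigr => i _.
  rewrite -(eq_frame_trace p z e
    (Q := fun v w => g (row i (invmx (met S x))) v * g (f (crd i)) w)).
    rewrite (frame_expandR frame_complete (f := fun w => g (f (crd i)) w)).
      by rewrite (inner_sym ig) inverse_metric_row.
    by move=> a v w; rewrite !(innerE ig).
  by move=> v; rewrite inverse_metric_row.
rewrite -frame_trace_sum; apply: eq_frame_trace => v.
rewrite {3}(rV_sum_coord v) (lin_sum lf) (inner_suml ig); apply: eq_bigr => i _.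
by rewrite (linZ lf) (innerZl ig).
Qed.

Lemma frame_trace_xi (f : 'rV[R]_d -> 'rV[R]_d) :
  trace (fun v w => g (xnz S x v) w) = \sum_k xi_trace g p (xnz S x) (e k).
Proof. by rewrite /frame_trace (cp_nzz cp) addr0. Qed.

Lemma frame_trace_np :
  trace (xnp S x) = \sum_k Pquad p (xnp S x) (e k) - p (xnz S x z).
Proof. by rewrite /frame_trace (cp_npz cp). Qed.

End PointFrames.

Section Normalization.
Context {R : realType} {d : nat}.
Variables (g : 'rV[R]_d -> 'M[R]_d) (V : set 'rV[R]_d).
Hypotheses (oV : open V) (sg : smooth_on V g).

Lemma smooth_ip (a b : 'rV[R]_d -> 'rV[R]_d) :
  smooth_on V a -> smooth_on V b -> smooth_on V (fun y => ip g y (a y) (b y)).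
Proof.
move=> sa sb.
have /(smooth_mxP oV) H := smooth_mulmx oV (smooth_mulmx oV sa sg) (smooth_trmx oV sb).
exact: (H 0 0).
Qed.

Lemma open_positive (u : 'rV[R]_d -> R) : smooth_on V u -> open (V `&` [set y | 0 < u y]).
Proof.
move=> su; rewrite openE => y [Vy uy]; apply: filterI; first exact: (open_nbhs_nbhs (conj oV Vy)).
have [cu _ _] := smooth_onS su; exact: (cvgr_gt _ (cu y Vy) _ uy).
Qed.

Lemma smooth_normalize (v : 'rV[R]_d -> 'rV[R]_d) x : smooth_on V v -> V x ->
  0 < ip g x (v x) (v x) ->
  exists V' u (c : 'rV[R]_d -> R),
    [/\ open V', V' x, V' `<=` V, smooth_on V' u &
        forall y, V' y -> u y = c y *: v y /\ ip g y (u y) (u y) = 1].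
Proof.
move=> sv Vx v0; have sn := smooth_ip sv sv.
pose V' := V `&` [set y | 0 < ip g y (v y) (v y)].
pose c y := (Num.sqrt (ip g y (v y) (v y)))^-1.
have V'V : V' `<=` V by move=> y [].
have oV' : open V' by exact: open_positive sn.
exists V', (fun y => c y *: v y), c; split=> //.
  apply: (smooth_scalemx oV'); last exact: smooth_sub V'V sv.
  apply: (smoothV oV'); first by move=> y [_ /= p]; rewrite gt_eqF // sqrtr_gt0.
  by apply: (smooth_sqrt oV'); [move=> y []|exact: smooth_sub V'V sn].
move=> y [_ /= p]; split=> //.
rewrite /ip -!scalemxAl mxE linearZ /= -scalemxAr mxE -/(ip g y (v y) (v y)) mulrA.
have s0 : Num.sqrt (ip g y (v y) (v y)) != 0 by rewrite gt_eqF // sqrtr_gt0.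
by rewrite -[X in _ * X](sqr_sqrtr (ltW p)) expr2 /c mulrACA mulVf // mulr1.
Qed.
End Normalization.

Section FrameExistence.
Context {R : realType} {d : nat}.
Variables (S : lacm R d) (U : set 'rV[R]_d).
Hypotheses (oU : open U) (aS : acm_on S U).
Let rg : riemannian_on (met S) U. Proof. by case: aS. Qed.

(** A vector orthogonal to the given fields at x is extended as a constant field, made orthogonal to
    them near x by Gram-Schmidt, and normalised. *)
Lemma phi_frame_step (k : nat) (V : set 'rV[R]_d) (e : 'I_k -> 'rV[R]_d -> 'rV[R]_d) x :
  (k + k + 1 < d)%N -> V `<=` U -> V x -> phi_frame S V e ->
  exists V' (e' : 'I_k.+1 -> 'rV[R]_d -> 'rV[R]_d), [/\ V' `<=` V, V' x & phi_frame S V' e'].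
Proof.
move=> kd VU Vx [oV se fr].
have sg := smooth_sub VU (met_smooth rg).
have sp := smooth_sub VU (phi_smooth aS).
have sx := smooth_sub VU (xi_smooth aS).
have cpV y (Vy : V y) := xcp oU aS (VU y Vy).
pose E := col_mx (col_mx (rows_mx (e^~ x)) (rows_mx (fun l => e l x *m phi S x)))
                 (rows_mx (fun _ : 'I_1 => xi S x)).
pose N := met S x *m E^T.
(* There are 2k + 1 < d orthogonality conditions at x, so they have a nonzero solution. *)
have /rowV0Pn[v0 v0N v0n] : kermx N != 0.
  rewrite -mxrank_eq0 mxrank_ker subn_eq0 -ltnNge.
  exact: leq_ltn_trans (rank_leq_col _) kd.
have N0 : v0 *m N = 0 by apply/sub_kermxP.
have orth0 : [/\ forall l, ip (met S) x v0 (e l x) = 0,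
    forall l, ip (met S) x v0 (e l x *m phi S x) = 0 & ip (met S) x v0 (xi S x) = 0].
  have row1 a (A : 'I_a -> 'rV[R]_d) : v0 *m (met S x *m (rows_mx A)^T) = 0 ->
      forall l, ip (met S) x v0 (A l) = 0.
    move=> H l; have := congr1 (fun M : 'rV[R]_a => M 0 l) H.
    rewrite mulmxA mxE [X in _ = X -> _]mxE => E0; rewrite /ip mxE -[RHS]E0.
    by apply: eq_bigr => j _; rewrite !mxE.
  move: N0; rewrite /N /E !tr_col_mx !mul_mx_row => /eqP.
  rewrite row_mx_eq0 => /andP[/eqP + /eqP/row1 H3] => /eqP.
  rewrite row_mx_eq0 => /andP[/eqP/row1 H1 /eqP/row1 H2].
  by split=> //; exact: (H3 0).
pose pe l := appl (phi S) (e l).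
have spe l : smooth_on V (pe l) by exact: (smooth_mulmx oV (se l) sp).
have sv0 : smooth_on V (fun=> v0) by exact: smooth_cst.
pose v y := v0 - \sum_l (ip (met S) y v0 (e l y) *: e l y
    + ip (met S) y v0 (pe l y) *: pe l y) - ip (met S) y v0 (xi S y) *: xi S y.
have sv : smooth_on V v.
  have sN (u : 'rV[R]_d -> 'rV[R]_d) : smooth_on V u -> smooth_on V (fun y => - u y).
    move=> su; apply: (smooth_eq oV (f := fun y => (- 1 : R) *: u y)).
      by move=> y _; rewrite scaleN1r.
    apply: (smooth_scalemx oV) su; exact: smooth_cst.
  have s1 l := smooth_scalemx oV (smooth_ip oV sg sv0 (se l)) (se l).
  have s2 l := smooth_scalemx oV (smooth_ip oV sg sv0 (spe l)) (spe l).
  have s3 := sN _ (smooth_scalemx oV (smooth_ip oV sg sv0 sx) sx).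
  have s4 := sN _ (smooth_sum oV (index_enum _) (P := xpredT) (fun l _ => smoothD oV (s1 l) (s2 l))).
  exact: (smoothD oV (smoothD oV sv0 s4) s3).
(* The corrections vanish at x, so v is nonzero there and can be normalised nearby. *)
have vx : v x = v0.
  case: orth0 => H1 H2 H3; rewrite /v H3 scale0r subr0 big1 ?subr0 // => l _.
  by rewrite H1 H2 !scale0r addr0.
have v_orth y : V y -> [/\ forall l, ip (met S) y (v y) (e l y) = 0,
    forall l, ip (met S) y (v y) (pe l y) = 0 & ip (met S) y (v y) (xi S y) = 0].
  move=> Vy; have cp := cpV y Vy; have ig := cp_inner cp.
  have [H1 H2 H3 H4 H5] := fr y Vy.
  have D w : ip (met S) y (v y) w = ip (met S) y v0 w
     - \sum_l (ip (met S) y v0 (e l y) * ip (met S) y (e l y) w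
             + ip (met S) y v0 (pe l y) * ip (met S) y (pe l y) w)
     - ip (met S) y v0 (xi S y) * ip (met S) y (xi S y) w.
    rewrite /v !(innerDl ig) !(innerNl ig) (innerZl ig) (inner_suml ig).
    congr (_ - _ - _); apply: eq_bigr => l _.
    by rewrite (innerDl ig) !(innerZl ig).
  split=> [l|l|].
  - rewrite D (inner_sym ig (xi S y)) (H4 l).1 mulr0 subr0 (bigD1 l) //= H1 eqxx.
    rewrite (inner_sym ig (pe l y)) H2 mulr0 addr0 mulr1 big1 ?addr0 ?subrr // => l' nl.
    by rewrite H1 (inner_sym ig (pe l' y)) H2 (negPf nl) !mulr0 addr0.
  - rewrite D (inner_sym ig (xi S y)) (H4 l).2 mulr0 subr0 (bigD1 l) //= H3 eqxx.
    rewrite H2 mulr0 add0r mulr1 big1 ?addr0 ?subrr // => l' nl.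
    by rewrite H3 H2 (negPf nl) !mulr0 addr0.
  - rewrite D H5 mulr1 big1 ?subr0 ?subrr // => l _.
    by rewrite (H4 l).1 (H4 l).2 !mulr0 addr0.
have pos : 0 < ip (met S) x (v x) (v x) by rewrite vx (inner_pos (cp_inner (cpV x Vx))).
have [V' [u [c [oV' V'x V'V su Hu]]]] := smooth_normalize oV sg sv Vx pos.
pose e' (i : 'I_k.+1) := if unlift ord_max i is Some j then e j else u.
have e'l (j : 'I_k) : e' (lift ord_max j) = e j by rewrite /e' liftK.
have e'm : e' ord_max = u by rewrite /e' unlift_none.
exists V', e'; split; [exact: V'V|exact: V'x|split; [exact: oV'| |]].
  move=> i; rewrite /e'; case: (unlift _ i) => [j|]; last exact: su.
  exact: smooth_sub V'V (se j).
move=> y V'y; have Vy := V'V y V'y; have cp := cpV y Vy; have ig := cp_inner cp.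
have [H1 H2 H3 H4 H5] := fr y Vy; have [q1 q2 q3] := v_orth y Vy; have [uE uu] := Hu y V'y.
have U1 l : ip (met S) y (u y) (e l y) = 0 by rewrite uE (innerZl ig) q1 mulr0.
have U2 l : ip (met S) y (u y) (pe l y) = 0 by rewrite uE (innerZl ig) q2 mulr0.
have U3 : ip (met S) y (u y) (xi S y) = 0 by rewrite uE (innerZl ig) q3 mulr0.
have gs a b : ip (met S) y a (b *m phi S y) = - ip (met S) y (a *m phi S y) b.
  by have := cp_gskew cp a b; rewrite /xphi => ->; rewrite opprK.
have U4 l : ip (met S) y (e l y) (appl (phi S) u y) = 0.
  by rewrite /appl gs (inner_sym ig) U2 oppr0.
have gpp a b : ip (met S) y (a *m phi S y) (b *m phi S y) =
    ip (met S) y a b - ip (met S) y a (xi S y) * ip (met S) y b (xi S y) := cp_gpp cp a b.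
have U5 : ip (met S) y (u y) (appl (phi S) u y) = 0.
  by have := gs (u y) (u y); rewrite /appl (inner_sym ig (_ *m _)); lra.
have lm (j : 'I_k) : (lift ord_max j == ord_max) = false by rewrite eq_sym (negbTE (neq_lift _ _)).
have ml (j : 'I_k) : (ord_max == lift ord_max j) = false by rewrite (negbTE (neq_lift _ _)).
split.
- move=> a b; case: (unliftP ord_max a) => [i ->|->]; case: (unliftP ord_max b) => [j ->|->].
  + by rewrite !e'l H1 (inj_eq lift_inj).
  + by rewrite e'l e'm lm (inner_sym ig).
  + by rewrite e'l e'm ml.
  + by rewrite e'm eqxx.
- move=> a b; case: (unliftP ord_max a) => [i ->|->]; case: (unliftP ord_max b) => [j ->|->].
  + by rewrite !e'l H2.
  + by rewrite e'l e'm.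
  + by rewrite e'l e'm; exact: U2.
  + by rewrite e'm.
- move=> a b; case: (unliftP ord_max a) => [i ->|->]; case: (unliftP ord_max b) => [j ->|->].
  + by rewrite !e'l H3 (inj_eq lift_inj).
  + by rewrite e'l e'm lm /appl gpp (H4 i).1 mul0r subr0 (inner_sym ig).
  + by rewrite e'l e'm ml /appl gpp U3 mul0r subr0.
  + by rewrite e'm eqxx /appl gpp U3 mul0r subr0.
- move=> a; case: (unliftP ord_max a) => [i ->|->].
  + by rewrite e'l; exact: H4.
  + by rewrite e'm; split=> //; exact: (cp_gpz cp).
- exact: H5.
Qed.

(** [almost_semi_sasakian] constrains local frames, so one is needed around every point to extract
    its content. *)
Lemma phi_frame_exists (m : nat) x : (m.*2 < d)%N -> U x ->
  exists V (e : 'I_m -> 'rV[R]_d -> 'rV[R]_d), [/\ V `<=` U, V x & phi_frame S V e].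
Proof.
move=> md Ux; elim: m md => [_|k IH kd].
  exists U, (fun _ _ => 0); split; [by []|exact: Ux|split; [exact: oU|by case|move=> y Uy]].
  split; (try by case); exact: (cp_zz (xcp oU aS Uy)).
have kd' : (k.*2.+2 < d)%N by rewrite doubleS in kd.
have [|V [e [VU Vx fr]]] := IH; first exact: ltn_trans (leqnSn _) kd'.
have [|V' [e' [V'V V'x fr']]] := @phi_frame_step k V e x _ VU Vx fr.
  by rewrite addnn addn1 (ltn_trans _ kd').
by exists V', e'; split; [exact: subset_trans VU|exact: V'x|exact: fr'].
Qed.

End FrameExistence.

(** * The Reeb field is divergence free *)

Section SkewDivergence.
Context {R : realType} {d : nat}.

Lemma skew_sum0 (s : 'I_d -> 'I_d -> R) : (forall i j, s i j = - s j i) ->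
  \sum_i \sum_j s i j = 0.
Proof.
move=> H; have : \sum_i \sum_j s i j = - \sum_i \sum_j s i j.
  rewrite {1}exchange_big /= -sumrN; apply: eq_bigr => i _.
  by rewrite -sumrN; apply: eq_bigr => j _; exact: H.
lra.
Qed.

(** This is delta^2 = 0 in coordinates. F is a bivector and a stands for d log sqrt(det g): X is the
    divergence of F and the conclusion is the divergence of X. Each double sum pairs a skew factor
    with a symmetric one or cancels another. *)
Lemma divergence_skew (U : set 'rV[R]_d) x (F : 'I_d -> 'I_d -> 'rV[R]_d -> R)
    (a X : 'I_d -> 'rV[R]_d -> R) :
  open U -> U x -> (forall i j, smooth_on U (F i j)) ->
  (forall i j y, U y -> F i j y = - F j i y) ->
  (forall k, differentiable (a k) x) ->
  (forall j k, 'D_(crd j) (a k) x = 'D_(crd k) (a j) x) ->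
  (forall j y, U y -> X j y = \sum_i 'D_(crd i) (F i j) y + \sum_k a k y * F k j y) ->
  \sum_j 'D_(crd j) (X j) x + \sum_k a k x * X k x = 0.
Proof.
move=> oU Ux sF skF da saa HX.
have dF i j : differentiable (F i j) x by exact: smooth_fun_differentiable (sF i j) Ux.
have dDF i j : differentiable ('D_(crd i) (F i j)) x.
  exact: smooth_fun_differentiable (smooth_derive i (sF i j)) Ux.
have DX j : 'D_(crd j) (X j) x = \sum_i 'D_(crd j) ('D_(crd i) (F i j)) x +
    \sum_k ('D_(crd j) (a k) x * F k j x + a k x * 'D_(crd j) (F k j) x).
  rewrite (near_eq_derive _ (open_near_eq oU (HX j) Ux)).
  have [_ H1] := is_derive_big (index_enum _)
    (fun i => derivableP (diff_derivable (v := crd j) (dDF i j))).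
  have D2 k : is_derive x (crd j) (fun y => a k y * F k j y)
      ('D_(crd j) (a k) x * F k j x + a k x * 'D_(crd j) (F k j) x).
    have := is_deriveM (derivableP (diff_derivable (v := crd j) (da k)))
                       (derivableP (diff_derivable (v := crd j) (dF k j))).
    by rewrite /GRing.scale /= [X in is_derive _ _ _ X]addrC [F k j x * _]mulrC.
  have D3 := is_derive_big (index_enum _) D2.
  have D1 := is_derive_big (index_enum _)
    (fun i => derivableP (diff_derivable (v := crd j) (dDF i j))).
  by have [_] := is_deriveD D1 D3.
have skD v i j : 'D_v (F i j) x = - 'D_v (F j i) x.
  rewrite (near_eq_derive _ (open_near_eq oU (skF i j) Ux)).
  exact: deriveN (diff_derivable (dF j i)).
rewrite (eq_bigr _ (fun j _ => DX j)) big_split /=.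
have -> : \sum_j \sum_i 'D_(crd j) ('D_(crd i) (F i j)) x = 0.
  apply: skew_sum0 => j i; rewrite (Schwarz oU _ _ (sF i j) Ux).
  have E : forall y, U y -> 'D_(crd j) (F i j) y = (- 'D_(crd j) (F j i)) y.
    move=> y Uy; rewrite (near_eq_derive _ (open_near_eq oU (skF i j) Uy)).
    exact: deriveN (diff_derivable (smooth_fun_differentiable oU (sF j i) Uy)).
  rewrite (near_eq_derive _ (open_near_eq oU E Ux)).
  exact: deriveN (diff_derivable (dDF j i)).
rewrite add0r; under eq_bigr do rewrite big_split; rewrite big_split /=.
have -> : \sum_j \sum_k 'D_(crd j) (a k) x * F k j x = 0.
  by apply: skew_sum0 => j k; rewrite (saa j k) (skF k j _ Ux) mulrN.
under [X in _ + _ + X]eq_bigr => k _ do rewrite (HX k x Ux) mulrDr !mulr_sumr.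
rewrite big_split /= add0r addrA.
have -> : \sum_k \sum_i a k x * (a i x * F i k x) = 0.
  by apply: skew_sum0 => k i; rewrite (skF i k _ Ux) mulrCA !mulrN.
(* The two sums left, a times a derivative of F, are opposite by skewness. *)
rewrite addr0 exchange_big -big_split /= big1 // => k _; rewrite -big_split big1 //= => i _.
by rewrite (skD _ i k) mulrN addrN.
Qed.

End SkewDivergence.

Section CoexactReeb.
Context {R : realType} {d : nat}.
Variables (S : lacm R d) (U : set 'rV[R]_d).
Hypotheses (oU : open U) (aS : acm_on S U).
Let rg : riemannian_on (met S) U. Proof. by case: aS. Qed.
Let sg := met_smooth rg.
Local Notation G := (gmx (met S)).

Lemma invmet_smooth : smooth_on U (fun y => invmx (met S y)).
Proof. by apply: (smooth_invmx oU) sg => y; exact: met_unit. Qed.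

Lemma gmx_coord y (i j k : 'I_d) : G y (crd i) j k = christoffel (met S) y i j k.
Proof.
rewrite mxE (bigD1 i) //= big1 ?addr0; first by rewrite mxE !eqxx mul1r.
by move=> i' ni; rewrite mxE (negPf ni) andbF mul0r.
Qed.

(** The contracted symbols are the derivative of log sqrt(det g); writing it as a trace avoids
    differentiating a determinant. *)
Lemma gmx_trace y k : U y ->
  \sum_i G y (crd i) k i = 2^-1 * \tr (invmx (met S y) *m 'D_(crd k) (met S) y).
Proof.
move=> Uy; have -> : \sum_i G y (crd i) k i = \tr (G y (crd k)).
  by apply: eq_bigr => i _; rewrite !gmx_coord (christoffel_sym oU rg Uy).
have /eqP := cov_met oU rg Uy (crd k); rewrite /cov mulmxN subr_eq0 subr_eq => /eqP ->.
rewrite mulmxDr mxtraceD mulmxA mulVmx ?(met_unit rg) // mul1mx.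
by rewrite mulmxA mxtrace_mulC mulmxA mulmxV ?(met_unit rg) // mul1mx mxtrace_tr; field.
Qed.

Section At.
Variable x : 'rV[R]_d.
Hypothesis Ux : U x.

Lemma derive_invmet v : 'D_v (fun y => invmx (met S y)) x =
  - (invmx (met S x) *m 'D_v (met S) x *m invmx (met S x)).
Proof.
have dg := met_differentiable oU rg Ux.
have di := smooth_differentiable oU invmet_smooth Ux.
have [_ E] := is_derive_mulmx (derivableP (diff_derivable (v := v) di))
                              (derivableP (diff_derivable (v := v) dg)).
have : 'D_v (fun y => invmx (met S y) *m met S y) x = 0.
  rewrite (near_eq_derive (g := cst (1%:M : 'M[R]_d))) ?derive_cst //.
  by apply: (open_near_eq oU _ Ux) => y Uy; rewrite mulVmx // (met_unit rg).
rewrite E => /(congr1 (mulmx^~ (invmx (met S x)))); rewrite mul0mx mulmxDl.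
by rewrite -[_ *m met S x *m _]mulmxA mulmxV ?(met_unit rg) // mulmx1 => /eqP; rewrite addr_eq0 => /eqP.
Qed.

Lemma cov_invmet v : cov (- (G x v)^T) (G x v) v (fun y => invmx (met S y)) x = 0.
Proof.
rewrite /cov derive_invmet.
have /eqP := cov_met oU rg Ux v; rewrite /cov mulmxN subr_eq0 subr_eq => /eqP ->.
have u := met_unit rg Ux.
rewrite mulmxDr mulmxDl !mulmxA mulVmx // mul1mx -[_ *m met S x *m _]mulmxA mulmxV // mulmx1.
rewrite mulNmx; move: ((G x v)^T *m _) (invmx _ *m G x v) => A B.
by apply/matrixP => i j; rewrite !mxE; ring.
Qed.

(** The derivative of the inverse metric produces a trace that is symmetric in j and k by cyclicity,
    and second derivatives of the metric commute. *)
Lemma logdet_closed j k :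
  'D_(crd j) (fun y => \tr (invmx (met S y) *m 'D_(crd k) (met S) y)) x =
  'D_(crd k) (fun y => \tr (invmx (met S y) *m 'D_(crd j) (met S) y)) x.
Proof.
have di := smooth_differentiable oU invmet_smooth Ux.
have dD l := smooth_differentiable oU (smooth_derive l sg) Ux.
have E i l : 'D_(crd i) (fun y => \tr (invmx (met S y) *m 'D_(crd l) (met S) y)) x =
   \tr (- (invmx (met S x) *m 'D_(crd i) (met S) x *m invmx (met S x)) *m 'D_(crd l) (met S) x)
   + \tr (invmx (met S x) *m 'D_(crd i) ('D_(crd l) (met S)) x).
  have /is_derive_mxP D := is_derive_mulmx (derivableP (diff_derivable (v := crd i) di))
                              (derivableP (diff_derivable (v := crd i) (dD l))).
  have [_ ->] := is_derive_big (index_enum _) (fun a => D a a).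
  by rewrite derive_invmet -mxtraceD.
have D2 := Schwarz_mx oU (crd j) (crd k) sg Ux.
have e1 := E j k; have e2 := E k j; rewrite D2 in e1; clear D2 E.
apply: (eq_trans e1); apply/esym; apply: (eq_trans e2); clear e1 e2 dD.
move: (\tr (_ *m 'D_(crd k) _ x)) ('D_(crd j) (met S) x) ('D_(crd k) (met S) x) => t a b.
by rewrite !mulNmx !raddfN /= -(mulmxA _ _ a) mxtrace_mulC !mulmxA.
Qed.

End At.

(** The codifferential of Omega in coordinates, through the bivector g^-1 phi. The last sum
    contracts a skew bivector with symmetric symbols, so it vanishes later. *)
Lemma xnp_trace_coord y (l : 'I_d) : U y ->
  (\sum_i \sum_j invmx (met S y) i j *: xnp S y (crd i) (crd j)) 0 l =
  \sum_i 'D_(crd i) (fun y => (invmx (met S y) *m phi S y) i l) y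
  + \sum_k (2^-1 * \tr (invmx (met S y) *m 'D_(crd k) (met S) y))
            * (invmx (met S y) *m phi S y) k l
  + \sum_i \sum_k (invmx (met S y) *m phi S y) i k * christoffel (met S) y i k l.
Proof.
move=> Uy; pose F y := invmx (met S y) *m phi S y.
have di := smooth_differentiable oU invmet_smooth Uy.
have dp := phi_differentiable oU aS Uy.
have dF : differentiable F y by exact: differentiable_mulmx.
have N i : (\sum_j invmx (met S y) i j *: xnp S y (crd i) (crd j)) 0 l =
   'D_(crd i) (fun y => F y i l) y + \sum_k G y (crd i) k i * F y k l
   + \sum_k F y i k * G y (crd i) k l.
  have -> : \sum_j invmx (met S y) i j *: xnp S y (crd i) (crd j) =
    row i (cov (- (G y (crd i))^T) (G y (crd i)) (crd i) F y).
    rewrite /F (cov_mulmx _ (G y (crd i))) // (cov_invmet Uy) mul0mx add0r row_mul.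
    rewrite [row i _]row_sum_delta mulmx_suml; apply: eq_bigr => j _.
    by rewrite -scalemxAl mxE.
  rewrite [LHS]mxE /cov mulNmx opprK.
  rewrite [LHS]mxE [X in X + _]mxE (derive_mx (diff_derivable dF)) [X in X + _ + _]mxE.
  congr (_ + _ + _); rewrite mxE //; apply: eq_bigr => k _; by rewrite [X in X * _]mxE.
rewrite summxE (eq_bigr _ (fun i _ => N i)) !big_split /=; congr (_ + _ + _).
  rewrite exchange_big; apply: eq_bigr => k _.
  by rewrite -mulr_suml gmx_trace.
by apply: eq_bigr => i _; apply: eq_bigr => k _; rewrite gmx_coord.
Qed.

(* c xi is the codifferential of the fundamental 2-form, and delta^2 = 0. *)
Lemma coexact_reeb (c : R) x : U x ->
  (forall y, U y -> \sum_i \sum_j invmx (met S y) i j *: xnp S y (crd i) (crd j) = c *: xi S y) ->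
  c * \sum_i (xnz S x (crd i)) 0 i = 0.
Proof.
move=> Ux H.
pose F y := invmx (met S y) *m phi S y.
have sF : smooth_on U F by exact: (smooth_mulmx oU invmet_smooth (phi_smooth aS)).
have skF y : U y -> F y = - (F y)^T.
  move=> Uy; have u := met_unit rg Uy; have := phi_met aS Uy.
  move/(congr1 (fun M => invmx (met S y) *m M *m invmx (met S y))).
  rewrite mulmxN mulNmx !mulmxA -[_ *m met S y *m _]mulmxA mulmxV // mulmx1 /F => {1}->.
  by rewrite !trmx_mul trmx_inv (met_sym rg Uy) !mulmxA mulVmx // mul1mx.
pose a k y := 2^-1 * \tr (invmx (met S y) *m 'D_(crd k) (met S) y).
have sT k : smooth_on U (fun y => \tr (invmx (met S y) *m 'D_(crd k) (met S) y)).
  have sM := smooth_mulmx oU invmet_smooth (smooth_derive k sg).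
  have /(smooth_mxP oU) sMe := sM.
  exact: (smooth_sum oU (index_enum _) (P := xpredT) (fun i _ => sMe i i)).
have dT k := smooth_fun_differentiable oU (sT k) Ux.
have da k : differentiable (a k) x.
  by apply: differentiableM => //; exact: differentiable_cst.
have Da j k : 'D_(crd j) (a k) x = 2^-1 *
    'D_(crd j) (fun y => \tr (invmx (met S y) *m 'D_(crd k) (met S) y)) x.
  exact: (deriveZ _ (diff_derivable (dT k))).
have HX l y : U y -> c * xi S y 0 l =
    \sum_i 'D_(crd i) (fun y => F y i l) y + \sum_k a k y * F y k l.
  move=> Uy; have := congr1 (fun w : 'rV[R]_d => w 0 l) (H y Uy).
  rewrite [X in _ = X]mxE (xnp_trace_coord l Uy) => <-.
  rewrite [X in _ + X]skew_sum0 ?addr0 // => i k.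
  have := congr1 (fun M : 'M[R]_d => M i k) (skF y Uy); rewrite !mxE /F => E.
  by rewrite E (christoffel_sym oU rg Uy) mulNr.
have sFe i j : smooth_on U (fun y => F y i j) by move/(smooth_mxP oU) : sF; exact.
have K : \sum_j 'D_(crd j) (fun y => c * xi S y 0 j) x + \sum_k a k x * (c * xi S x 0 k) = 0.
  apply: (divergence_skew oU Ux sFe _ da _ HX).
    by move=> i j y Uy; have := congr1 (fun M : 'M[R]_d => M i j) (skF y Uy); rewrite !mxE.
  move=> j k; apply: (etrans (Da j k)); apply: (etrans _ (esym (Da k j))).
  exact: (congr1 (fun t => 2^-1 * t) (logdet_closed Ux j k)).
have dxi := xi_differentiable oU aS Ux.
have Dxi j : 'D_(crd j) (fun y => c * xi S y 0 j) x = c * 'D_(crd j) (xi S) x 0 j.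
  rewrite (derive_mx (diff_derivable dxi)) [X in _ = c * X]mxE.
  exact: (deriveZ _ (diff_derivable (differentiable_mx_entry 0 j dxi))).
rewrite -[RHS]K; rewrite (eq_bigr _ (fun j _ => Dxi j)) -mulr_sumr.
have -> : \sum_k a k x * (c * xi S x 0 k) = c * \sum_k a k x * xi S x 0 k.
  by rewrite mulr_sumr; apply: eq_bigr => k _; rewrite mulrCA.
rewrite -mulrDr; congr (_ * _).
have E i : xnz S x (crd i) 0 i = 'D_(crd i) (xi S) x 0 i + \sum_k xi S x 0 k * G x (crd i) k i.
  by rewrite /xnz /cov mul0mx subr0 [LHS]mxE; congr (_ + _); rewrite mxE.
rewrite (eq_bigr _ (fun i _ => E i)) big_split /=; congr (_ + _).
rewrite exchange_big; apply: eq_bigr => k _.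
by rewrite -mulr_sumr gmx_trace // mulrC.
Qed.

End CoexactReeb.

(** * The second fundamental form of a map *)

Lemma cov_scale_cst {R : realType} {d p q} (L : 'M[R]_p) (M : 'M[R]_q) w (c : R)
    (A : 'rV[R]_d -> 'M[R]_(p, q)) x :
  differentiable A x -> cov L M w (fun y => c *: A y) x = c *: cov L M w A x.
Proof.
move=> dA; have e1 := cov_scalemx L M w (differentiable_cst c x) dA.
apply: (etrans e1); rewrite -[RHS]add0r; congr (_ + _).
by rewrite (derive_cst c) scale0r.
Qed.

Section MapJets.
Context {R : realType} {d e : nat}.
Variables (S : lacm R d) (U : set 'rV[R]_d).
Hypotheses (oU : open U) (aS : acm_on S U).
Let rg : riemannian_on (met S) U. Proof. by case: aS. Qed.
Variables (h : 'rV[R]_e -> 'M[R]_e) (V : set 'rV[R]_e).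
Hypotheses (oV : open V) (rh : riemannian_on h V).
Variables (D : set 'rV[R]_d) (F : 'rV[R]_d -> 'rV[R]_e).
Hypotheses (oD : open D) (DU : D `<=` U) (FV : forall y, D y -> V (F y)) (sF : smooth_on D F).

(** The second fundamental form as the covariant derivative of the Jacobian: the source connection
    acts on rows, the target connection pulled back by F on columns. *)
Definition jetB x (w v : 'rV[R]_d) : 'rV[R]_e :=
  v *m cov (gmx (met S) x w) (gmx h (F x) ('D_w F x)) w (jacobian F) x.

Lemma map_differentiable x : D x -> differentiable F x.
Proof. exact: (smooth_differentiable oD sF). Qed.

Lemma jacobian_differentiable x : D x -> differentiable (jacobian F) x.
Proof. exact: (smooth_differentiable oD (smooth_jacobian oD sF)). Qed.

Lemma deriveJ x v : D x -> 'D_v F x = v *m jacobian F x.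
Proof. by move=> Dx; rewrite deriveEjacobian //; exact: map_differentiable. Qed.

Section At.
Variable x : 'rV[R]_d.
Hypothesis Dx : D x.
Let Ux : U x := DU Dx.
Let Vx : V (F x) := FV Dx.
Let dF := map_differentiable Dx.
Let dJ := jacobian_differentiable Dx.
Local Notation G := (gmx (met S) x).
Local Notation Gh w := (gmx h (F x) ('D_w F x)).

Lemma derive_jacobian w v : v *m 'D_w (jacobian F) x = 'D_w ('D_v F) x.
Proof.
have E : forall y, D y -> v *m jacobian F y = 'D_v F y by move=> y Dy; rewrite deriveJ.
rewrite -(near_eq_derive w (open_near_eq oD E Dx)).
have [_ ->] := is_derive_mulmx (is_derive_cst v x w) (derivableP (diff_derivable (v := w) dJ)).
by rewrite mul0mx add0r.
Qed.

Lemma jetBE w v : jetB x w v = 'D_w ('D_v F) x + 'D_v F x *m Gh w - (v *m G w) *m jacobian F x.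
Proof.
rewrite /jetB /cov mulmxDr mulmxBr derive_jacobian !mulmxA -!deriveJ //.
by rewrite addrAC.
Qed.

(** Second derivatives of F commute and both connections are torsion free. *)
Lemma jetB_sym w v : jetB x w v = jetB x v w.
Proof.
rewrite !jetBE (Schwarz_mx oD w v sF Dx); have e1 := gmx_sym oV rh Vx ('D_v F x) ('D_w F x).
by rewrite e1 (gmx_sym oU rg Ux v w).
Qed.

Lemma jetB_linear w : linear (jetB x w).
Proof. by move=> a u v; rewrite /jetB mulmxDl scalemxAl. Qed.

Lemma second_fundE v w : second_fund (met S) h F (fun=> v) (fun=> w) x = jetB x v w.
Proof.
rewrite [LHS](_ : _ = ('D_v ('D_w F) x + gamma h (F x) ('D_v F x) ('D_w F x))
   - 'D_(nabla (met S) (fun=> v) (fun=> w) x) F x) //.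
rewrite jetBE gammaE nablaE /cov derive_cst mul0mx subr0 add0r.
by rewrite (deriveJ (w *m _)).
Qed.

Lemma tensionE : tension (met S) h F x =
  \sum_i \sum_j invmx (met S x) i j *: jetB x (crd i) (crd j).
Proof.
by rewrite /tension; apply: eq_bigr => i _; apply: eq_bigr => j _; rewrite second_fundE.
Qed.

Lemma pushforward_linear : linear (fun v => 'D_v F x).
Proof. exact: derive_linear. Qed.

Lemma comp_differentiable {p q} (A : 'rV[R]_e -> 'M[R]_(p, q)) :
  smooth_on V A -> differentiable (A \o F) x.
Proof.
by move=> sA; apply: differentiable_comp => //; exact: (smooth_differentiable oV sA Vx).
Qed.

Lemma cov_pullback {p q} (L : 'M[R]_p) (M : 'M[R]_q) w (A : 'rV[R]_e -> 'M[R]_(p, q)) :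
  smooth_on V A -> cov L M w (A \o F) x = cov L M ('D_w F x) A (F x).
Proof.
by move=> sA; rewrite cov_comp //; exact: (smooth_differentiable oV sA Vx).
Qed.

(** The pulled back metric has matrix J h J^T and nabla h = 0, so only the two Jacobians are
    differentiated. *)
Lemma dpullE w v u :
  (v *m cov (G w) (- (G w)^T) w
     (fun y => jacobian F y *m (h (F y) *m (jacobian F y)^T)) x *m u^T) 0 0 =
  dpull (fun v => 'D_v F x) (jetB x) (ip h (F x)) w v u.
Proof.
have sh := met_smooth rh.
have dh : differentiable (fun y => h (F y)) x by exact: comp_differentiable sh.
have dJT := differentiable_trmx dJ.
have dhJ := differentiable_mulmx dh dJT.
rewrite (cov_mulmx _ (Gh w)) // (cov_mulmx _ (- (Gh w)^T)) //.
rewrite (cov_pullback _ _ _ sh) (cov_met oV rh Vx) mul0mx add0r cov_trmx //.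
rewrite mulmxDr mulmxDl [LHS]mxE /dpull /jetB !deriveJ // /ip !trmx_mul.
by rewrite !mulmxA.
Qed.

Section Holomorphic.
Variables (q : 'rV[R]_e -> 'M[R]_e) (s : R).
Hypotheses (sq : smooth_on V q) (ss : s * s = 1).
Hypothesis hol : forall y, D y -> forall v,
  'D_(v *m phi S y) F y = s *: ('D_v F y *m q (F y)).

(** [hj_Bp] is the covariant derivative of holomorphy in matrix form, phi J = s J q. *)
Lemma map_jet : holomorphic_jet (xphi S x) (xnp S x) (fun v => v *m q (F x)) (jetn h q (F x))
  (fun v => 'D_v F x) (jetB x) s.
Proof.
split; [exact: pushforward_linear|exact: jetB_linear|exact: jetB_sym|exact: ss|exact: (hol Dx)|].
move=> w v.
have E : forall y, D y -> phi S y *m jacobian F y = s *: (jacobian F y *m q (F y)).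
  move=> y Dy; apply: rV_mulmx_inj => u; rewrite mulmxA -deriveJ // hol //.
  by rewrite -scalemxAr mulmxA -deriveJ.
have dphi := phi_differentiable oU aS Ux.
have dq : differentiable (fun y => q (F y)) x by exact: comp_differentiable sq.
have dJq := differentiable_mulmx dJ dq.
have := cov_near (G w) (Gh w) w oD Dx E.
rewrite (cov_mulmx _ (G w)) // cov_scale_cst // (cov_mulmx _ (Gh w) _ _ dJ dq).
rewrite (cov_pullback _ _ _ sq) => E1.
rewrite /jetB /jetn /xphi (deriveJ (xnp S x w v)) // (deriveJ v) // /xnp.
move: (cov (G w) (G w) w (phi S) x) (cov (G w) (Gh w) w (jacobian F) x)
  (cov (Gh w) (Gh w) _ q _) E1 => X Y Z E1.
by have := congr1 (mulmx v) E1; rewrite mulmxDr -scalemxAr mulmxDr !mulmxA addrC => ->.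
Qed.

End Holomorphic.
End At.
End MapJets.

(** * Holomorphic maps of almost semi-Sasakian manifolds *)

Section SemiSasakianFrames.
Context {R : realType} {m : nat}.
Local Notation d := (m.*2.+1).
Variables (S : lacm R d) (D : set 'rV[R]_d).
Hypotheses (oD : open D) (aS : acm_on S D) (m0 : (0 < m)%N).
Hypothesis semi : forall (V : set 'rV[R]_d) (e : 'I_m -> _), V `<=` D -> phi_frame S V e ->
  forall X, smooth_on V X -> forall x, V x -> codiff_Om S e X x = m.*2%:R * etaf S X x.

Record semi_frame x (e : 'I_m -> 'rV[R]_d) : Prop := SemiFrame {
  sf_ee : forall k l, ip (met S) x (e k) (e l) = (k == l)%:R;
  sf_epe : forall k l, ip (met S) x (e k) (xphi S x (e l)) = 0;
  sf_ez : forall k, ip (met S) x (e k) (xi S x) = 0;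
  sf_semi : \sum_k Pquad (xphi S x) (xnp S x) (e k) - xphi S x (xnz S x (xi S x)) =
            m.*2%:R *: xi S x }.

(** Testing delta Omega = 2m eta on constant fields determines the whole vector. *)
Lemma semi_frame_of V e x : V `<=` D -> phi_frame S V e -> V x ->
  semi_frame x (fun k => e k x).
Proof.
move=> VD fr Vx; have [oV se frV] := fr; have [H1 H2 H3 H4 H5] := frV x Vx.
have Dx := VD x Vx; have cp := xcp oD aS Dx; have ig := cp_inner cp.
split=> // [k|]; first by have [] := H4 k.
apply/eqP; rewrite -subr_eq0; apply/eqP; apply: (inner_nondeg ig) => w.
have de k : differentiable (e k) x := smooth_differentiable oV (se k) Vx.
have E := semi VD fr (smooth_cst oV w) Vx.
rewrite (codiff_OmE oD aS Dx (fun=> w) de) (etafE aS Dx) in E.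
by rewrite (innerDl ig) E (innerNl ig) (innerZl ig) (inner_sym ig w) subrr.
Qed.

Lemma semi_frame_exists x : D x -> exists e, semi_frame x e.
Proof.
move=> Dx; have [V [e [VD Vx fr]]] := phi_frame_exists oD aS (ltnSn m.*2) Dx.
by exists (fun k => e k x); exact: semi_frame_of fr Vx.
Qed.

Lemma m2_neq0 : m.*2%:R != 0 :> R.
Proof. by rewrite pnatr_eq0 double_eq0 -lt0n. Qed.

Lemma semi_div0 x e : D x -> semi_frame x e ->
  \sum_k xi_trace (ip (met S) x) (xphi S x) (xnz S x) (e k) = 0.
Proof.
move=> Dx [H1 H2 H3 H4].
have [cp dxi] := (xcp oD aS Dx, xnz_linear oD aS Dx).
rewrite -(frame_trace_xi oD aS Dx e id) -(frame_trace_div oD aS Dx H1 H2 H3 dxi).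
have tr y : D y -> \sum_i \sum_j invmx (met S y) i j *: xnp S y (crd i) (crd j) =
    m.*2%:R *: xi S y.
  move=> Dy; have [e' [K1 K2 K3 K4]] := semi_frame_exists Dy; have cpy := xcp oD aS Dy.
  rewrite (frame_trace_inv oD aS Dy K1 K2 K3 (cp_npr cpy) (cp_npl cpy)).
  by rewrite (frame_trace_np oD aS Dy).
by have /eqP := coexact_reeb oD aS Dx tr; rewrite mulf_eq0 (negPf m2_neq0) => /eqP.
Qed.

(** The xi component of delta Omega = 2m eta. It shows that d eta vanishes nowhere on D^M, as
    [dlam0] needs. *)
Lemma semi_deta x e : D x -> semi_frame x e ->
  \sum_k two_deta (ip (met S) x) (xnz S x) (e k) (xphi S x (e k)) = - m.*2%:R.
Proof.
move=> Dx [H1 H2 H3 H4]; have cp := xcp oD aS Dx; have ig := cp_inner cp.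
have := congr1 (fun w => ip (met S) x w (xi S x)) H4.
rewrite /= (innerDl ig) (innerNl ig) (cp_gpz cp) subr0 (innerZl ig) (cp_zz cp) mulr1 => <-.
rewrite (inner_suml ig) -sumrN; apply: eq_bigr => k _.
by rewrite (Pquad_xi cp (H3 k)) opprK.
Qed.

End SemiSasakianFrames.

Lemma tension_frame_trace {R : realType} {m e : nat} (S : lacm R m.*2.+1) D
    (h : 'rV[R]_e -> 'M[R]_e) V (F : 'rV[R]_(m.*2.+1) -> 'rV[R]_e) x e' :
  open D -> acm_on S D -> open V -> riemannian_on h V -> (forall y, D y -> V (F y)) ->
  smooth_on D F -> D x -> semi_frame S x e' ->
  tension (met S) h F x = frame_trace (xphi S x) (xi S x) e' (jetB S h F x).
Proof.
move=> oD aS oV rh FV sF Dx [H1 H2 H3 _]; rewrite (tensionE S h oD sF Dx).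
apply: (frame_trace_inv oD aS Dx H1 H2 H3); first exact: jetB_linear.
move=> v a u w; rewrite !(jetB_sym oD aS oV rh oD (fun _ Dy => Dy) FV sF Dx _ v).
exact: jetB_linear.
Qed.

(** Parity excludes dimension 2, where the energy is conformally invariant and the stress-energy
    identities say nothing about lambda. *)
Lemma double_neq1 {R : numDomainType} k : k.*2%:R != 1 :> R.
Proof. by rewrite (eqr_nat _ _ 1); apply/negP => /eqP E; have := odd_double k; rewrite E. Qed.

Section ContactMaps.
Context {R : realType} {m e : nat}.
Local Notation d := (m.*2.+1).
Variables (S : lacm R d) (D : set 'rV[R]_d) (T : lacm R e) (V : set 'rV[R]_e)
  (F : 'rV[R]_d -> 'rV[R]_e) (s : R).

(* A holomorphic map of an almost semi-Sasakian manifold, read in charts. *)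
Record contact_map : Prop := ContactMap {
  cm_dim : (0 < m)%N;
  cm_open : open D;
  cm_acm : acm_on S D;
  cm_semi : forall (V : set 'rV[R]_d) (e : 'I_m -> _), V `<=` D -> phi_frame S V e ->
    forall X, smooth_on V X -> forall x, V x -> codiff_Om S e X x = m.*2%:R * etaf S X x;
  cm_openT : open V;
  cm_acmT : acm_on T V;
  cm_range : forall y, D y -> V (F y);
  cm_smooth : smooth_on D F;
  cm_sign : s * s = 1;
  cm_holo : forall y, D y -> forall v,
    'D_(v *m phi S y) F y = s *: ('D_v F y *m phi T (F y)) }.

Hypothesis cm : contact_map.
Let m0 := cm_dim cm.
Let oD := cm_open cm.
Let aS := cm_acm cm.
Let semi := cm_semi cm.
Let oV := cm_openT cm.
Let aT := cm_acmT cm.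
Let FV := cm_range cm.
Let sF := cm_smooth cm.
Let ss := cm_sign cm.
Let hol := cm_holo cm.
Let rg : riemannian_on (met S) D. Proof. by case: aS. Qed.
Let rh : riemannian_on (met T) V. Proof. by case: aT. Qed.
Let DD : D `<=` D := fun _ h => h.

Local Notation B := (jetB S (met T) F).
Local Notation ten := (tension (met S) (met T) F).

(** Lambda in charts, by a formula: it is smooth by construction and available to the assertions
    that do not name a function [lam]. *)
Definition lam_rep y := ip (met T) (F y) ('D_(xi S y) F y) (xi T (F y)).

Lemma jet_at x : D x -> holomorphic_jet (xphi S x) (xnp S x) (xphi T (F x)) (xnp T (F x))
  (fun v => 'D_v F x) (B x) s.
Proof. move=> Dx; exact: (map_jet oD aS oV rh oD DD FV sF Dx (phi_smooth aT) ss hol). Qed.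

Lemma target_cp x : D x -> contact_point (ip (met T) (F x)) (xphi T (F x)) (xi T (F x))
  (xnp T (F x)) (xnz T (F x)).
Proof. by move=> Dx; exact: (xcp oV aT (FV Dx)). Qed.

(** As phi xi = 0, holomorphy makes f_* xi a vector killed by the target endomorphism, hence a
    multiple of its Reeb vector. *)
Lemma push_xi x : D x -> 'D_(xi S x) F x = lam_rep x *: xi T (F x).
Proof.
move=> Dx; have cp' := target_cp Dx; have hj := jet_at Dx.
have qA : xphi T (F x) ('D_(xi S x) F x) = 0.
  have := hol Dx (xi S x); rewrite (xi_phi aS Dx) derive0 => /esym/eqP.
  by rewrite scaler_eq0 (negPf (s_neq0 hj)) => /eqP.
by rewrite {1}(cp_decomp cp' ('D_(xi S x) F x)) qA (lin0 (cp_p cp')) oppr0 add0r.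
Qed.

Lemma lam_rep_unique x (l : R) : D x -> 'D_(xi S x) F x = l *: xi T (F x) -> l = lam_rep x.
Proof.
move=> Dx E; have cp' := target_cp Dx.
by rewrite /lam_rep E (innerZl (cp_inner cp')) (cp_zz cp') mulr1.
Qed.

Lemma lam_rep_smooth : smooth_on D lam_rep.
Proof.
have sh := smooth_comp oD oV FV (met_smooth rh) sF.
have sx := smooth_comp oD oV FV (xi_smooth aT) sF.
have sA := smooth_mulmx oD (xi_smooth aS) (smooth_jacobian oD sF).
have := smooth_mulmx oD (smooth_mulmx oD sA sh) (smooth_trmx oD sx).
move=> /(smooth_mxP oD)/(_ 0 0); apply: (smooth_eq oD) => y Dy.
by rewrite /lam_rep /ip (deriveJ oD sF).
Qed.

Lemma lam_rep_differentiable x : D x -> differentiable lam_rep x.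
Proof. by move=> Dx; exact: (smooth_fun_differentiable oD lam_rep_smooth Dx). Qed.

(** The covariant derivative of f^* sigma = lambda eta, written as an equality of column vectors. *)
Lemma dlam_rep x w v : D x ->
  ip (met T) (F x) (B x w v) (xi T (F x)) +
  ip (met T) (F x) ('D_v F x) (xnz T (F x) ('D_w F x)) =
  'D_w lam_rep x * ip (met S) x v (xi S x) + lam_rep x * ip (met S) x v (xnz S x w).
Proof.
move=> Dx.
have E : forall y, D y -> jacobian F y *m (met T (F y) *m (xi T (F y))^T) =
    lam_rep y *: (met S y *m (xi S y)^T).
  move=> y Dy; apply: rV_mulmx_inj => u; apply/matrixP => i j; rewrite !ord1.
  have := hAz (xcp oD aS Dy) (jet_at Dy) (target_cp Dy) (push_xi Dy) u.
  rewrite /ip (deriveJ oD sF _ Dy) => H.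
  by rewrite -scalemxAr [RHS]mxE !mulmxA; exact: H.
have dJ := jacobian_differentiable oD sF Dx.
have dl := lam_rep_differentiable Dx.
have dh : differentiable (fun y => met T (F y)) x.
  exact: (comp_differentiable oV oD FV sF Dx (met_smooth rh)).
have dx : differentiable (fun y => xi T (F y)) x.
  exact: (comp_differentiable oV oD FV sF Dx (xi_smooth aT)).
have dxT := differentiable_trmx dx.
have dhx := differentiable_mulmx dh dxT.
have dg := met_differentiable oD rg Dx.
have dxi := xi_differentiable oD aS Dx.
have dgx := differentiable_mulmx dg (differentiable_trmx dxi).
have Vx := FV Dx.
have := cov_near (gmx (met S) x w) 0 w oD Dx E.
set Gh := gmx (met T) (F x) ('D_w F x).
have c1 := cov_mulmx (gmx (met S) x w) Gh 0 w dJ dhx.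
have c2 := cov_mulmx Gh (- Gh^T) 0 w dh dxT.
have c3 := cov_pullback oV oD FV sF Dx Gh (- Gh^T) w (met_smooth rh).
have c4 := cov_trmx 0 Gh w dx; rewrite trmx0 oppr0 in c4.
have c5 := cov_pullback oV oD FV sF Dx 0 Gh w (xi_smooth aT).
rewrite /= in c3 c5.
have c3' : cov Gh (- Gh^T) w (fun y => met T (F y)) x = 0.
  by rewrite [LHS]c3; exact: (cov_met oV rh Vx).
have c5' : cov 0 Gh w (fun y => xi T (F y)) x = xnz T (F x) ('D_w F x) by exact: c5.
rewrite c1 c2 c3' c4 c5' mul0mx add0r.
have c6 := cov_scalemx (gmx (met S) x w) 0 w dl dgx.
have c7 : cov (gmx (met S) x w) 0 w (fun y => met S y *m (xi S y)^T) x =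
  met S x *m (xnz S x w)^T := cov_met_tr oD rg Dx w dxi.
rewrite c7 in c6 => H0; have H := etrans H0 c6; clear H0.
rewrite /jetB -/Gh (deriveJ oD sF v Dx).
move: (cov _ Gh w (jacobian F) x) (xnz T _ _) (xnz S x w) H => X Y Z H.
have := congr1 (fun M => (v *m M) 0 0) H; rewrite /= !mulmxDr -!scalemxAr /ip !mulmxA.
by rewrite [X in X = _]mxE [X in _ = X]mxE [X in _ = X + _ ]mxE [X in _ = _ + X]mxE.
Qed.

Lemma tension_trace x e' : D x -> semi_frame S x e' ->
  ten x = frame_trace (xphi S x) (xi S x) e' (B x).
Proof. by move=> Dx; exact: (tension_frame_trace oD aS oV rh FV sF Dx). Qed.

Lemma map_tension_contact_like x : D x ->
  contact_like (ip (met T) (F x)) (xphi T (F x)) (xi T (F x)) (xnp T (F x)) (xnz T (F x)) ->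
  ten x = 'D_(xi S x) lam_rep x *: xi T (F x).
Proof.
move=> Dx cl; have [e' fr] := semi_frame_exists oD aS semi Dx; have [H1 H2 H3 H4] := fr.
have c' := target_cp Dx; rewrite (tension_trace Dx fr).
exact: (tension_contact_like (xcp oD aS Dx) (cp_p c') (cp_npl c') (cp_npr c') (jet_at Dx) H3 c'
  (push_xi Dx) (fun w v => dlam_rep w v Dx) H4 (semi_div0 oD aS m0 semi Dx fr) cl).
Qed.

Local Notation lam := lam_rep.

Let cp x (Dx : D x) := xcp oD aS Dx.
Let cp' x (Dx : D x) := target_cp Dx.
Let hj x (Dx : D x) := jet_at Dx.
Let Az x (Dx : D x) := push_xi Dx.
Let dlam x (Dx : D x) w v := dlam_rep w v Dx.
Let frame x (Dx : D x) := semi_frame_exists oD aS semi Dx.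
Let div0 x (Dx : D x) e (fr : semi_frame S x e) := semi_div0 oD aS m0 semi Dx fr.
Let ten_trace x (Dx : D x) e (fr : semi_frame S x e) := tension_trace Dx fr.
Let slam := lam_rep_smooth.
Let dflam x (Dx : D x) := smooth_fun_differentiable oD slam Dx.

Lemma derive_eq0_near (u : 'rV[R]_d -> R) x w : (forall y, D y -> u y = 0) -> D x -> 'D_w u x = 0.
Proof.
move=> u0 Dx; have E := near_eq_derive w (open_near_eq oD (g := cst 0) u0 Dx).
by rewrite E derive_cst.
Qed.

Lemma lam_eq0_of_Pquad x : D x ->
  (forall E, ip (met T) (F x) E (xi T (F x)) = 0 ->
     ip (met T) (F x) (Pquad (xphi T (F x)) (xnp T (F x)) E) (xi T (F x)) = 0) -> lam x = 0.
Proof.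
move=> Dx H; have [e' fr] := frame Dx; have [H1 H2 H3 H4] := fr; have c' := cp' Dx.
exact: (lam_eq0 (cp Dx) (cp_p c') (cp_npl c') (cp_npr c') (hj Dx) H3 c' (Az Dx)
  (m2_neq0 m0) H4 H).
Qed.

Lemma tension_cosymplectic_map :
  (forall y, D y -> forall E, ip (met T) (F y) E (xi T (F y)) = 0 ->
     Pquad (xphi T (F y)) (xnp T (F y)) E = 0 /\
     xi_trace (ip (met T) (F y)) (xphi T (F y)) (xnz T (F y)) E = 0) ->
  forall x, D x -> ten x = 0.
Proof.
move=> H x Dx; have [e' fr] := frame Dx; have [H1 H2 H3 H4] := fr; have c' := cp' Dx.
(* Lambda must vanish on all of D, not only at x, for its derivative along xi to vanish at x. *)
have l0 y : D y -> lam y = 0.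
  move=> Dy; apply: lam_eq0_of_Pquad => // E Ez.
  by rewrite (H y Dy E Ez).1 (inner0l (cp_inner (cp' Dy))).
rewrite (ten_trace Dx fr).
exact: (tension_cosymplectic (cp Dx) (cp_p c') (cp_npl c') (cp_npr c') (hj Dx) H3 c' (Az Dx)
  (fun w v => dlam Dx w v) (m2_neq0 m0) H4 (div0 Dx fr) (H x Dx) (derive_eq0_near _ l0 Dx)).
Qed.

Lemma derive_frame0 x e' : D x -> semi_frame S x e' ->
  (forall k, 'D_(e' k) F x = 0) -> forall v, ip (met S) x v (xi S x) = 0 -> 'D_v F x = 0.
Proof.
move=> Dx [H1 H2 H3 H4] Ae v vz; have hx := hj Dx; have lA := hj_A hx.
have -> : v = \sum_k (ip (met S) x v (e' k) *: e' k +
    ip (met S) x v (xphi S x (e' k)) *: xphi S x (e' k)).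
  by rewrite {1}(frame_complete oD aS Dx H1 H2 H3 v) vz scale0r addr0.
rewrite (lin_sum lA) big1 // => k _; rewrite (linD lA) !(linZ lA) Ae scaler0 add0r.
by rewrite (hj_Ap hx) Ae (lin0 (cp_p (cp' Dx))) !scaler0.
Qed.

Lemma derive0_of_lam x e' : D x -> semi_frame S x e' ->
  (forall k, 'D_(e' k) F x = 0) -> lam x = 0 -> forall v, 'D_v F x = 0.
Proof.
move=> Dx fr Ae l0 v; have lA := hj_A (hj Dx).
pose g := ip (met S) x; have ig := cp_inner (cp Dx).
rewrite -[v](subrK (g v (xi S x) *: xi S x)) (linD lA) (linZ lA) (Az Dx) l0 scale0r scaler0 addr0.
apply: (derive_frame0 Dx fr Ae).
by rewrite (innerDl ig) (innerNl ig) (innerZl ig) (cp_zz (cp Dx)) mulr1 subrr.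
Qed.

(** Closedness of the target 1-form removes the Reeb component of P, hence lambda = 0. The Reeb
    component of the tension field is then - 2 b times the energy over D^M, with b nonzero. *)
Lemma kenmotsu_map_constant :
  (forall y, D y -> (forall v w, two_deta (ip (met T) (F y)) (xnz T (F y)) v w = 0) /\
     exists2 b : R, b != 0 & forall E, ip (met T) (F y) E (xi T (F y)) = 0 ->
       xi_trace (ip (met T) (F y)) (xphi T (F y)) (xnz T (F y)) E =
       2 * b * ip (met T) (F y) E E) ->
  (forall y, D y -> ten y = 0) -> forall x v, D x -> 'D_v F x = 0.
Proof.
move=> H ten0 x v Dx; have [e' fr] := frame Dx; have [H1 H2 H3 H4] := fr; have c' := cp' Dx.
have l0 y : D y -> lam y = 0.
  move=> Dy; apply: lam_eq0_of_Pquad => // E Ez; have [H' _] := H y Dy.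
  by rewrite (Pquad_xi (cp' Dy) Ez) H' oppr0.
have [_ [b b0 Hb]] := H x Dx.
have := tension_xi_kenmotsu (cp Dx) (hj Dx) H3 c' (Az Dx) (fun w v => dlam Dx w v) (div0 Dx fr) Hb.
rewrite -(ten_trace Dx fr) ten0 // (inner0l (cp_inner c')) (derive_eq0_near _ l0 Dx) sub0r.
move=> /esym/eqP; rewrite oppr_eq0 !mulf_eq0 (negPf b0) pnatr_eq0 /= => /eqP E0.
have AE := energy_eq0 (cp_p c') (hj Dx) c' E0.
by apply: (derive0_of_lam Dx fr _ (l0 x Dx)) => k; have [] := AE k.
Qed.

Section TransSasakianTarget.
Variables (a b : 'rV[R]_e -> R).
Hypothesis trans : forall y, D y -> xnz T (F y) (xi T (F y)) = 0 /\
  forall E, ip (met T) (F y) E (xi T (F y)) = 0 ->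
    Pquad (xphi T (F y)) (xnp T (F y)) E = (2 * a (F y) * ip (met T) (F y) E E) *: xi T (F y) /\
    xi_trace (ip (met T) (F y)) (xphi T (F y)) (xnz T (F y)) E =
    2 * b (F y) * ip (met T) (F y) E E.

Local Notation en x e' := (energy (fun v => 'D_v F x) e' (ip (met T) (F x))).

Lemma tension_trans_map x e' : D x -> semi_frame S x e' ->
  m.*2%:R * lam x = s * (2 * a (F x) * en x e') /\
  ten x = ('D_(xi S x) lam x - 2 * b (F x) * en x e') *: xi T (F x).
Proof.
move=> Dx fr; have [H1 H2 H3 H4] := fr; have c' := cp' Dx; have [K1 K2] := trans Dx.
rewrite (ten_trace Dx fr).
exact: (tension_trans (cp Dx) (cp_p c') (cp_npl c') (cp_npr c') (hj Dx) H3 c' (Az Dx)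
  (fun w v => dlam Dx w v) H4 (div0 Dx fr) K1 K2).
Qed.

Lemma tension_trans_eq0 x e' : D x -> semi_frame S x e' ->
  ten x = 0 <-> 'D_(xi S x) lam x = 2 * b (F x) * en x e'.
Proof.
move=> Dx fr; have [_ ->] := tension_trans_map Dx fr; split; last by move=> ->; rewrite subrr scale0r.
move=> /(congr1 (ip (met T) (F x) ^~ (xi T (F x)))); have c' := cp' Dx.
by rewrite (innerZl (cp_inner c')) (cp_zz c') mulr1 (inner0l (cp_inner c')) => /eqP; rewrite subr_eq0 => /eqP.
Qed.
End TransSasakianTarget.

(* Both Reeb fields are geodesic as soon as M and N are normal: then
   d lam = d lam (xi) eta, and the symmetry of the Hessian of lam gives
   d lam (xi) d eta = 0 on D^M, while d eta has nonzero trace there. *)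
Section GeodesicReebFields.
Hypothesis geoM : forall y, D y -> xnz S y (xi S y) = 0.
Hypothesis geoN : forall y, D y -> xnz T (F y) (xi T (F y)) = 0.

(** Compare [dlam_rep] at (w, xi) and at (xi, w): B is symmetric, and the terms in the derivatives
    of the Reeb fields vanish, by unit length or because these fields are geodesic. *)
Lemma dlam_eta x w : D x -> 'D_w lam x = 'D_(xi S x) lam x * ip (met S) x w (xi S x).
Proof.
move=> Dx; have c := cp Dx; have c' := cp' Dx; have ig := cp_inner c; have ih := cp_inner c'.
have z1 : xnz T (F x) ('D_(xi S x) F x) = 0.
  by have := congr1 (xnz T (F x)) (Az Dx); rewrite (linZ (cp_nz c')) (geoN Dx) scaler0.
have z2 : ip (met T) (F x) ('D_(xi S x) F x) (xnz T (F x) ('D_w F x)) = 0.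
  have := congr1 (fun u => ip (met T) (F x) u (xnz T (F x) ('D_w F x))) (Az Dx).
  by rewrite /= (innerZl ih) (inner_sym ih (xi T _)) (cp_nzz c') mulr0.
have z3 : ip (met S) x w (xnz S x (xi S x)) = 0 by rewrite (geoM Dx) (inner0r ig).
have z4 : ip (met S) x (xi S x) (xnz S x w) = 0 by rewrite (inner_sym ig) (cp_nzz c).
have := dlam Dx w (xi S x); have := dlam Dx (xi S x) w; rewrite z1 z2 z3 z4.
by rewrite (cp_zz c) (inner0r ih) (hj_Bsym (hj Dx) w) !mulr0 mulr1 !addr0 => -> ->.
Qed.

Lemma dlam0 x w : D x -> 'D_w lam x = 0.
Proof.
move=> Dx; suff L0 : 'D_(xi S x) lam x = 0 by rewrite dlam_eta // L0 mul0r.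
pose L y := 'D_(xi S y) lam y.
have sL : smooth_on D L.
  have /(smooth_mxP oD) sx := xi_smooth aS.
  have := smooth_sum oD (index_enum 'I_d) (P := xpredT)
    (fun i _ => smoothM oD (sx 0 i) (smooth_derive i slam)).
  by apply: (smooth_eq oD) => y Dy; rewrite /L (derive_coord _ (dflam Dy)).
have dL := smooth_fun_differentiable oD sL Dx.
have H u v : 'D_u ('D_v lam) x = 'D_u L x * ip (met S) x v (xi S x) +
    L x * ((v *m gmx (met S) x u *m met S x *m (xi S x)^T) 0 0 + (v *m met S x *m (xnz S x u)^T) 0 0).
  have E y : D y -> 'D_v lam y = (fun y => L y * etaf S (fun=> v) y) y.
    by move=> Dy; rewrite dlam_eta // (etafE aS Dy).
  have E1 := near_eq_derive u (open_near_eq oD E Dx).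
  have dv : differentiable (fun=> v : 'rV[R]_d) x by exact: differentiable_cst.
  have se : smooth_on D (etaf S (fun=> v)).
    have se0 : smooth_on D (Defs.eta S) by case: aS.
    by have /(smooth_mxP oD) H := smooth_mulmx oD (smooth_cst oD v) se0; exact: (H 0 0).
  have de := smooth_fun_differentiable oD se Dx.
  have [_ E2] := is_deriveM (derivableP (diff_derivable (v := u) dL))
                       (derivableP (diff_derivable (v := u) de)).
  rewrite [LHS]E1 [LHS]E2 (dird_etaf oD aS Dx u dv) (etafE aS Dx) derive_cst add0r.
  by rewrite /GRing.scale /= addrC [in LHS](mulrC (ip _ _ _ _)).
have [e' fr] := frame Dx; have [H1 H2 H3 H4] := fr; have c := cp Dx; have ig := cp_inner c.
(* The antisymmetrised Hessian of lambda at e_k and phi e_k: both are orthogonal to xi, so the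
   derivatives of L drop out and L times d eta is left. *)
have K k : L x * two_deta (ip (met S) x) (xnz S x) (e' k) (xphi S x (e' k)) = 0.
  have K := etrans (esym (H _ _)) (etrans (Schwarz oD (e' k) (xphi S x (e' k)) slam Dx) (H _ _)).
  move: (H3 k) (cp_gpz c (e' k)) K; rewrite /two_deta (gmx_sym oD rg Dx (xphi S x (e' k))).
  rewrite (inner_sym ig (xnz S x (e' k))) (inner_sym ig (xnz S x (xphi S x (e' k)))) => -> ->.
  rewrite /ip; move: ('D_(e' k) L x) ('D_(xphi S x (e' k)) L x) (L x) => a1 a2 a3.
  move: ((e' k *m gmx _ _ _ *m _ *m _) 0 0) ((xphi S x (e' k) *m _ *m _) 0 0) => a4 a5.
  move: ((e' k *m met S x *m _) 0 0) => a6.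
  by rewrite !mulr0 !add0r !mulrDr => /addrI ->; rewrite mulrN subrr.
have := congr1 (fun t => L x * t) (semi_deta oD aS Dx fr).
rewrite /= mulr_sumr big1 // mulrN => /esym/eqP.
by rewrite oppr_eq0 mulf_eq0 (negPf (m2_neq0 m0)) orbF => /eqP.
Qed.
End GeodesicReebFields.

Lemma derive_sqr_lam x w : D x -> 'D_w (fun y => lam y ^+ 2) x = 2 * lam x * 'D_w lam x.
Proof.
move=> Dx; have dl := diff_derivable (v := w) (dflam Dx).
have [_ E] := is_deriveX 2 (derivableP dl).
by rewrite [LHS]E expr1 /GRing.scale /=; ring.
Qed.

Lemma norm_push_xi x : D x ->
  ip (met T) (F x) ('D_(xi S x) F x) ('D_(xi S x) F x) = lam x ^+ 2.
Proof.
move=> Dx; have c' := cp' Dx; have ih := cp_inner c'.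
by rewrite (Az Dx) (innerZl ih) (innerZr ih) (cp_zz c') mulr1.
Qed.

Section ConformalMaps.
Hypothesis conf : forall y, D y -> forall v w, ip (met T) (F y) ('D_v F y) ('D_w F y) =
  lam y ^+ 2 * ip (met S) y v w.

(** Here dm = d(lambda^2) = 2 lambda d lambda, so the coefficient 1 - (2m + 1)/2 becomes 1 - 2m. *)
Lemma conformal_map_tension x u : D x -> ip (met T) (F x) (ten x) ('D_u F x) =
  (1 - m.*2.+1%:R) * (lam x * 'D_u lam x) + lam x * 'D_u lam x.
Proof.
move=> Dx; have [e' fr] := frame Dx; have [H1 H2 H3 H4] := fr; have c := cp Dx.
have sl2 := smoothM oD slam slam; have dl2 := smooth_fun_differentiable oD sl2 Dx.
have E : forall y, D y -> jacobian F y *m (met T (F y) *m (jacobian F y)^T) =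
    (lam y * lam y) *: met S y.
  move=> y Dy; apply: bilinear_mx_inj => v w; have := conf Dy v w.
  rewrite /ip !(deriveJ oD sF _ Dy) trmx_mul !mulmxA expr2 => ->.
  by rewrite -scalemxAr -scalemxAl [RHS]mxE.
pose dm v := 'D_v (fun y => lam y * lam y) x.
have dmE v : dm v = 2 * (lam x * 'D_v lam x).
  by rewrite mulrA -(derive_sqr_lam v Dx) /dm; congr ('D_v _ x); apply/funext => y; rewrite expr2.
have Hd w v v' : dpull (fun v => 'D_v F x) (B x) (ip (met T) (F x)) w v v' = dm w * ip (met S) x v v'.
  rewrite -(dpullE S oV rh oD FV sF Dx).
  have e1 := cov_near (gmx (met S) x w) (- (gmx (met S) x w)^T) w oD Dx E.
  have e2 := cov_scalemx (gmx (met S) x w) (- (gmx (met S) x w)^T) w dl2 (met_differentiable oD rg Dx).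
  rewrite (cov_met oD rg Dx) scaler0 addr0 in e2.
  by rewrite e1 e2 -scalemxAr -scalemxAl mxE.
have ldm : forall a v w, dm (a *: v + w) = a * dm v + dm w.
  by move=> a v w; rewrite /dm (derive_linear dl2).
rewrite (ten_trace Dx fr).
rewrite (conformal_tension c (hj Dx) H3 (cp_inner (cp' Dx)) (frame_complete oD aS Dx H1 H2 H3) _ ldm u Hd).
  by rewrite dmE; field.
by move=> k; rewrite H1 eqxx.
Qed.

Let m2_neq1 : m.*2%:R - 1 != 0 :> R.
Proof. by rewrite subr_eq0 double_neq1. Qed.

(** For this tension field, h(tau, f_* u) = lambda d lambda(xi) eta(u). Compared with (1 - 2m)
    lambda d lambda(u), the case u = xi gives 2m lambda d lambda(xi) = 0, and then all u follow. *)
Lemma conformal_contact_like x : D x -> ten x = 'D_(xi S x) lam x *: xi T (F x) ->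
  forall u, lam x * 'D_u lam x = 0.
Proof.
move=> Dx tE; have c := cp Dx; have c' := cp' Dx; have ih := cp_inner c'.
have H u : lam x * 'D_(xi S x) lam x * ip (met S) x u (xi S x) = (1 - m.*2%:R) * (lam x * 'D_u lam x).
  have := conformal_map_tension u Dx; rewrite tE (innerZl ih) (inner_sym ih).
  rewrite (hAz c (hj Dx) c' (Az Dx) u) -natr1; move: (lam x) ('D_u lam x) ('D_(xi S x) lam x) => l l1 l2.
  by move: (ip _ _ _ _) m.*2%:R => a b; lra.
have z0 : lam x * 'D_(xi S x) lam x = 0.
  have := H (xi S x); rewrite (cp_zz c) => K.
  by apply/eqP; have /eqP : m.*2%:R * (lam x * 'D_(xi S x) lam x) = 0; [lra|rewrite mulf_eq0 (negPf (m2_neq0 m0))].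
move=> u; have := H u; rewrite z0 mul0r => /esym/eqP.
by rewrite mulf_eq0 -opprB oppr_eq0 (negPf m2_neq1) => /eqP.
Qed.

Lemma conformal_harmonic x : D x -> ten x = 0 -> forall u, lam x * 'D_u lam x = 0.
Proof.
move=> Dx t0 u; have := conformal_map_tension u Dx.
rewrite t0 (inner0l (cp_inner (cp' Dx))) => /esym E; apply/eqP.
have /eqP : (m.*2%:R - 1) * (lam x * 'D_u lam x) = 0 by rewrite -natr1 in E; lra.
by rewrite mulf_eq0 (negPf m2_neq1).
Qed.

Lemma conformal_derive0 x : D x -> lam x = 0 -> forall v, 'D_v F x = 0.
Proof.
move=> Dx l0 v; apply/eqP; rewrite -(inner_eq0 (cp_inner (cp' Dx))) conf //.
by rewrite l0 expr0n mul0r.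
Qed.

Lemma conformal_energy x e' : D x -> semi_frame S x e' ->
  energy (fun v => 'D_v F x) e' (ip (met T) (F x)) = m%:R * lam x ^+ 2.
Proof.
move=> Dx [H1 H2 H3 H4]; rewrite /energy (eq_bigr (fun=> lam x ^+ 2)).
  by rewrite sumr_const card_ord mulr_natl.
by move=> k _; rewrite conf // H1 eqxx mulr1.
Qed.
End ConformalMaps.
End ContactMaps.

(** * Horizontally weakly conformal maps *)

Section HorizontallyConformalAlgebra.
Context {R : realFieldType} {p q : nat}.
Variables (g : 'M[R]_p) (h : 'M[R]_q) (J : 'M[R]_(p, q)) (mu2 : R).
Local Notation gf v w := ((v *m g *m w^T) 0 0).
Local Notation hf v w := ((v *m h *m w^T) 0 0).
Hypotheses (ig : inner_product (fun v w : 'rV[R]_p => gf v w)) (ih : inner_product (fun v w : 'rV[R]_q => hf v w)).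
Hypothesis ug : g \in unitmx.
Hypothesis conf : forall v w : 'rV[R]_p,
  (forall u : 'rV[R]_p, u *m J = 0 -> gf v u = 0) ->
  (forall u : 'rV[R]_p, u *m J = 0 -> gf w u = 0) ->
  hf (v *m J) (w *m J) = mu2 * gf v w.
Hypothesis onto : mu2 != 0 -> forall z : 'rV[R]_q, exists v : 'rV[R]_p, v *m J = z.

Definition adjoint_mx : 'M[R]_(q, p) := h *m J^T *m invmx g.

Lemma adjointP (w : 'rV[R]_q) (v : 'rV[R]_p) : gf (w *m adjoint_mx) v = hf w (v *m J).
Proof. by rewrite /adjoint_mx !mulmxA mulmxKV // trmx_mul !mulmxA. Qed.

Let horiz (w : 'rV[R]_q) (u : 'rV[R]_p) : u *m J = 0 -> gf (w *m adjoint_mx) u = 0.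
Proof. by move=> uJ; rewrite adjointP uJ trmx0 mulmx0 mxE. Qed.

Let PP (w w' : 'rV[R]_q) : hf (w *m adjoint_mx *m J) (w' *m adjoint_mx *m J) = mu2 * hf w (w' *m adjoint_mx *m J).
Proof. by rewrite conf ?adjointP // => u; exact: horiz. Qed.

Let psym (w w' : 'rV[R]_q) : hf (w *m adjoint_mx *m J) w' = hf w (w' *m adjoint_mx *m J).
Proof. by rewrite (inner_sym ih) -adjointP (inner_sym ig) adjointP. Qed.

(** The adjoint has horizontal values, so P = [adjoint_mx *m J] satisfies P P = mu2 P. Then w P -
    mu2 w is killed by P, hence by the adjoint, hence orthogonal to the image of J, which is
    everything when mu2 is nonzero. *)
Lemma adjoint_conformal : adjoint_mx *m J = mu2%:M.
Proof.
apply: rV_mulmx_inj => w; rewrite mulmxA mul_mx_scalar.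
have [m0|m0] := eqVneq mu2 0.
  have := PP w w; rewrite m0 mul0r scale0r => /eqP; rewrite (inner_eq0 ih) => /eqP //.
pose u := w *m adjoint_mx *m J - mu2 *: w; apply/eqP; rewrite -subr_eq0 -/u; apply/eqP.
have uP : u *m adjoint_mx *m J = 0.
  apply: (inner_nondeg ih) => w'; rewrite psym /u (innerDl ih) (innerNl ih) (innerZl ih) PP.
  by rewrite subrr.
have uA : u *m adjoint_mx = 0.
  apply/eqP; rewrite -(inner_eq0 ig) adjointP uP (inner0r ih) //.
apply: (inner_nondeg ih) => z; have [v <-] := onto m0 z.
by rewrite -adjointP uA (inner0l ig).
Qed.

Lemma conformal_null : mu2 = 0 -> J = 0.
Proof.
move=> m0; apply: rV_mulmx_inj => v; rewrite mulmx0; apply: (inner_nondeg ih) => w.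
rewrite (inner_sym ih) -adjointP; suff -> : w *m adjoint_mx = 0 by rewrite (inner0l ig).
have wP : w *m adjoint_mx *m J = 0.
  by rewrite -mulmxA adjoint_conformal m0 mul_mx_scalar scale0r.
by apply/eqP; rewrite -(inner_eq0 ig) adjointP wP (inner0r ih).
Qed.

End HorizontallyConformalAlgebra.

(** * Smooth orthonormal frames of the kernel of a submersion *)

Section KernelFrames.
Context {R : realType} {d e : nat}.
Variables (g : 'rV[R]_d -> 'M[R]_d) (U : set 'rV[R]_d).
Hypotheses (oU : open U) (rg : riemannian_on g U).
Variables (J : 'rV[R]_d -> 'M[R]_(d, e)) (Pi : 'rV[R]_d -> 'M[R]_d).
Hypotheses (sPi : smooth_on U Pi) (PiJ : forall y, U y -> Pi y *m J y = 0)
  (PiK : forall y, U y -> forall v : 'rV[R]_d, v *m J y = 0 -> v *m Pi y = v)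
  (onto : forall y, U y -> row_full (J y)).

Definition kernel_frame (r : nat) (V : set 'rV[R]_d) (E : 'I_r -> 'rV[R]_d -> 'rV[R]_d) :=
  [/\ open V, V `<=` U, forall a, smooth_on V (E a) & forall y, V y ->
    (forall a b, ip g y (E a y) (E b y) = (a == b)%:R) /\ forall a, E a y *m J y = 0].

(** As in [phi_frame_step], but the new field must stay in the kernel: the constant field is first
    sent there by the projection [Pi]. *)
Lemma kernel_frame_step (k : nat) V (E : 'I_k -> 'rV[R]_d -> 'rV[R]_d) x :
  (e + k < d)%N -> V x -> kernel_frame V E ->
  exists V' (E' : 'I_k.+1 -> 'rV[R]_d -> 'rV[R]_d), V' x /\ kernel_frame V' E'.
Proof.
move=> kd Vx [oV VU sE fr]; have Ux := VU x Vx.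
have sg := smooth_sub VU (met_smooth rg); have sP := smooth_sub VU sPi.
have /rowV0Pn[v0 v0N v0n] : kermx (row_mx (J x) (g x *m (rows_mx (E^~ x))^T)) != 0.
  by rewrite -mxrank_eq0 mxrank_ker subn_eq0 -ltnNge (leq_ltn_trans (rank_leq_col _)).
have /eqP : v0 *m row_mx (J x) (g x *m (rows_mx (E^~ x))^T) = 0 by apply/sub_kermxP.
rewrite mul_mx_row row_mx_eq0 => /andP[/eqP v0J /eqP v0E].
have orth0 l : ip g x v0 (E l x) = 0.
  have := congr1 (fun M : 'rV[R]_k => M 0 l) v0E.
  rewrite mulmxA mxE [X in _ = X -> _]mxE => E0; rewrite /ip mxE -[RHS]E0.
  by apply: eq_bigr => j _; rewrite !mxE.
pose w y := v0 *m Pi y.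
have sw : smooth_on V w := smooth_mulmx oV (smooth_cst oV v0) sP.
pose v y := w y + \sum_l (- ip g y (w y) (E l y)) *: E l y.
have sv : smooth_on V v.
  apply: (smoothD oV sw); apply: (smooth_sum oV) => l _; apply: (smooth_scalemx oV) (sE l).
  apply: (smooth_eq oV (f := fun y => (- 1) * ip g y (w y) (E l y))).
    by move=> y _; rewrite mulN1r.
  by apply: (smoothM oV (smooth_cst oV _)); exact: (smooth_ip oV sg sw (sE l)).
have vx : v x = v0.
  rewrite /v /w (PiK Ux v0J) big1 ?addr0 // => l _; by rewrite orth0 oppr0 scale0r.
have vJ y : V y -> v y *m J y = 0.
  move=> Vy; rewrite /v mulmxDl /w -mulmxA (PiJ (VU y Vy)) mulmx0 add0r mulmx_suml big1 // => l _.
  by rewrite -scalemxAl (fr y Vy).2 scaler0.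
have vE y l : V y -> ip g y (v y) (E l y) = 0.
  move=> Vy; have ig := met_inner rg (VU y Vy).
  rewrite /v (innerDl ig) (inner_suml ig) (bigD1 l) //= big1; last first.
    by move=> j jl; rewrite (innerZl ig) (fr y Vy).1 (negPf jl) mulr0.
  by rewrite (innerZl ig) (fr y Vy).1 eqxx mulr1 addr0 subrr.
have pos : 0 < ip g x (v x) (v x) by rewrite vx (inner_pos (met_inner rg Ux)).
have [V' [u [c [oV' V'x V'V su Hu]]]] := smooth_normalize oV sg sv Vx pos.
pose E' (i : 'I_k.+1) := if unlift ord_max i is Some j then E j else u.
have E'l (j : 'I_k) : E' (lift ord_max j) = E j by rewrite /E' liftK.
have E'm : E' ord_max = u by rewrite /E' unlift_none.
exists V', E'; split; [exact: V'x|split; [exact: oV'|exact: subset_trans VU| |]].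
  move=> i; rewrite /E'; case: (unlift _ i) => [j|]; last exact: su.
  exact: smooth_sub V'V (sE j).
move=> y V'y; have Vy := V'V y V'y; have ig := met_inner rg (VU y Vy).
have [uE uu] := Hu y V'y; have [H1 H2] := fr y Vy.
have U1 l : ip g y (u y) (E l y) = 0 by rewrite uE (innerZl ig) vE // mulr0.
have lm (j : 'I_k) : (lift ord_max j == ord_max) = false by rewrite eq_sym (negbTE (neq_lift _ _)).
have ml (j : 'I_k) : (ord_max == lift ord_max j) = false by rewrite (negbTE (neq_lift _ _)).
split=> [a b|a].
  case: (unliftP ord_max a) => [i ->|->]; case: (unliftP ord_max b) => [j ->|->].
  - by rewrite !E'l H1 (inj_eq lift_inj).
  - by rewrite E'l E'm lm (inner_sym ig).
  - by rewrite E'l E'm ml.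
  - by rewrite E'm eqxx.
case: (unliftP ord_max a) => [i ->|->]; first by rewrite E'l.
by rewrite E'm uE -scalemxAl vJ // scaler0.
Qed.

Lemma kernel_frame_exists x : U x -> exists V (E : 'I_(d - e) -> 'rV[R]_d -> 'rV[R]_d),
  [/\ V x, kernel_frame V E & forall y, V y -> forall v, v *m J y = 0 ->
    exists c : 'I_(d - e) -> R, v = \sum_a c a *: E a y].
Proof.
move=> Ux.
have ed : (e <= d)%N by have /eqP <- := onto Ux; exact: rank_leq_row.
have [V [E [Vx fr]]] : exists V (E : 'I_(d - e) -> 'rV[R]_d -> 'rV[R]_d), V x /\ kernel_frame V E.
  have := leqnn (d - e); elim: {-2}(d - e)%N => [_|k IH kd].
    by exists U, (fun _ _ => 0); do 2![split=> //]; [case|split; case].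
  have [V [E [Vx fr]]] := IH (ltnW kd).
  have kd' : (e + k < d)%N by rewrite -ltn_subRL.
  exact: (kernel_frame_step kd' Vx fr).
exists V, E; split=> // y Vy v vJ; have [oV VU sE /(_ y Vy)[H1 H2]] := fr.
have free : row_free (rows_mx (E^~ y)).
  apply/row_freeP; exists (g y *m (rows_mx (E^~ y))^T).
  by rewrite mulmxA mulmx_tr_ip; apply/matrixP => a b; rewrite !mxE H1.
have sub : (rows_mx (E^~ y) <= kermx (J y))%MS.
  by apply/row_subP => a; apply/sub_kermxP; rewrite rows_mxK.
have /eqmxP eq : (rows_mx (E^~ y) == kermx (J y))%MS.
  rewrite -(mxrank_leqif_eq sub).2 (eqP free) mxrank_ker; have /eqP -> := onto (VU y Vy).
  by rewrite eqxx.
have /submxP[c ->] : (v <= rows_mx (E^~ y))%MS by rewrite eq; apply/sub_kermxP.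
by exists (c 0); rewrite mulmx_sum_row; apply: eq_bigr => a _; rewrite rows_mxK.
Qed.

End KernelFrames.

Section HorizontallyConformalMaps.
Context {R : realType} {m n : nat}.
Local Notation d := (m.*2.+1).
Local Notation e := (n.*2.+1).
Variables (S : lacm R d) (D : set 'rV[R]_d) (T : lacm R e) (V : set 'rV[R]_e)
  (F : 'rV[R]_d -> 'rV[R]_e) (s : R).
Hypothesis cm : contact_map S D T V F s.
Let oD := cm_open cm.
Let aS := cm_acm cm.
Let semi := cm_semi cm.
Let oV := cm_openT cm.
Let aT := cm_acmT cm.
Let FV := cm_range cm.
Let sF := cm_smooth cm.
Let rg : riemannian_on (met S) D. Proof. by case: aS. Qed.
Let rh : riemannian_on (met T) V. Proof. by case: aT. Qed.

Local Notation lam := (lam_rep S T F).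
Local Notation B := (jetB S (met T) F).
Local Notation ten := (tension (met S) (met T) F).

Let cp x (Dx : D x) := xcp oD aS Dx.
Let cp' x (Dx : D x) := target_cp cm Dx.
Let hj x (Dx : D x) := jet_at cm Dx.
Let Az x (Dx : D x) := push_xi cm Dx.
Let frame x (Dx : D x) := semi_frame_exists oD aS semi Dx.
Let ten_trace x (Dx : D x) e (fr : semi_frame S x e) := tension_trace cm Dx fr.
Let slam := lam_rep_smooth cm.

Definition horiz_at x v := forall w, 'D_w F x = 0 -> ip (met S) x v w = 0.

Hypothesis hwc : forall y, D y -> exists mu : R, [/\ 0 <= mu,
  forall v w, horiz_at y v -> horiz_at y w -> ip (met T) (F y) ('D_v F y) ('D_w F y) =
    mu ^+ 2 * ip (met S) y v w &
  0 < mu -> forall z, exists2 v, horiz_at y v & 'D_v F y = z].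

(** Since h(f_* w, gamma) = lambda eta(w), the kernel of f_* is orthogonal to xi where lambda is
    nonzero. *)
Lemma xi_horizontal x : D x -> lam x != 0 -> horiz_at x (xi S x).
Proof.
move=> Dx l0 w Aw; have c' := cp' Dx; have := hAz (cp Dx) (hj Dx) c' (Az Dx) w.
rewrite Aw (inner0l (cp_inner c')) (inner_sym (cp_inner (cp Dx)) (xi S x)) => /esym/eqP.
by rewrite mulf_eq0 (negPf l0) => /eqP.
Qed.

(** Where lambda is nonzero, xi is horizontal and gives mu^2 = lambda^2. Where lambda = 0, a
    positive mu would put gamma in the image of f_*, although h(f_* v, gamma) = lambda eta(v). *)
Lemma hwc_lam x : D x ->
  (forall v w, horiz_at x v -> horiz_at x w -> ip (met T) (F x) ('D_v F x) ('D_w F x) =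
     lam x ^+ 2 * ip (met S) x v w) /\
  (lam x ^+ 2 != 0 -> forall z, exists2 v, horiz_at x v & 'D_v F x = z).
Proof.
move=> Dx; have [mu [mu0 H1 H2]] := hwc Dx; have c := cp Dx; have c' := cp' Dx.
have -> : lam x ^+ 2 = mu ^+ 2.
  have [l0|l0] := eqVneq (lam x) 0; last first.
    have hz := xi_horizontal Dx l0; have := H1 _ _ hz hz.
    by rewrite (norm_push_xi cm Dx) (cp_zz c) mulr1.
  have [->|mun] := eqVneq mu 0; first by rewrite l0 expr0n.
  have mup : 0 < mu by rewrite lt0r mun.
  have [v _ vz] := H2 mup (xi T (F x)); have := hAz c (hj Dx) c' (Az Dx) v.
  by rewrite vz (cp_zz c') l0 mul0r => /eqP; rewrite oner_eq0.
split=> // mun; apply: H2; rewrite lt0r mu0 andbT.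
by apply: contra_neq mun => ->; rewrite expr0n.
Qed.

Let J := jacobian F.
Let As x := adjoint_mx (met S x) (met T (F x)) (J x).

Let conf x (Dx : D x) (v w : 'rV[R]_d) :
  (forall u : 'rV[R]_d, u *m J x = 0 -> (v *m met S x *m u^T) 0 0 = 0) ->
  (forall u : 'rV[R]_d, u *m J x = 0 -> (w *m met S x *m u^T) 0 0 = 0) ->
  (v *m J x *m met T (F x) *m (w *m J x)^T) 0 0 = lam x ^+ 2 * (v *m met S x *m w^T) 0 0.
Proof.
move=> hv hw; have [H _] := hwc_lam Dx.
rewrite -!(deriveJ oD sF _ Dx); apply: H => u; rewrite (deriveJ oD sF _ Dx) => uJ.
  exact: hv.
exact: hw.
Qed.

Let onto x (Dx : D x) : lam x ^+ 2 != 0 -> forall z : 'rV[R]_e, exists v : 'rV[R]_d, v *m J x = z.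
Proof.
move=> l0 z; have [_ /(_ l0 z)[v _ vz]] := hwc_lam Dx; exists v.
by rewrite -(deriveJ oD sF _ Dx).
Qed.

Let outer_mx (v w : 'rV[R]_d) (a b : 'cV[R]_d) :
  (v *m (a *m b^T) *m w^T) 0 0 = (v *m a) 0 0 * (w *m b) 0 0.
Proof.
have -> : v *m (a *m b^T) *m w^T = (v *m a) *m (w *m b)^T by rewrite trmx_mul !mulmxA.
by rewrite mxE big_ord1 [X in _ * X]mxE.
Qed.

Let AsJ x (Dx : D x) : As x *m J x = (lam x ^+ 2)%:M.
Proof.
exact: (adjoint_conformal (cp_inner (cp Dx)) (cp_inner (cp' Dx)) (met_unit rg Dx) (conf Dx) (onto Dx)).
Qed.

Lemma hwc_derive0 x : D x -> lam x = 0 -> forall v, 'D_v F x = 0.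
Proof.
move=> Dx l0 v; rewrite (deriveJ oD sF _ Dx).
suff -> : jacobian F x = 0 by rewrite mulmx0.
apply: (conformal_null (cp_inner (cp Dx)) (cp_inner (cp' Dx)) (met_unit rg Dx) (conf Dx) (onto Dx)).
by rewrite l0 expr0n.
Qed.

(** The trace of J times its adjoint is, cyclically, that of lambda^2 on the target, (2n + 1)
    lambda^2. In the frame, xi accounts for lambda^2 and each pair e_k, phi e_k for 2 h(E_k,
    E_k). *)
Lemma hwc_energy x e' : D x -> semi_frame S x e' ->
  energy (fun v => 'D_v F x) e' (ip (met T) (F x)) = n%:R * lam x ^+ 2.
Proof.
move=> Dx fr; have [H1 H2 H3 H4] := fr; have c := cp Dx; have c' := cp' Dx; have ih := cp_inner c'.
pose f (v : 'rV[R]_d) := v *m (J x *m As x).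
have lf : linear f by move=> a u v; rewrite /f mulmxDl scalemxAl.
have fE v w : ip (met S) x (f v) w = ip (met T) (F x) ('D_v F x) ('D_w F x).
  rewrite (deriveJ oD sF v Dx) (deriveJ oD sF w Dx) /f mulmxA.
  exact: (adjointP _ _ (met_unit rg Dx)).
have := frame_trace_div oD aS Dx H1 H2 H3 lf.
have -> : \sum_i (f (crd i)) 0 i = \tr (J x *m As x).
  by apply: eq_bigr => i _; rewrite /f -rowE mxE.
rewrite mxtrace_mulC AsJ // mxtrace_scalar /frame_trace fE (norm_push_xi cm Dx).
rewrite (eq_bigr (fun k => 2 * ip (met T) (F x) ('D_(e' k) F x) ('D_(e' k) F x))); last first.
  move=> k _; rewrite !fE (hj_Ap (hj Dx)) (innerZl ih) (innerZr ih) mulrA (hj_sign (hj Dx)) mul1r.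
  have Aez : ip (met T) (F x) ('D_(e' k) F x) (xi T (F x)) = 0.
    by rewrite (hAz c (hj Dx) c' (Az Dx)) H3 mulr0.
  by rewrite (cp_gpp c') Aez mulr0 subr0 mulr2n mulrDl mul1r.
rewrite -mulr_sumr /energy mulrS addrC => /addIr.
move: (lam x ^+ 2) (\sum_(k < m) _) => l E; rewrite -[_ *+ n.*2]mulr_natl -muln2 natrM => H.
by apply: (mulfI (x := 2)); [rewrite pnatr_eq0|rewrite -H; ring].
Qed.

Section MinimalFibres.
Hypothesis nm : (n <= m)%N.
Hypothesis minf : forall (V : set 'rV[R]_d) (r : nat) (E : 'I_r -> 'rV[R]_d -> 'rV[R]_d),
    open V -> V `<=` D -> (forall x, V x -> forall z, exists v, 'D_v F x = z) ->
    (forall a, smooth_on V (E a)) ->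
    (forall x, V x -> [/\ forall a b, ip (met S) x (E a x) (E b x) = (a == b)%:R,
           forall a, 'D_(E a x) F x = 0 & forall v, 'D_v F x = 0 ->
             exists c : 'I_r -> R, v = \sum_(a < r) c a *: E a x]) ->
    forall x, V x -> forall w, horiz_at x w ->
      ip (met S) x (\sum_(a < r) nabla (met S) (E a) (E a) x) w = 0.

Lemma hwc_kernel_frame x : D x -> lam x != 0 ->
  exists V' (E : 'I_(d - e) -> 'rV[R]_d -> 'rV[R]_d),
   [/\ V' x, forall y, V' y -> lam y != 0, kernel_frame (met S) D J V' E &
       forall y, V' y -> forall v, 'D_v F y = 0 ->
         exists c : 'I_(d - e) -> R, v = \sum_a c a *: E a y].
Proof.
move=> Dx lx.
pose V0 := D `&` [set y | 0 < lam y ^+ 2].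
have sl2 : smooth_on D (fun y => lam y ^+ 2).
  by apply: (smooth_eq oD _ (smoothM oD slam slam)) => y _; rewrite expr2.
have oV0 : open V0 := open_positive oD sl2.
have V0D : V0 `<=` D by move=> y [].
have l2 y : V0 y -> lam y ^+ 2 != 0 by move=> [_ /= h]; rewrite gt_eqF.
have rg0 : riemannian_on (met S) V0.
  by case: rg => sg H; split; [exact: smooth_sub V0D sg|move=> y /V0D; exact: H].
have sJ := smooth_sub V0D (smooth_jacobian oD sF).
have sg := met_smooth rg0.
have sh : smooth_on V0 (fun y => met T (F y)).
  exact: (smooth_sub V0D (smooth_comp oD oV FV (met_smooth rh) sF)).
have sAs : smooth_on V0 As.
  have uS : forall y, V0 y -> met S y \in unitmx by move=> y /V0D; exact: met_unit.
  exact: (smooth_mulmx oV0 (smooth_mulmx oV0 sh (smooth_trmx oV0 sJ)) (smooth_invmx oV0 uS sg)).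
pose c y := - (lam y ^+ 2)^-1.
(* The orthogonal projection on the kernel, because the adjoint followed by J is lambda^2. *)
pose Pi y := 1%:M + c y *: (J y *m As y).
have sc : smooth_on V0 c.
  apply: (smooth_eq oV0 (f := fun y => -1 * (lam y ^+ 2)^-1)); first by move=> y _; rewrite mulN1r.
  apply: (smoothM oV0 (smooth_cst oV0 _)); apply: (smoothV oV0 l2); exact: smooth_sub V0D sl2.
have sPi : smooth_on V0 Pi.
  exact: (smoothD oV0 (smooth_cst oV0 _) (smooth_scalemx oV0 sc (smooth_mulmx oV0 sJ sAs))).
have PiJ y : V0 y -> Pi y *m J y = 0.
  move=> Vy; rewrite /Pi mulmxDl mul1mx -scalemxAl -mulmxA (AsJ (V0D y Vy)) mul_mx_scalar scalerA.
  by rewrite mulNr mulVf ?l2 // scaleN1r subrr.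
have PiK y : V0 y -> forall v : 'rV[R]_d, v *m J y = 0 -> v *m Pi y = v.
  by move=> Vy v vJ; rewrite /Pi mulmxDr mulmx1 -scalemxAr mulmxA vJ mul0mx scaler0 addr0.
have full y : V0 y -> row_full (J y).
  move=> Vy; apply/row_fullP; exists ((lam y ^+ 2)^-1 *: As y).
  by rewrite -scalemxAl (AsJ (V0D y Vy)) scale_scalar_mx mulVf ?l2.
have V0x : V0 x by split=> //=; rewrite lt0r sqrf_eq0 lx sqr_ge0.
have [V' [E [V'x [oV' V'V0 sE fr] sp]]] := kernel_frame_exists oV0 rg0 sPi PiJ PiK full V0x.
exists V', E; split=> //.
- by move=> y /V'V0/l2; rewrite sqrf_eq0.
- by split=> //; exact: subset_trans V0D.
- move=> y V'y v; rewrite (deriveJ oD sF _ (V0D _ (V'V0 _ V'y))); exact: sp.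
Qed.

(** With an orthonormal frame E of the fibres, f^* h is lambda^2 times g minus the squares of the
    forms dual to the E_a. Its derivative enters [minimal_fibre_tension], which leaves (1 - 2n)
    lambda d lambda(xi) = 0. *)
Lemma minimal_fibres_lam x : D x -> lam x != 0 -> ten x = 0 -> 'D_(xi S x) lam x = 0.
Proof.
move=> Dx lx t0; have [V' [E [V'x lV' [oV' V'D sE fr] sp]]] := hwc_kernel_frame Dx lx.
have dJ y v : V' y -> 'D_v F y = v *m J y by move=> /V'D Dy; exact: (deriveJ oD sF).
have [e' fr'] := frame Dx; have [H1 H2 H3 H4] := fr'; have c := cp Dx; have c' := cp' Dx.
have ig := cp_inner c; have hz := xi_horizontal Dx lx.
have frE y : V' y -> [/\ forall a b, ip (met S) y (E a y) (E b y) = (a == b)%:R,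
     forall a, 'D_(E a y) F y = 0 & forall v, 'D_v F y = 0 ->
     exists c : 'I_(d - e) -> R, v = \sum_(a < d - e) c a *: E a y].
  by move=> Vy; have [K1 K2] := fr y Vy; split=> // [a|]; [rewrite dJ|exact: sp].
have conf' y v w : V' y -> ip (met T) (F y) ('D_v F y) ('D_w F y) = lam y ^+ 2 *
    (ip (met S) y v w - \sum_a ip (met S) y v (E a y) * ip (met S) y w (E a y)).
  move=> Vy; have Dy := V'D y Vy; have [K1 K2 K3] := frE y Vy; have igy := cp_inner (cp Dy).
  have lA := hj_A (hj Dy).
  (* The horizontal projection: it leaves f_* unchanged and brings any vector within reach of the
     conformality hypothesis. *)
  pose pr u := u - \sum_a ip (met S) y u (E a y) *: E a y.
  have Apr u : 'D_(pr u) F y = 'D_u F y.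
    rewrite /pr (linD lA) (linN lA) (lin_sum lA) big1 ?subr0 // => a _.
    by rewrite (linZ lA) K2 scaler0.
  have prE u a : ip (met S) y (pr u) (E a y) = 0.
    rewrite /pr (innerDl igy) (innerNl igy) (inner_suml igy) (bigD1 a) //= big1.
      by rewrite (innerZl igy) K1 eqxx mulr1 addr0 subrr.
    by move=> b ba; rewrite (innerZl igy) K1 (negPf ba) mulr0.
  have hpr u : horiz_at y (pr u).
    move=> t /K3[cc ->]; rewrite (inner_sumr igy) big1 // => a _.
    by rewrite (innerZr igy) prE mulr0.
  rewrite -(Apr v) -(Apr w) (hwc_lam Dy).1 //; congr (_ * _).
  rewrite {2}/pr (innerDr igy) (innerNr igy) (inner_sumr igy) [X in _ - X]big1 ?subr0; last first.
    by move=> a _; rewrite (innerZr igy) prE mulr0.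
  rewrite /pr (innerDl igy) (innerNl igy) (inner_suml igy); congr (_ - _); apply: eq_bigr => a _.
  by rewrite (innerZl igy) (inner_sym igy (E a y)).
have surj y : V' y -> forall z, exists v, 'D_v F y = z.
  move=> Vy z; have [|v _ vz] := (hwc_lam (V'D y Vy)).2 _ z; last by exists v.
  by rewrite sqrf_eq0 lV'.
have mE := minf oV' V'D surj sE frE V'x hz.
pose nE w a := cov 0 (gmx (met S) x w) w (E a) x.
have dE a : differentiable (E a) x := smooth_differentiable oV' (sE a) V'x.
have lnE a : linear (nE ^~ a).
  move=> cc u v; have X w : nE w a = 'D_w (E a) x + E a x *m gmx (met S) x w by rewrite /nE /cov mul0mx subr0.
  rewrite !X (derive_linear (dE a)) gmx_linear mulmxDr -scalemxAr scalerDr.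
  by move: ('D_u (E a) x) ('D_v (E a) x) => t1 t2; rewrite addrACA.
have gE a b w : ip (met S) x (nE w a) (E b x) + ip (met S) x (E a x) (nE w b) = 0.
  have EE y : V' y -> E a y *m (met S y *m (E b y)^T) = ((a == b)%:R)%:M.
    move=> Vy; have [K1 _ _] := frE y Vy; rewrite mulmxA [LHS]mx11_scalar; congr (_%:M).
    exact: K1.
  have := cov_near 0 0 w oV' V'x EE; rewrite (cov_cst 0 w _) mulmx0.
  have dET := differentiable_trmx (dE b).
  have dgE := differentiable_mulmx (met_differentiable oD rg Dx) dET.
  have e1 := cov_mulmx 0 (gmx (met S) x w) 0 w (dE a) dgE.
  have e2 : cov (gmx (met S) x w) 0 w (fun y => met S y *m (E b y)^T) x = met S x *m (nE w b)^T :=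
    cov_met_tr oD rg Dx w (dE b).
  rewrite e2 in e1 => /(etrans (esym e1))/(congr1 (fun M : 'M[R]_1 => M 0 0)).
  by rewrite /= [X in X = _]mxE [X in _ = X -> _]mxE /ip !mulmxA.
have nEE w a : ip (met S) x (nE w a) (E a x) = 0.
  by have := gE a a w; rewrite (inner_sym ig (E a x)); lra.
have Ez a : ip (met S) x (E a x) (xi S x) = 0.
  by rewrite (inner_sym ig) hz //; have [_ K2 _] := frE x V'x; exact: K2.
have EE1 a : ip (met S) x (E a x) (E a x) = 1.
  by have [K1 _ _] := frE x V'x; rewrite K1 eqxx.
have minE : \sum_a ip (met S) x (nE (E a x) a) (xi S x) = 0.
  rewrite -(inner_suml ig) -[RHS]mE; congr (ip _ _ _ _); apply: eq_bigr => a _.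
  by rewrite nablaE.
pose dm w := 'D_w (fun y => lam y * lam y) x.
have sl2 := smoothM oD slam slam; have dl2 := smooth_fun_differentiable oD sl2 Dx.
have ldm a v w : dm (a *: v + w) = a * dm v + dm w by rewrite /dm (derive_linear dl2).
pose Q a y := (met S y *m (E a y)^T) *m (met S y *m (E a y)^T)^T.
pose X y := met S y - \sum_a Q a y.
have XE y v w : (v *m X y *m w^T) 0 0 =
    ip (met S) y v w - \sum_a ip (met S) y v (E a y) * ip (met S) y w (E a y).
  rewrite /X mulmxBr mulmxBl mulmx_sumr mulmx_suml [LHS]mxE [X in _ + X]mxE summxE.
  congr (_ - _); apply: eq_bigr => a _.
  by rewrite outer_mx !mulmxA.
have EJ y : V' y -> J y *m (met T (F y) *m (J y)^T) = (lam y * lam y) *: X y.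
  move=> Vy; apply: bilinear_mx_inj => v w; have := conf' y v w Vy.
  rewrite -XE !dJ // /ip trmx_mul !mulmxA expr2 => ->.
  by rewrite -scalemxAr -scalemxAl [RHS]mxE.
have dg := met_differentiable oD rg Dx.
have dgE a := differentiable_mulmx dg (differentiable_trmx (dE a)).
have dgET a := differentiable_trmx (dgE a).
have dQ a : differentiable (Q a) x := differentiable_mulmx (dgE a) (dgET a).
have covQ a w : cov (gmx (met S) x w) (- (gmx (met S) x w)^T) w (Q a) x =
   (met S x *m (nE w a)^T) *m (met S x *m (E a x)^T)^T +
   (met S x *m (E a x)^T) *m (met S x *m (nE w a)^T)^T.
  have e1 := cov_mulmx (gmx (met S) x w) 0 (- (gmx (met S) x w)^T) w (dgE a) (dgET a).
  have e2 : cov (gmx (met S) x w) 0 w (fun y => met S y *m (E a y)^T) x = met S x *m (nE w a)^T :=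
    cov_met_tr oD rg Dx w (dE a).
  have e3 := cov_trmx (gmx (met S) x w) 0 w (dgE a); rewrite trmx0 oppr0 e2 in e3.
  by rewrite e2 e3 in e1.
have sgV := smooth_sub V'D (met_smooth rg).
have sgE a := smooth_mulmx oV' sgV (smooth_trmx oV' (sE a)).
have sQ a : smooth_on V' (Q a) := smooth_mulmx oV' (sgE a) (smooth_trmx oV' (sgE a)).
have dsQ : differentiable (fun y => \sum_a Q a y) x :=
  smooth_differentiable oV' (smooth_sum oV' (index_enum _) (P := xpredT) (fun a _ => sQ a)) V'x.
have dX : differentiable X x by exact: differentiableB.
have covX w : cov (gmx (met S) x w) (- (gmx (met S) x w)^T) w X x =
   - \sum_a ((met S x *m (nE w a)^T) *m (met S x *m (E a x)^T)^T +
     (met S x *m (E a x)^T) *m (met S x *m (nE w a)^T)^T).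
  have dN : differentiable (fun y => - \sum_a Q a y) x by exact: differentiableN.
  have e1 := covD (gmx (met S) x w) (- (gmx (met S) x w)^T) w dg dN.
  have e2 := covN (gmx (met S) x w) (- (gmx (met S) x w)^T) w dsQ.
  have e3 := cov_sum (gmx (met S) x w) (- (gmx (met S) x w)^T) w dQ.
  rewrite [LHS]e1 (cov_met oD rg Dx) add0r [LHS]e2 e3; congr (- _).
  by apply: eq_bigr => a _; exact: covQ.
have Hd w v u : dpull (fun v => 'D_v F x) (B x) (ip (met T) (F x)) w v u =
    dm w * (ip (met S) x v u - \sum_a ip (met S) x v (E a x) * ip (met S) x u (E a x))
    - (lam x * lam x) * \sum_a (ip (met S) x v (nE w a) * ip (met S) x u (E a x)
                               + ip (met S) x v (E a x) * ip (met S) x u (nE w a)).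
  rewrite -(dpullE S oV rh oD FV sF Dx) -XE.
  have e1 := cov_near (gmx (met S) x w) (- (gmx (met S) x w)^T) w oV' V'x EJ.
  have e2 := cov_scalemx (gmx (met S) x w) (- (gmx (met S) x w)^T) w dl2 dX.
  rewrite covX in e2; rewrite e1 e2 -/(dm w) mulmxDr mulmxDl [LHS]mxE.
  rewrite -!scalemxAr -!scalemxAl; congr (_ + _); rewrite [LHS]mxE //.
  rewrite -mulrN; congr (_ * _); rewrite mulmxN mulNmx [LHS]mxE; congr (- _).
  rewrite mulmx_sumr mulmx_suml summxE; apply: eq_bigr => a _.
  by rewrite mulmxDr mulmxDl [LHS]mxE !outer_mx /ip !mulmxA.
have := minimal_fibre_tension c (hj Dx) H3 (cp_inner c') (frame_complete oD aS Dx H1 H2 H3)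
  (fun k => etrans (H1 k k) (congr1 (fun b : bool => b%:R) (eqxx k))) ldm Ez EE1 nEE lnE minE Hd.
rewrite -(ten_trace Dx fr') t0 (inner0l (cp_inner c')).
have dmE : dm (xi S x) = 2 * (lam x * 'D_(xi S x) lam x).
  by rewrite mulrA -(derive_sqr_lam cm (xi S x) Dx).
have ed : (e <= d)%N by rewrite ltnS leq_double.
rewrite dmE -natrB ?leq_subr // subKn // => /esym/eqP.
(* The fibres have dimension d - e, so d minus it is e = 2n + 1; the coefficient is nonzero by
   parity. *)
have -> : 1 - 2^-1 * e%:R = 2^-1 * (1 - n.*2%:R) :> R by rewrite -natr1; field.
by rewrite !mulf_eq0 invr_eq0 pnatr_eq0 (negPf lx) subr_eq0 [1 == _]eq_sym (negPf (double_neq1 n)) => /eqP.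
Qed.
End MinimalFibres.
End HorizontallyConformalMaps.

(** * The classes of targets *)

Section ContactForm.
Context {R : realType} {d : nat}.
Variables (S : lacm R d) (U : set 'rV[R]_d).
Hypotheses (oU : open U) (aS : acm_on S U).
Let rg : riemannian_on (met S) U. Proof. by case: aS. Qed.

(* alpha d Omega = d (d eta) = 0 *)
Lemma contact_dOmega (alpha : R) : alpha != 0 ->
  (forall u v y, U y -> deta S (fun=> u) (fun=> v) y = alpha * Om S (fun=> u) (fun=> v) y) ->
  forall x u v w, U x -> dOmega (ip (met S) x) (xnp S x) u v w = 0.
Proof.
move=> a0 H x u v w Ux; have cp := xcp oU aS Ux; have ig := cp_inner cp.
pose et w := etaf S (fun=> w).
have se t : smooth_on U (et t).
  have se0 : smooth_on U (Defs.eta S) by case: aS.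
  by have /(smooth_mxP oU) K := smooth_mulmx oU (smooth_cst oU t) se0; exact: (K 0 0).
have dD t r l : derivable ('D_t (et r)) x l.
  apply: diff_derivable.
  exact: (smooth_fun_differentiable oU (smooth_derivev oU t (se r)) Ux).
(* Constant fields commute, so d eta is an antisymmetrised derivative on them, and d(d eta) = 0
   reduces to Schwarz. *)
have HE t r y : U y -> Om S (fun=> t) (fun=> r) y = (alpha^-1 * 2^-1) * ('D_t (et r) y - 'D_r (et t) y).
  move=> Uy; have := H t r y Uy; rewrite /deta /dird.
  have -> : etaf S (lie_bracket (fun=> t) (fun=> r)) y = 0.
    by rewrite /etaf /lie_bracket !derive_cst subr0 etav0.
  by rewrite subr0 => E; rewrite -mulrA E mulrA mulVf // mul1r.
have DE l t r : 'D_l (Om S (fun=> t) (fun=> r)) x =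
    (alpha^-1 * 2^-1) * ('D_l ('D_t (et r)) x - 'D_l ('D_r (et t)) x).
  rewrite (near_eq_derive l (open_near_eq oU (HE t r) Ux)).
  have [_ K] := is_deriveZ (alpha^-1 * 2^-1) (is_deriveB (derivableP (dD t r l)) (derivableP (dD r t l))).
  exact: K.
rewrite -(dOmE oU aS Ux) /dOm /d_fund.
pose Nb (t r : 'rV[R]_d) := r *m gmx (met S) x t.
have nE t r q : nabla_fund (met S) (phi S) (fun=> t) (fun=> r) (fun=> q) x =
    'D_t (Om S (fun=> r) (fun=> q)) x - ip (met S) x (Nb t r) (xphi S x q)
    + ip (met S) x (Nb t q) (xphi S x r).
  have N a b : nabla (met S) (fun=> a) (fun=> b) x = Nb a b.
    by rewrite nablaE /cov derive_cst mul0mx subr0 add0r.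
  rewrite [LHS](_ : _ = 'D_t (Om S (fun=> r) (fun=> q)) x
     - ip (met S) x (nabla (met S) (fun=> t) (fun=> r) x) (xphi S x q)
     - ip (met S) x r (xphi S x (nabla (met S) (fun=> t) (fun=> q) x))) //.
  by rewrite !N (inner_sym ig (Nb t q)) (cp_gskew cp).
rewrite [LHS](_ : _ = nabla_fund (met S) (phi S) (fun=> u) (fun=> v) (fun=> w) x
  + nabla_fund (met S) (phi S) (fun=> v) (fun=> w) (fun=> u) x
  + nabla_fund (met S) (phi S) (fun=> w) (fun=> u) (fun=> v) x) //.
have Ns a b : Nb a b = Nb b a by exact: (gmx_sym oU rg Ux).
rewrite !nE !DE (Ns v u) (Ns w u) (Ns w v).
rewrite (Schwarz oU v u (se w) Ux) (Schwarz oU w u (se v) Ux) (Schwarz oU w v (se u) Ux).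
move: ('D_u ('D_v (et w)) x) ('D_u ('D_w (et v)) x) ('D_v ('D_w (et u)) x) => t1 t2 t3.
by move: (ip _ _ _ _) (ip _ _ _ _) (ip _ _ _ _) => r1 r2 r3; ring.
Qed.

(** Omega(xi, v) = 0, so d eta = alpha Omega gives the hypothesis of [xi_geodesic]. *)
Lemma contact_geodesic (alpha : R) :
  (forall u v y, U y -> deta S (fun=> u) (fun=> v) y = alpha * Om S (fun=> u) (fun=> v) y) ->
  forall x, U x -> xnz S x (xi S x) = 0.
Proof.
move=> H x Ux; have cp := xcp oU aS Ux; apply: (xi_geodesic cp) => v.
have dc u : differentiable (fun=> u : 'rV[R]_d) x by exact: differentiable_cst.
have := H (xi S x) v x Ux; rewrite (detaE oU aS Ux (dc _) (dc _)) OmE.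
rewrite (inner_sym (cp_inner cp)) (cp_gpz cp) mulr0 => /eqP.
by rewrite mulf_eq0 invr_eq0 pnatr_eq0 => /eqP.
Qed.
End ContactForm.

Section Classes.
Context {R : realType} {m : nat} {M : manifold R m.*2.+1}.
Variable S : acm_structure M.
Variables (i : chart_ix M) (x : 'rV[R]_(m.*2.+1)).
Hypothesis Ix : img i x.
Let oU := img_open (m := M) (i := i).
Let aS := acm_axioms S i.
Let cp := xcp oU aS Ix.
Let sc (v : 'rV[R]_(m.*2.+1)) : smooth_on (img i) (fun=> v) := smooth_cst oU v.
Let dc (v : 'rV[R]_(m.*2.+1)) : differentiable (fun=> v : 'rV[R]_(m.*2.+1)) x := differentiable_cst v x.
Local Notation g := (ip (met (S i)) x).
Local Notation p := (xphi (S i) x).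
Local Notation z := (xi (S i) x).
Local Notation np := (xnp (S i) x).
Local Notation nz := (xnz (S i) x).

(** Every vector at x is the value of a constant field of the chart; on such fields the class
    conditions become pointwise identities. *)
Lemma eta_closed_point : eta_closed S -> forall v w, two_deta g nz v w = 0.
Proof.
move=> H v w; have := H i _ _ (sc v) (sc w) x Ix; rewrite (detaE oU aS Ix (dc v) (dc w)) => /eqP.
by rewrite mulf_eq0 invr_eq0 pnatr_eq0 => /eqP.
Qed.

Lemma Om_closed_point : Om_closed S -> forall u v w, dOmega g np u v w = 0.
Proof.
by move=> H u v w; have := H i _ _ _ (sc u) (sc v) (sc w) x Ix; rewrite (dOmE oU aS Ix).
Qed.

Lemma normal_point : normal_acm S -> nz z = 0.
Proof.
move=> H; apply: (normal_geodesic oU aS Ix) => v.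
exact: (H i _ _ (sc v) (xi_smooth aS) x Ix).
Qed.

Lemma class_B1_point : class_B1 S ->
  forall E, g E z = 0 -> Pquad p np E = 0 /\ xi_trace g p nz E = 0.
Proof.
have nearly : nearly_cosymplectic S -> forall v, np v v = 0.
  by move=> H v; have := H i _ (sc v) x Ix; rewrite (nphiE oU aS Ix _ (dc v)).
case=> [[He Ho _]|[He Ho]|Hn|[[Hn _]|Hq]].
- exact: (almost_cosymplectic_point cp (Om_closed_point Ho) (eta_closed_point He)).
- exact: (almost_cosymplectic_point cp (Om_closed_point Ho) (eta_closed_point He)).
- exact: (nearly_cosymplectic_point cp (nearly Hn)).
- exact: (nearly_cosymplectic_point cp (nearly Hn)).
apply: (quasi_K_cosymplectic_point cp) => v w.
have := Hq i _ _ (sc v) (sc w) x Ix; rewrite (PtenE oU aS Ix (dc v) (dc w)) => ->.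
by rewrite (etafE aS Ix) nablaE.
Qed.

Lemma alpha_contact_point alpha : alpha_contact S alpha -> contact_like g p z np nz.
Proof.
move=> [a0 H].
have K u v y : img i y -> deta (S i) (fun=> u) (fun=> v) y = alpha * Om (S i) (fun=> u) (fun=> v) y.
  by move=> Iy; exact: (H i _ _ (sc u) (sc v) y Iy).
apply: (geodesic_contact_like cp).
  by move=> u v w; exact: (contact_dOmega oU aS a0 K).
exact: (contact_geodesic oU aS K Ix).
Qed.

Lemma class_A_point : class_A1 S \/ class_A4 S -> contact_like g p z np nz.
Proof.
case=> [[[al]|Hq|Hk|[[H _]|[al [H _]]]]|[Hn Ho _]].
- exact: alpha_contact_point.
- apply: (quasi_contact_point cp) => v w.
  have := Hq i _ _ (sc v) (sc w) x Ix; rewrite (PtenE oU aS Ix (dc v) (dc w)) => ->.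
  by rewrite !(etafE aS Ix) (htenE oU aS Ix (dc v)).
- apply: (quasi_K_sasakian_point cp) => v w.
  have := Hk i _ _ (sc v) (sc w) x Ix; rewrite (PtenE oU aS Ix (dc v) (dc w)) => ->.
  by rewrite !(etafE aS Ix) nablaE.
- apply: (@alpha_contact_point 1); split; first exact: oner_neq0.
  by move=> i' X Y sX sY y Iy; rewrite H // mul1r.
- exact: alpha_contact_point H.
- exact: (geodesic_contact_like cp (Om_closed_point Ho) (normal_point Hn)).
Qed.

(** On (xi, E, phi E) the 3-form eta wedge Omega is Omega(E, phi E) = - g(E, E), while d Omega is
    minus the trace of nabla xi over E and phi E: hence the constant 2 beta. *)
Lemma class_B3_point : class_B3 S -> (forall v w, two_deta g nz v w = 0) /\
  exists2 b : R, b != 0 & forall E, g E z = 0 -> xi_trace g p nz E = 2 * b * g E E.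
Proof.
case=> be H; have {H} [[_ b0] Ho He _] : almost_beta_kenmotsu S be by case: H => [|[]|[]].
split; first exact: eta_closed_point.
exists (be (chart_inv i x)) => // E Ez; have ig := cp_inner cp.
have := Ho i _ _ _ (sc z) (sc E) (sc (p E)) x Ix.
rewrite (dOmE oU aS Ix) (xi_trace_dOmega cp Ez).
rewrite [eta_wedge_Om _ _ _ _ _](_ : _ = etaf (S i) (fun=> z) x * Om (S i) (fun=> E) (fun=> p E) x
  + etaf (S i) (fun=> E) x * Om (S i) (fun=> p E) (fun=> z) x
  + etaf (S i) (fun=> p E) x * Om (S i) (fun=> z) (fun=> E) x) //.
rewrite !(etafE aS Ix) !OmE Ez (cp_gpz cp) (cp_zz cp) !mul0r !addr0 mul1r (cp_ppE cp Ez).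
by rewrite (innerNr ig) mulrN => /oppr_inj.
Qed.

Lemma trans_sasakian_map_point wp theta : trans_sasakian S wp theta -> nz z = 0 /\
  forall E, g E z = 0 -> Pquad p np E = (2 * wp (chart_inv i x) * g E E) *: z /\
    xi_trace g p nz E = 2 * theta (chart_inv i x) * g E E.
Proof.
move=> [_ _ _ H _]; apply: (trans_sasakian_point cp) => v w.
have := H i _ _ (sc v) (sc w) x Ix; rewrite (nphiE oU aS Ix _ (dc w)) => ->.
by rewrite !(etafE aS Ix).
Qed.

End Classes.

Section HermitianStructures.
Context {R : realType} {n : nat} {N : manifold R n.*2}.
Variable K : ah_structure N.
Variables (j : chart_ix N) (y : 'rV[R]_(n.*2)).
Hypothesis Iy : img j y.
Let oU := img_open (m := N) (i := j).
Let rg := ah_riemannian K j.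
Let sJ := @ah_smooth _ _ _ K j.
Let sc (v : 'rV[R]_(n.*2)) : smooth_on (img j) (fun=> v) := smooth_cst oU v.
Let dc (v : 'rV[R]_(n.*2)) : differentiable (fun=> v : 'rV[R]_(n.*2)) y := differentiable_cst v y.
Local Notation g := (ah_metric K j).
Local Notation J := (cplx K j).

Lemma hermitian_structure_point : hermitian_point (ip g y) (fun v => v *m J y) (jetn g J y).
Proof.
have ig x (Ix : img j x) := met_inner rg Ix.
have sk x : img j x -> J x *m g x = - (J x *m g x)^T.
  move=> Ix; apply: bilinear_mx_inj => v w.
  have := ah_hermitian K Ix v (w *m J x); rewrite (ah_square K Ix) (innerNr (ig x Ix)) /ip !mulmxA => E.
  rewrite mulmxN mulNmx [RHS]mxE; have := congr1 -%R E; rewrite opprK => ->; congr (- _).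
  by rewrite !trmx_mul (met_sym rg Ix) !mulmxA.
split; [exact: ig| | | |exact: (jetn_linearl g oU sJ Iy)|exact: jetn_linearr| |].
- by move=> a u v; rewrite mulmxDl scalemxAl.
- exact: (ah_square K Iy).
- exact: (ah_hermitian K Iy).
- by move=> v w u; exact: (jetn_skew oU rg sJ Iy v w u sk).
move=> v w; have dJ := smooth_differentiable oU sJ Iy.
have E : forall x, img j x -> J x *m J x = - 1%:M.
  by move=> x Ix; apply: rV_mulmx_inj => u; rewrite mulmxA (ah_square K Ix) mulmxN mulmx1.
have := cov_near (gmx g y v) (gmx g y v) v oU Iy E.
have e1 := cov_mulmx (gmx g y v) (gmx g y v) (gmx g y v) v dJ dJ.
have -> : cov (gmx g y v) (gmx g y v) v (fun=> - 1%:M) y = 0.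
  by rewrite /cov [X in X - _ + _]derive_cst mulmxN mulNmx mulmx1 mul1mx sub0r opprK subrr.
rewrite e1 /jetn; move: (cov _ _ v J y) => C H.
by have := congr1 (mulmx w) H; rewrite mulmxDr mulmx0 !mulmxA addrC.
Qed.

Lemma class_C1_point : class_C1 K -> forall v, Pquad (fun v => v *m J y) (jetn g J y) v = 0.
Proof.
have hp := hermitian_structure_point.
have nE u v : nabla_end g J (fun=> u) (fun=> v) y = jetn g J y u v.
  exact: (nabla_endE g oU sJ Iy (fun=> u) (dc v)).
case=> H.
- by move=> v; rewrite /Pquad -!nE !(H j _ _ (sc _) (sc _) y Iy) addr0.
- by move=> v; rewrite /Pquad -!nE !(H j _ (sc _) y Iy) addr0.
- apply: (almost_kahler_point hp) => u v w.
  by rewrite -(d_fundE oU rg sJ Iy); exact: (H j _ _ _ (sc _) (sc _) (sc _) y Iy).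
apply: (quasi_kahler_point hp) => v; have := H j _ (sc v) y Iy.
have dv : differentiable (appl J (fun=> v)) y.
  exact: (differentiable_mulmx (dc v) (smooth_differentiable oU sJ Iy)).
by rewrite (nabla_endE g oU sJ Iy _ (dc v)) (nabla_endE g oU sJ Iy _ dv).
Qed.
End HermitianStructures.

(** J is injective and phi xi = 0, so f_* xi = 0. Every term on the right of [q_trace] then
    vanishes, and J tau = 0 gives tau = 0. *)
Lemma tension_hermitian_map {R : realType} {m n : nat} {N : manifold R n.*2} (K : ah_structure N)
    (j : chart_ix N) (S : lacm R m.*2.+1) D (F : 'rV[R]_(m.*2.+1) -> 'rV[R]_(n.*2)) (s : R) x :
  class_C1 K -> open D -> acm_on S D ->
  (forall (V : set 'rV[R]_(m.*2.+1)) (e : 'I_m -> _), V `<=` D -> phi_frame S V e ->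
    forall X, smooth_on V X -> forall x, V x -> codiff_Om S e X x = m.*2%:R * etaf S X x) ->
  (forall y, D y -> img j (F y)) -> smooth_on D F -> s * s = 1 ->
  (forall y, D y -> forall v, 'D_(v *m phi S y) F y = s *: ('D_v F y *m cplx K j (F y))) ->
  D x -> tension (met S) (ah_metric K j) F x = 0.
Proof.
move=> C1 oD aS semi FV sF ss hol Dx.
have oV := img_open (m := N) (i := j); have rh := ah_riemannian K j; have sJ := @ah_smooth _ _ _ K j.
have [e' fr] := semi_frame_exists oD aS semi Dx; have [H1 H2 H3 H4] := fr.
have hp := hermitian_structure_point K (FV x Dx).
have hj := map_jet oD aS oV rh oD (fun _ Dy => Dy) FV sF Dx sJ ss hol.
have s0 := s_neq0 hj; have lq := hp_p hp.
have Az0 : 'D_(xi S x) F x = 0.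
  have /esym/eqP := hol x Dx (xi S x); rewrite (xi_phi aS Dx) derive0 scaler_eq0 (negPf s0) => /eqP q0.
  by have := hp_pp hp ('D_(xi S x) F x); rewrite q0 mul0mx => /esym/eqP; rewrite oppr_eq0 => /eqP.
rewrite (tension_frame_trace oD aS oV rh FV sF Dx fr).
have := q_trace (xcp oD aS Dx) lq (hp_npl hp) (hp_npr hp) hj H3.
rewrite H4 (linZ (hj_A hj)) Az0 scaler0 (lin0 (hp_npr hp _)) big1 ?addr0 ?scaler0 ?subr0; last first.
  by move=> k _; exact: (class_C1_point (FV x Dx) C1).
move=> /eqP; rewrite scaler_eq0 (negPf s0) => /eqP q0.
move: (frame_trace _ _ _ _) q0 => t q0.
by have := hp_pp hp t; rewrite q0 mul0mx => /esym/eqP; rewrite oppr_eq0 => /eqP.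
Qed.

(** * From charts to manifolds *)

Lemma derive0_locally_constant_fun {R : realType} {d : nat} (U : set 'rV[R]_d) (u : 'rV[R]_d -> R) x :
  open U -> U x -> (forall y, U y -> differentiable u y) ->
  (forall y v, U y -> 'D_v u y = 0) -> \forall y \near x, u y = u x.
Proof.
move=> oU Ux du u0; pose F y : 'rV[R]_1 := const_mx (u y).
have dF y : U y -> differentiable F y.
  move=> Uy; apply: differentiable_mx => i j.
  by rewrite (_ : (fun _ => _) = u); [exact: du|apply/funext => t; rewrite mxE].
have F0 y v : U y -> 'D_v F y = 0.
  move=> Uy; apply/rowP => j.
  have /is_derive_mxP/(_ 0 j)[_ H] := derivableP (diff_derivable (v := v) (dF y Uy)).
  rewrite -H (_ : (fun _ => _) = u) ?u0 ?mxE //.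
  by apply/funext => t; rewrite mxE.
have := derive0_locally_constant oU Ux dF F0; apply: filterS => y /rowP/(_ 0).
by rewrite !mxE.
Qed.

Lemma acm_sub {R : realType} {d : nat} (S : lacm R d) (U V : set 'rV[R]_d) :
  V `<=` U -> acm_on S U -> acm_on S V.
Proof.
move=> VU [s1 s2 s3 [s4 r] ax]; split; [exact: smooth_sub s1|exact: smooth_sub s2|
  exact: smooth_sub s3|split; [exact: smooth_sub s4|]|] => x /VU; [exact: r|exact: ax].
Qed.

Section Charts.
Context {R : realType} {d e : nat} {M : manifold R d} {N : manifold R e}.
Variable f : M -> N.
Hypothesis sf : smooth_map f.

Lemma map_dom_open i j : open (map_dom f i j).
Proof.
have [cf _] := sf; rewrite openE => x [Ix Jx]; rewrite /interior; apply: filterI.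
  exact: (open_nbhs_nbhs (conj (img_open (i := i)) Ix)).
have c1 := chart_inv_continuous Ix.
have c2 : {for x, continuous (f \o chart_inv i)} by exact: (continuous_comp c1 (cf _)).
by apply: c2; exact: (open_nbhs_nbhs (conj (@Defs.dom_open _ _ N j) Jx)).
Qed.

Lemma map_range i j x : map_dom f i j x -> img j (map_rep f i j x).
Proof. by move=> [_ Jx]; exact: chart_img. Qed.

Lemma map_chart p : exists i j, Defs.dom i p /\ map_dom f i j (chart i p).
Proof.
have [i Ip] := dom_cover p; have [j Jp] := dom_cover (f p); exists i, j; split=> //.
by split; [exact: chart_img|rewrite /= chartK].
Qed.

Lemma map_chart_at i x : img i x -> exists j, map_dom f i j x.
Proof. by move=> Ix; have [j Jx] := dom_cover (f (chart_inv i x)); exists j. Qed.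

Lemma chart_constant (Y : Type) (u : M -> Y) : connected [set: M] ->
  (forall i j x, map_dom f i j x -> \forall y \near x, u (chart_inv i y) = u (chart_inv i x)) ->
  is_constant u.
Proof.
move=> cM H; apply: locally_constant => // p; have [i [j [Ip Dp]]] := map_chart p.
have K := H i j _ Dp; rewrite (chartK Ip) in K.
have n1 : \forall q \near p, Defs.dom i q by exact: (open_nbhs_nbhs (conj (@Defs.dom_open _ _ M i) Ip)).
have n2 : \forall q \near p, u (chart_inv i (chart i q)) = u p by exact: (chart_continuous Ip K).
by apply: filterS2 n1 n2 => q Iq; rewrite (chartK Iq).
Qed.

Lemma derive0_constant : connected [set: M] ->
  (forall i j x, map_dom f i j x -> forall v, 'D_v (map_rep f i j) x = 0) -> is_constant f.
Proof.
move=> cM H; apply: chart_constant => // i j x Dx; have oD := map_dom_open (i := i) (j := j).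
have sF : smooth_on (map_dom f i j) (map_rep f i j) by case: sf => _; exact.
have n1 := derive0_locally_constant oD Dx (fun y Dy => smooth_differentiable oD sF Dy)
  (fun y v Dy => H i j y Dy v).
have n2 : \forall y \near x, map_dom f i j y by exact: (open_nbhs_nbhs (conj oD Dx)).
apply: filterS2 n1 n2 => y E [_ Dy]; have [_ Dx'] := Dx.
have e1 : chart_inv j (map_rep f i j y) = f (chart_inv i y) := chartK Dy.
by rewrite -e1 E; exact: (chartK Dx').
Qed.

Lemma constant_derive0 : is_constant f ->
  forall i j x, map_dom f i j x -> forall v, 'D_v (map_rep f i j) x = 0.
Proof.
move=> cf i j x Dx v; rewrite (_ : map_rep f i j = cst (map_rep f i j x)) ?derive_cst //.
by apply/funext => y; rewrite /map_rep /= (cf (chart_inv i y) (chart_inv i x)).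
Qed.

Lemma chart_constant_fun (u : M -> R) (ur : chart_ix M -> chart_ix N -> 'rV[R]_d -> R) :
  connected [set: M] ->
  (forall i j x, map_dom f i j x -> [/\ u (chart_inv i x) = ur i j x,
     differentiable (ur i j) x & forall v, 'D_v (ur i j) x = 0]) -> is_constant u.
Proof.
move=> cM H; apply: chart_constant => // i j x Dx; have oD := map_dom_open (i := i) (j := j).
have n1 := derive0_locally_constant_fun (u := ur i j) oD Dx
  (fun y Dy => let: And3 _ h _ := H i j y Dy in h) (fun y v Dy => let: And3 _ _ h := H i j y Dy in h v).
have n2 : \forall y \near x, map_dom f i j y by exact: (open_nbhs_nbhs (conj oD Dx)).
apply: filterS2 n1 n2 => y E Dy.
by have [-> _ _] := H i j y Dy; have [-> _ _] := H i j x Dx.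
Qed.

End Charts.

Section ContactGlobal.
Context {R : realType} {m n : nat} {M : manifold R m.*2.+1} {N : manifold R n.*2.+1}.
Variables (SM : acm_structure M) (SN : acm_structure N) (f : M -> N).
Hypotheses (m0 : (0 < m)%N) (cM : connected [set: M]) (semi : almost_semi_sasakian SM).
Hypothesis ch : contact_holomorphic SM SN f.
Let sf : smooth_map f. Proof. by case: ch. Qed.

Lemma chart_contact_map : exists s, forall i j,
  contact_map (SM i) (map_dom f i j) (SN j) (img j) (map_rep f i j) s.
Proof.
have [_ [b H]] := ch; exists ((-1) ^+ b) => i j.
have DI : map_dom f i j `<=` img i by move=> x [].
split; [exact: m0|exact: map_dom_open|exact: (acm_sub DI (acm_axioms SM i))| |
  exact: img_open|exact: acm_axioms|exact: map_range| | |].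
- by move=> V e VD; apply: semi; exact: subset_trans DI.
- by case: sf => _; exact.
- by case: b {H} => /=; rewrite ?expr1 ?expr0 ?mulr1 // mulrNN mulr1.
- by move=> y Dy v; exact: H.
Qed.

Section WithCharts.
Variable s : R.
Hypothesis cms : forall i j, contact_map (SM i) (map_dom f i j) (SN j) (img j) (map_rep f i j) s.
Local Notation lr i j := (lam_rep (SM i) (SN j) (map_rep f i j)).

Lemma chart_semi_frame i j x : map_dom f i j x -> exists V (e : 'I_m -> 'rV[R]_(m.*2.+1) -> _),
  [/\ V `<=` map_dom f i j, V x, phi_frame (SM i) V e & semi_frame (SM i) x (fun k => e k x)].
Proof.
move=> Dx; have cm := cms i j.
have [V [e [VD Vx fr]]] := phi_frame_exists (cm_open cm) (cm_acm cm) (ltnSn m.*2) Dx.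
by exists V, e; split=> //; exact: (semi_frame_of (cm_open cm) (cm_acm cm) (cm_semi cm) VD fr Vx).
Qed.

Lemma lr_differentiable i j x : map_dom f i j x -> differentiable (lr i j) x.
Proof.
move=> Dx; have cm := cms i j.
exact: (lam_rep_differentiable cm Dx).
Qed.

Lemma reeb_factorE lam i j x : reeb_factor SM SN f lam -> map_dom f i j x ->
  lam (chart_inv i x) = lr i j x.
Proof.
move=> [_ H] Dx; have cm := cms i j.
exact: (lam_rep_unique cm Dx (H i j x Dx)).
Qed.

Lemma reeb_derivativeE lam i j x : reeb_factor SM SN f lam -> map_dom f i j x ->
  reeb_derivative SM lam i x = 'D_(xi (SM i) x) (lr i j) x.
Proof.
move=> rl Dx; rewrite /reeb_derivative; apply: near_eq_derive.
have E y : map_dom f i j y -> (lam \o chart_inv i) y = lr i j y by exact: reeb_factorE.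
exact: (open_near_eq (map_dom_open sf (i := i) (j := j)) E Dx).
Qed.

Lemma reeb_factor_constant lam : reeb_factor SM SN f lam ->
  (forall i j x, map_dom f i j x -> forall v, 'D_v (lr i j) x = 0) -> is_constant lam.
Proof.
move=> rl H; apply: (chart_constant_fun sf (ur := fun i j => lr i j) cM) => i j x Dx.
by split; [exact: reeb_factorE|exact: lr_differentiable|exact: H].
Qed.

Lemma contact_like_tension :
  (forall j y, img j y -> contact_like (ip (met (SN j)) y) (xphi (SN j) y) (xi (SN j) y)
     (xnp (SN j) y) (xnz (SN j) y)) ->
  forall i j x, map_dom f i j x -> tension (met (SM i)) (met (SN j)) (map_rep f i j) x =
    'D_(xi (SM i) x) (lr i j) x *: xi (SN j) (map_rep f i j x).
Proof.
move=> H i j x Dx; have cm := cms i j.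
exact: (map_tension_contact_like cm Dx (H j _ (cm_range cm Dx))).
Qed.

Lemma scaled_xi_eq0 i j x (a : R) : map_dom f i j x -> a *: xi (SN j) (map_rep f i j x) = 0 -> a = 0.
Proof.
move=> Dx; have cm := cms i j; have c' := target_cp cm Dx.
move=> /(congr1 (ip (met (SN j)) (map_rep f i j x) ^~ (xi (SN j) (map_rep f i j x)))).
by rewrite (innerZl (cp_inner c')) (cp_zz c') mulr1 (inner0l (cp_inner c')).
Qed.

Lemma geodesic_lam0 : (forall i y, img i y -> xnz (SM i) y (xi (SM i) y) = 0) ->
  (forall j y, img j y -> xnz (SN j) y (xi (SN j) y) = 0) ->
  forall i j x, map_dom f i j x -> forall v, 'D_v (lr i j) x = 0.
Proof.
move=> gM gN i j x Dx v; have cm := cms i j.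
apply: (dlam0 cm) => // y Dy; first by apply: gM; case: Dy.
exact: gN (cm_range cm Dy).
Qed.

Section WeaklyConformal.
Variable mu : M -> R.
Hypothesis wc : conformal_factor (acm_metric SM) (acm_metric SN) f mu.

(** As xi is a unit vector, both sides are the squared length of f_* xi. *)
Lemma conformal_factorE i j x : map_dom f i j x -> mu (chart_inv i x) ^+ 2 = lr i j x ^+ 2.
Proof.
move=> Dx; have cm := cms i j; have [_ H] := wc; have := H i j x Dx (xi (SM i) x) (xi (SM i) x).
have c := xcp (cm_open cm) (cm_acm cm) Dx; rewrite [ip (acm_metric SM i) _ _ _](cp_zz c) mulr1 => <-.
exact: (norm_push_xi cm Dx).
Qed.

Lemma conformal_chart i j y : map_dom f i j y -> forall v w,
  ip (met (SN j)) (map_rep f i j y) ('D_v (map_rep f i j) y) ('D_w (map_rep f i j) y) =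
  lr i j y ^+ 2 * ip (met (SM i)) y v w.
Proof. by move=> Dy v w; rewrite -conformal_factorE //; have [_ H] := wc; exact: H. Qed.

Hypothesis l0 : forall i j x, map_dom f i j x -> forall v, lr i j x * 'D_v (lr i j) x = 0.

(** In charts mu^2 is lambda^2, with derivative 2 lambda d lambda = 0; a nonnegative mu is
    determined by its square. *)
Lemma conformal_factor_constant : is_constant mu.
Proof.
have H : is_constant (fun p => mu p ^+ 2).
  apply: (chart_constant_fun sf (ur := fun i j y => lr i j y ^+ 2) cM) => i j x Dx; split.
  - exact: conformal_factorE.
  - have dl := lr_differentiable Dx.
    exact: (differentiableM dl dl).
  - by move=> v; rewrite (derive_sqr_lam (cms i j)) // -mulrA l0 // mulr0.
move=> p q; have [mu0 _] := wc; have /eqP := H p q.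
by rewrite eqrXn2 // => /eqP.
Qed.

(** At a zero of lambda the hypothesis [l0] says nothing about d lambda. But mu is constant, so one
    zero of lambda makes it vanish on the whole chart domain. *)
Lemma conformal_lam_derive0 i j x : map_dom f i j x -> forall v, 'D_v (lr i j) x = 0.
Proof.
move=> Dx v; have [lx|lx] := eqVneq (lr i j x) 0; last first.
  by have /eqP := l0 Dx v; rewrite mulf_eq0 (negPf lx) => /eqP.
apply: (derive_eq0_near (cms i j)) => // y Dy; apply/eqP; rewrite -sqrf_eq0 -(conformal_factorE Dy).
rewrite (conformal_factor_constant _ (chart_inv i x)) (conformal_factorE Dx).
by rewrite lx expr0n.
Qed.

End WeaklyConformal.
End WithCharts.
End ContactGlobal.

(** E is orthonormal for f^* h = c g, so the tension field is c times the sum of the B(E_a, E_a),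
    which therefore vanishes. The trace to be tested differs from that sum by tangent vectors, the
    images of the nabla E_a. *)
Lemma minimal_immersion_trace {R : realType} {m e : nat} (S : lacm R m.*2.+1) D (T : lacm R e) V
    (F : 'rV[R]_(m.*2.+1) -> 'rV[R]_e) s (c : R) :
  contact_map S D T V F s ->
  (forall y, D y -> forall v w, ip (met T) (F y) ('D_v F y) ('D_w F y) = c * ip (met S) y v w) ->
  forall (V' : set 'rV[R]_(m.*2.+1)) (E : 'I_(m.*2.+1) -> 'rV[R]_(m.*2.+1) -> 'rV[R]_(m.*2.+1)) x z,
  open V' -> V' `<=` D -> (forall a, smooth_on V' (E a)) -> V' x ->
  (forall a b, ip (met T) (F x) (push F (E a) x) (push F (E b) x) = (a == b)%:R) ->
  tension (met S) (met T) F x = 0 ->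
  (forall v, ip (met T) (F x) z ('D_v F x) = 0) ->
  ip (met T) (F x) (\sum_a nabla_along (met T) F (E a) (push F (E a)) x) z = 0.
Proof.
move=> cm conf V' E x z oV' V'D sE V'x orth t0 perp; have Dx := V'D x V'x.
have oD := cm_open cm; have sF := cm_smooth cm; have aS := cm_acm cm; have aT := cm_acmT cm.
have rg : riemannian_on (met S) D by case: aS.
have rh : riemannian_on (met T) V by case: aT.
have oV := cm_openT cm; have FV := cm_range cm; have ih := met_inner rh (FV x Dx).
pose P := rows_mx (E^~ x).
have H : P *m (c *: met S x) *m P^T = 1%:M.
  rewrite -scalemxAr -scalemxAl mulmx_tr_ip; apply/matrixP => a b; rewrite !mxE -conf //.
  exact: orth.
have K : P^T *m P *m (c *: met S x) = 1%:M.
  by rewrite -mulmxA; exact: (mulmx1C H).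
have inv : invmx (met S x) = c *: (P^T *m P).
  rewrite -[RHS](mulmxK (met_unit rg Dx)) -scalemxAl scalemxAr K.
  by rewrite mul1mx.
have ten : tension (met S) (met T) F x = c *: \sum_a jetB S (met T) F x (E a x) (E a x).
  have sB v w : jetB S (met T) F x v w = jetB S (met T) F x w v.
    exact: (jetB_sym oD aS oV rh oD (fun _ Dy => Dy) FV sF Dx).
  have lB v : linear (jetB S (met T) F x v) by exact: jetB_linear.
  have BB v : jetB S (met T) F x v v =
      \sum_i v 0 i *: \sum_j v 0 j *: jetB S (met T) F x (crd i) (crd j).
    have := lin_sum (lB v) (index_enum _) (fun i => v 0 i *: crd i).
    rewrite -rV_sum_coord => ->; apply: eq_bigr => i _; rewrite (linZ (lB v)) sB; congr (_ *: _).
    have := lin_sum (lB (crd i)) (index_enum _) (fun j => v 0 j *: crd j).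
    by rewrite -rV_sum_coord => ->; apply: eq_bigr => j _; rewrite (linZ (lB _)).
  rewrite (tensionE S (met T) oD sF Dx) inv.
  transitivity (\sum_i \sum_j \sum_a
      (c * (E a x 0 i * E a x 0 j)) *: jetB S (met T) F x (crd i) (crd j)).
    apply: eq_bigr => i _; apply: eq_bigr => j _; rewrite -scaler_suml -mulr_sumr; congr (_ *: _).
    by rewrite !mxE; congr (_ * _); apply: eq_bigr => a _; rewrite !mxE.
  rewrite scaler_sumr; under eq_bigr do rewrite exchange_big; rewrite exchange_big /=.
  apply: eq_bigr => a _; rewrite BB scaler_sumr; apply: eq_bigr => i _.
  by rewrite !scaler_sumr; apply: eq_bigr => j _; rewrite !scalerA mulrA.
have c0 : c != 0.
  apply/eqP => c0; have := orth ord0 ord0; rewrite /push conf // c0 mul0r eqxx => /eqP.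
  by rewrite eq_sym oner_eq0.
have {ten} B0 : \sum_a jetB S (met T) F x (E a x) (E a x) = 0.
  by apply/eqP; have /eqP := t0; rewrite ten scaler_eq0 (negPf c0).
have dJ := jacobian_differentiable oD sF Dx.
have N a : nabla_along (met T) F (E a) (push F (E a)) x =
    'D_(cov 0 (gmx (met S) x (E a x)) (E a x) (E a) x) F x + jetB S (met T) F x (E a x) (E a x).
  have pE y : V' y -> push F (E a) y = E a y *m jacobian F y.
    by move=> Vy; rewrite /push (deriveJ oD sF _ (V'D y Vy)).
  have dE := smooth_differentiable oV' (sE a) V'x.
  rewrite /nabla_along gammaE.
  have e1 := cov_near 0 (gmx (met T) (F x) (push F (E a) x)) (E a x) oV' V'x pE.
  have e2 := cov_mulmx 0 (gmx (met S) x (E a x)) (gmx (met T) (F x) (push F (E a) x)) (E a x) dE dJ.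
  have e3 := etrans e1 e2; rewrite /jetB (deriveJ oD sF _ Dx) -[RHS]e3.
  by rewrite [in RHS]/cov mul0mx subr0.
rewrite (eq_bigr _ (fun a _ => N a)) big_split /= B0 addr0 (inner_suml ih) big1 // => a _.
by rewrite (inner_sym ih) perp.
Qed.

(** * The assertions of the theorem, by class of targets *)

Section TheoremParts.
Context {R : realType} {m : nat} {M : manifold R m.*2.+1}.
Variable SM : acm_structure M.
Hypotheses (m0 : (0 < m)%N) (cM : connected [set: M]) (semi : almost_semi_sasakian SM).

Lemma holomorphic_hermitian_harmonic n (N : manifold R n.*2) (K : ah_structure N) (f : M -> N) :
  class_C1 K -> pm_holomorphic SM (cplx K) f -> harmonic_map (acm_metric SM) (ah_metric K) f.
Proof.
move=> C1 [sf [b hol]] i j x Dx; have DI : map_dom f i j `<=` img i by move=> y [].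
apply: (tension_hermitian_map (s := (-1) ^+ b) C1 _ (acm_sub DI (acm_axioms SM i))) Dx.
- exact: map_dom_open.
- by move=> V e VD; apply: semi; exact: subset_trans DI.
- exact: map_range.
- by case: sf => _; exact.
- by case: b {hol} => /=; rewrite ?expr1 ?expr0 ?mulr1 // mulrNN mulr1.
- by move=> y Dy v; exact: hol.
Qed.

Section ContactTarget.
Context {n : nat} {N : manifold R n.*2.+1}.
Variable SN : acm_structure N.
Local Notation charts ch := (chart_contact_map m0 semi ch).
Local Notation lr f i j := (lam_rep (SM i) (SN j) (map_rep f i j)).

Lemma holomorphic_B1_harmonic (f : M -> N) :
  class_B1 SN -> contact_holomorphic SM SN f -> contact_harmonic SM SN f.
Proof.
move=> B1 ch i j x Dx; have [s cms] := charts ch; have cm := cms i j.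
apply: (tension_cosymplectic_map cm) Dx => y Dy.
exact: (class_B1_point (cm_range cm Dy) B1).
Qed.

Lemma holomorphic_B3_constant (f : M -> N) :
  class_B3 SN -> contact_holomorphic SM SN f -> contact_harmonic SM SN f -> is_constant f.
Proof.
move=> B3 ch ha; have [s cms] := charts ch; have [sf _] := ch.
apply: (derive0_constant sf cM) => i j x Dx v; have cm := cms i j.
apply: (kenmotsu_map_constant cm) Dx => y Dy; last exact: ha.
exact: (class_B3_point (cm_range cm Dy) B3).
Qed.

Section ClassA.
Hypothesis cA : class_A1 SN \/ class_A4 SN.

Lemma class_A_tension (f : M -> N) (ch : contact_holomorphic SM SN f) i j x : map_dom f i j x ->
  tension (met (SM i)) (met (SN j)) (map_rep f i j) x =
    'D_(xi (SM i) x) (lr f i j) x *: xi (SN j) (map_rep f i j x).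
Proof.
have [s cms] := charts ch; apply: (contact_like_tension cms) => k y Iy.
exact: (class_A_point Iy cA).
Qed.

Lemma class_A_harmonic (f : M -> N) lam : contact_holomorphic SM SN f ->
  reeb_factor SM SN f lam -> contact_harmonic SM SN f <-> constant_along_xi SM lam.
Proof.
move=> ch rl; have [sf _] := ch; have [s cms] := charts ch; split=> H i.
  move=> x Ix; have [j Dx] := map_chart_at f Ix.
  rewrite (reeb_derivativeE ch cms rl Dx); apply: (scaled_xi_eq0 cms Dx).
  by rewrite -(class_A_tension ch Dx); exact: H.
move=> j x Dx; rewrite [LHS](class_A_tension ch Dx) -(reeb_derivativeE ch cms rl Dx) H ?scale0r //.
by case: Dx.
Qed.

Lemma class_A_conformal (f : M -> N) mu : contact_holomorphic SM SN f ->
  conformal_factor (acm_metric SM) (acm_metric SN) f mu ->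
  [/\ is_constant mu, contact_harmonic SM SN f &
      forall i j x, map_dom f i j x -> forall v, 'D_v (lr f i j) x = 0].
Proof.
move=> ch wc; have [s cms] := charts ch.
have l0 i j x : map_dom f i j x -> forall v, lr f i j x * 'D_v (lr f i j) x = 0.
  move=> Dx; apply: (conformal_contact_like (cms i j)) => //; last exact: class_A_tension.
  by move=> y Dy v w; exact: (conformal_chart cms wc Dy).
have dl := conformal_lam_derive0 cM ch cms wc l0.
split=> [||//]; first exact: (conformal_factor_constant cM ch cms wc l0).
by move=> i j x Dx; rewrite [LHS](class_A_tension ch Dx) dl ?scale0r.
Qed.

Lemma class_A_minimal_image (f : M -> N) mu : contact_holomorphic SM SN f ->
  conformal_factor (acm_metric SM) (acm_metric SN) f mu -> minimal_image (acm_metric SN) f.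
Proof.
move=> ch wc; have [sf _] := ch; have [s cms] := charts ch.
have [mc ha _] := class_A_conformal ch wc; have [mu0 H] := wc.
(* As mu is constant, either it is zero and f_* vanishes, or it is a nonzero number and f is an
   immersion. *)
have [E|/existsNP[p /eqP mp]] := pselect (forall p, mu p = 0).
  left; apply: (derive0_constant sf cM) => i j x Dx v; have cm := cms i j.
  have c' := target_cp cm Dx.
  apply/eqP; rewrite -(inner_eq0 (cp_inner c')); have := H i j x Dx v v.
  by rewrite E expr0n mul0r => <-.
right; split=> [i j x Dx v v0|i j V E oV VD sE orth x Vx z perp].
  have cm := cms i j; have c := xcp (cm_open cm) (cm_acm cm) Dx.
  have c' := target_cp cm Dx.
  apply/eqP; rewrite -(inner_eq0 (cp_inner c)); have := H i j x Dx v v.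
  rewrite v0 [LHS](inner0l (cp_inner c')) (mc _ p) => /esym/eqP.
  by rewrite mulf_eq0 sqrf_eq0 (negPf mp).
apply: (minimal_immersion_trace (c := mu p ^+ 2) (cms i j) _ oV VD sE Vx (orth x Vx) _ perp).
  by move=> y Dy v w; have := H i j y Dy v w; rewrite (mc _ p).
exact: (ha i j x (VD x Vx)).
Qed.

End ClassA.

Lemma normal_lam0 (f : M -> N) : normal_acm SM -> contact_holomorphic SM SN f ->
  (forall j y, img j y -> xnz (SN j) y (xi (SN j) y) = 0) ->
  forall i j x, map_dom f i j x -> forall v, 'D_v (lr f i j) x = 0.
Proof.
move=> nM ch gN; have [s cms] := charts ch; apply: (geodesic_lam0 cms) => //.
by move=> i y Iy; exact: normal_point.
Qed.

Lemma class_A_normal_lam0 (f : M -> N) : class_A1 SN \/ class_A4 SN -> normal_acm SM ->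
  contact_holomorphic SM SN f ->
  forall i j x, map_dom f i j x -> forall v, 'D_v (lr f i j) x = 0.
Proof. by move=> cA nM ch; apply: normal_lam0 => // j y Iy; have [] := class_A_point Iy cA. Qed.

Section TransSasakian.
Variables wp theta : N -> R.
Hypothesis ts : trans_sasakian SN wp theta.

Let tsp i j (f : M -> N) y (Dy : map_dom f i j y) :
  xnz (SN j) (map_rep f i j y) (xi (SN j) (map_rep f i j y)) = 0 /\
  forall E, ip (met (SN j)) (map_rep f i j y) E (xi (SN j) (map_rep f i j y)) = 0 ->
    Pquad (xphi (SN j) (map_rep f i j y)) (xnp (SN j) (map_rep f i j y)) E =
      (2 * (wp \o chart_inv j) (map_rep f i j y) * ip (met (SN j)) (map_rep f i j y) E E)
        *: xi (SN j) (map_rep f i j y) /\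
    xi_trace (ip (met (SN j)) (map_rep f i j y)) (xphi (SN j) (map_rep f i j y))
      (xnz (SN j) (map_rep f i j y)) E =
      2 * (theta \o chart_inv j) (map_rep f i j y) * ip (met (SN j)) (map_rep f i j y) E E.
Proof. exact: (trans_sasakian_map_point (map_range Dy) ts). Qed.

Local Notation th j y := (theta (chart_inv j y)).
Local Notation en f i j e x := (energy (fun v => 'D_v (map_rep f i j) x) e
  (ip (met (SN j)) (map_rep f i j x))).

Lemma trans_codiff (f : M -> N) i j x : map_dom f i j x ->
  codiff_eta (SN j) (map_rep f i j x) = - (2 * n%:R * th j (map_rep f i j x)).
Proof.
move=> Dx; have [_ _ _ _ [_ H]] := ts; have := H j _ (map_range Dx).
have -> : n.*2%:R = 2 * n%:R :> R by rewrite -muln2 natrM mulrC.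
by move=> E; rewrite -[LHS]opprK -E.
Qed.

Lemma trans_harmonic_at (f : M -> N) (ch : contact_holomorphic SM SN f) i j x (e : 'I_m -> _) :
  map_dom f i j x -> semi_frame (SM i) x e ->
  tension (met (SM i)) (met (SN j)) (map_rep f i j) x = 0 <->
  'D_(xi (SM i) x) (lr f i j) x = 2 * th j (map_rep f i j x) * en f i j e x.
Proof.
move=> Dx fr; have [s cms] := charts ch.
exact: (tension_trans_eq0 (cms i j) (fun y Dy => tsp Dy) Dx fr).
Qed.

(** [tension_trans_map] equates 2m lambda with 2 s wp times the energy. *)
Lemma trans_energy_lam (f : M -> N) (ch : contact_holomorphic SM SN f) i j x (e : 'I_m -> _) :
  map_dom f i j x -> semi_frame (SM i) x e -> en f i j e x = 0 -> lr f i j x = 0.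
Proof.
move=> Dx fr E; have [s cms] := charts ch.
have [] := tension_trans_map (cms i j) (fun y Dy => tsp Dy) Dx fr.
rewrite E !mulr0 => /eqP; rewrite mulf_eq0 (negPf (m2_neq0 m0)) => /eqP //.
Qed.

(** For n = 0 the tangent spaces of the target are spanned by gamma, to which f_* e_k is
    orthogonal. *)
Lemma energy_dim1 (f : M -> N) (ch : contact_holomorphic SM SN f) i j x (e : 'I_m -> _) : n = 0%N ->
  map_dom f i j x -> semi_frame (SM i) x e -> en f i j e x = 0.
Proof.
move=> n0 Dx fr; have [s cms] := charts ch; have cm := cms i j.
have c' := target_cp cm Dx; have [_ _ ez _] := fr.
have hj := jet_at cm Dx.
have Az := push_xi cm Dx.
have absurd (k : 'I_n) : False by have := ltn_ord k; rewrite {2}n0.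
apply: (energy0 c') => k.
have := @frame_complete _ _ _ _ _ (cm_openT cm) (cm_acmT cm) (cm_range cm Dx) (fun=> 0) (fun k _ => False_ind _ (absurd k))
  (fun k _ => False_ind _ (absurd k)) (fun k => False_ind _ (absurd k)) ('D_(e k) (map_rep f i j) x).
rewrite big1 ?add0r => [->|l]; last by case: (absurd l).
by rewrite (hAz (xcp (cm_open cm) (cm_acm cm) Dx) hj c' Az) ez mulr0 scale0r.
Qed.

(** Harmonicity means d lambda(xi) = 2 theta times the energy; multiplied by n this is the stated
    equation, since delta sigma = - 2 n theta. *)
Lemma trans_harmonic (f : M -> N) lam : contact_holomorphic SM SN f -> reeb_factor SM SN f lam ->
  contact_harmonic SM SN f <->
  forall i j (V : set 'rV[R]_(m.*2.+1)) (e : 'I_m -> _),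
    V `<=` map_dom f i j -> phi_frame (SM i) V e -> forall x, V x ->
    n%:R * reeb_derivative SM lam i x
    + codiff_eta (SN j) (map_rep f i j x) * frame_energy SN f i j e x = 0.
Proof.
move=> ch rl; have [sf _] := ch; have [s cms] := charts ch; split=> [ha i j V e VD fr x Vx|H i j x Dx].
  have Dx := VD x Vx; have cm := cms i j.
  have sfr := semi_frame_of (cm_open cm) (cm_acm cm) (cm_semi cm) VD fr Vx.
  rewrite (reeb_derivativeE ch cms rl Dx) (trans_codiff Dx).
  rewrite ((trans_harmonic_at ch Dx sfr).1 (ha i j x Dx)) -[frame_energy _ _ _ _ _ _]/(en f i j _ x).
  ring.
have [V [e [VD Vx fr sfr]]] := chart_semi_frame cms Dx.
apply/(trans_harmonic_at ch Dx sfr); have := H i j V e VD fr x Vx.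
rewrite (reeb_derivativeE ch cms rl Dx) (trans_codiff Dx) -[frame_energy _ _ _ _ _ _]/(en f i j _ x) => E.
(* For n = 0 the equation is empty. But then the energy is zero, hence lambda is zero on the whole
   domain, and d lambda(xi) = 0 as well. *)
have [n0|n0] := eqVneq n 0%N.
  rewrite (energy_dim1 ch n0 Dx sfr) mulr0; apply: (derive_eq0_near (cms i j)) => // y Dy.
  have [V' [e2 [_ _ _ sfr']]] := chart_semi_frame cms Dy.
  exact: (trans_energy_lam ch Dy sfr' (energy_dim1 ch n0 Dy sfr')).
have n0' : n%:R != 0 :> R by rewrite pnatr_eq0.
apply: (mulfI n0'); apply/eqP; rewrite -subr_eq0 -E; apply/eqP; ring.
Qed.

Lemma trans_energy0_constant_along_D (f : M -> N) : contact_holomorphic SM SN f ->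
  (forall i j x (e : 'I_m -> _), map_dom f i j x -> semi_frame (SM i) x e -> en f i j e x = 0) ->
  constant_along_D SM f.
Proof.
move=> ch H i j x Dx v vz; have [s cms] := charts ch; have cm := cms i j.
have [V [e [_ _ _ fr]]] := chart_semi_frame cms Dx.
have c' := target_cp cm Dx; have hj := jet_at cm Dx.
have AE := energy_eq0 (cp_p c') hj c' (H i j x _ Dx fr).
apply: (derive_frame0 cm Dx fr) => [k|]; first by have [] := AE k.
by rewrite -(etavE (cm_acm cm) Dx).
Qed.

Lemma constant_along_D_energy (f : M -> N) : contact_holomorphic SM SN f -> constant_along_D SM f ->
  forall i j x (e : 'I_m -> _), map_dom f i j x -> semi_frame (SM i) x e -> en f i j e x = 0.
Proof.
move=> ch cD i j x e Dx [_ _ ez _]; have [s cms] := charts ch; have cm := cms i j.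
apply: (energy0 (target_cp cm Dx)) => k.
by apply: cD => //; rewrite (etavE (cm_acm cm) Dx).
Qed.

Lemma theta_neq0 j y : th j y != 0.
Proof. by have [_ _ [_ t0] _ _] := ts. Qed.

Lemma trans_two_of_three (f : M -> N) lam : contact_holomorphic SM SN f -> reeb_factor SM SN f lam ->
  [/\ contact_harmonic SM SN f -> constant_along_xi SM lam -> constant_along_D SM f,
      contact_harmonic SM SN f -> constant_along_D SM f -> constant_along_xi SM lam &
      constant_along_xi SM lam -> constant_along_D SM f -> contact_harmonic SM SN f].
Proof.
move=> ch rl; have [sf _] := ch; have [s cms] := charts ch; split=> [ha cx|ha cD i x Ix|cx cD i j x Dx].
- apply: (trans_energy0_constant_along_D ch) => i j x e Dx fr.
  have := (trans_harmonic_at ch Dx fr).1 (ha i j x Dx).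
  rewrite -(reeb_derivativeE ch cms rl Dx) cx; last by case: Dx.
  move=> /esym/eqP; rewrite !mulf_eq0 (negPf (theta_neq0 _ _)) pnatr_eq0 => /eqP //.
- have [j Dx] := map_chart_at f Ix; have [V [e [_ _ _ fr]]] := chart_semi_frame cms Dx.
  rewrite (reeb_derivativeE ch cms rl Dx) ((trans_harmonic_at ch Dx fr).1 (ha i j x Dx)).
  by rewrite (constant_along_D_energy ch cD Dx fr) mulr0.
have [V [e [_ _ _ fr]]] := chart_semi_frame cms Dx.
apply/(trans_harmonic_at ch Dx fr); rewrite (constant_along_D_energy ch cD Dx fr) mulr0.
by rewrite -(reeb_derivativeE ch cms rl Dx) cx //; case: Dx.
Qed.

(** [conformal_harmonic] gives lambda d lambda(xi) = 0 and harmonicity gives d lambda(xi) = 2 theta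
    m lambda^2. Together they force lambda^3 = 0, and lambda^2 is the conformal factor squared. *)
Lemma trans_conformal_constant (f : M -> N) : contact_holomorphic SM SN f ->
  weakly_conformal (acm_metric SM) (acm_metric SN) f -> contact_harmonic SM SN f -> is_constant f.
Proof.
move=> ch [mu wc] ha; have [sf _] := ch; have [s cms] := charts ch.
apply: (derive0_constant sf cM) => i j x Dx v; have cm := cms i j.
have conf := fun y Dy => conformal_chart cms wc (i := i) (j := j) (y := y) Dy.
apply: (conformal_derive0 cm conf Dx).
have [V [e [_ _ _ fr]]] := chart_semi_frame cms Dx.
have := (trans_harmonic_at ch Dx fr).1 (ha i j x Dx).
have := conformal_harmonic cm conf Dx (ha i j x Dx) (xi (SM i) x).
rewrite (conformal_energy conf Dx fr) => l0 E; rewrite E in l0; move/eqP: l0.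
have [//|lx] := eqVneq (lr f i j x) 0.
by rewrite !mulf_eq0 (negPf lx) (negPf (theta_neq0 _ _)) !pnatr_eq0 (gtn_eqF m0).
Qed.

Section HorizontallyConformal.
Variable f : M -> N.
Hypothesis ch : contact_holomorphic SM SN f.
Hypothesis hw : horizontally_weakly_conformal (acm_metric SM) (acm_metric SN) f.

Let hwc i j y (Dy : map_dom f i j y) : exists mu : R, [/\ 0 <= mu,
  forall v w, horiz_at (SM i) (map_rep f i j) y v -> horiz_at (SM i) (map_rep f i j) y w ->
    ip (met (SN j)) (map_rep f i j y) ('D_v (map_rep f i j) y) ('D_w (map_rep f i j) y) =
    mu ^+ 2 * ip (met (SM i)) y v w &
  0 < mu -> forall z, exists2 v, horiz_at (SM i) (map_rep f i j) y v & 'D_v (map_rep f i j) y = z].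
Proof.
have [mu [mu0 H]] := hw; have [H1 H2] := H i j y Dy.
exists (mu (chart_inv i y)); split; [exact: mu0|exact: H1|exact: H2].
Qed.

Lemma hwc_harmonic_at i j x : map_dom f i j x ->
  tension (met (SM i)) (met (SN j)) (map_rep f i j) x = 0 <->
  'D_(xi (SM i) x) (lr f i j) x = 2 * n%:R * th j (map_rep f i j x) * lr f i j x ^+ 2.
Proof.
move=> Dx; have [s cms] := charts ch; have [V [e [_ _ _ fr]]] := chart_semi_frame cms Dx.
have K := trans_harmonic_at ch Dx fr; rewrite (hwc_energy (cms i j) (fun y Dy => hwc Dy) Dx fr) in K.
split=> [/K ->|E]; first by ring.
by apply/K; rewrite E; ring.
Qed.

Lemma hwc_harmonic lam : reeb_factor SM SN f lam ->
  contact_harmonic SM SN f <-> forall i j x, map_dom f i j x ->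
    reeb_derivative SM lam i x
    + codiff_eta (SN j) (map_rep f i j x) * lam (chart_inv i x) ^+ 2 = 0.
Proof.
move=> rl; have [s cms] := charts ch; split=> H i j x Dx.
  rewrite (reeb_derivativeE ch cms rl Dx) (trans_codiff Dx) (reeb_factorE cms rl Dx).
  by rewrite ((hwc_harmonic_at Dx).1 (H i j x Dx)); ring.
apply/(hwc_harmonic_at Dx); have := H i j x Dx.
rewrite (reeb_derivativeE ch cms rl Dx) (trans_codiff Dx) (reeb_factorE cms rl Dx) => E.
by apply/eqP; rewrite -subr_eq0 -E; apply/eqP; ring.
Qed.

(** The product n lambda^2 is the energy, so [trans_energy_lam] applies; this covers n = 0, where
    the hypothesis is empty. *)
Lemma hwc_lam_zero i j x : map_dom f i j x -> n%:R * lr f i j x ^+ 2 = 0 -> lr f i j x = 0.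
Proof.
move=> Dx E; have [s cms] := charts ch; have [V [e [_ _ _ fr]]] := chart_semi_frame cms Dx.
apply: (trans_energy_lam ch Dx fr).
by rewrite (hwc_energy (cms i j) (fun y Dy => hwc Dy) Dx fr).
Qed.

(** With d lambda(xi) = 0, [hwc_harmonic_at] reads theta n lambda^2 = 0; hence lambda, and with it
    f_*, is zero everywhere. *)
Lemma hwc_harmonic_constant :
  (forall i j x, map_dom f i j x -> lr f i j x != 0 ->
     tension (met (SM i)) (met (SN j)) (map_rep f i j) x = 0 -> 'D_(xi (SM i) x) (lr f i j) x = 0) ->
  contact_harmonic SM SN f -> is_constant f.
Proof.
move=> H ha; have [sf _] := ch; have [s cms] := charts ch.
apply: (derive0_constant sf cM) => i j x Dx v.
apply: (hwc_derive0 (cms i j) (fun y Dy => hwc Dy) Dx).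
have [//|lx] := eqVneq (lr f i j x) 0; apply: (hwc_lam_zero Dx).
have := (hwc_harmonic_at Dx).1 (ha i j x Dx); rewrite (H i j x Dx lx (ha i j x Dx)).
move=> /esym/eqP; rewrite !mulf_eq0 (negPf (theta_neq0 _ _)) pnatr_eq0 /= orbF.
by move=> /orP[/eqP ->|]; [rewrite mul0r|rewrite (negPf lx)].
Qed.

Lemma hwc_minimal_fibres_constant : (n <= m)%N -> minimal_fibres (acm_metric SM) f ->
  contact_harmonic SM SN f -> is_constant f.
Proof.
move=> nm mf; have [s cms] := charts ch; apply: hwc_harmonic_constant => i j x Dx lx t0.
apply: (minimal_fibres_lam (cms i j) (fun y Dy => hwc Dy) nm _ Dx lx t0) => V r E.
exact: mf.
Qed.

Lemma hwc_normal_constant : normal_acm SM -> contact_harmonic SM SN f -> is_constant f.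
Proof.
move=> nM; have [nN _ _ _ _] := ts; apply: hwc_harmonic_constant => i j x Dx _ _.
by apply: (normal_lam0 nM ch) => // k y Iy; exact: normal_point.
Qed.

Lemma constant_harmonic : is_constant f -> contact_harmonic SM SN f.
Proof.
move=> cf i j x Dx; have [s cms] := charts ch; have cm := cms i j.
have d0 := constant_derive0 cf.
apply/(hwc_harmonic_at Dx).
have l0 y : map_dom f i j y -> lr f i j y = 0.
  move=> Dy; rewrite /lam_rep d0 //.
  exact: (inner0l (cp_inner (target_cp cm Dy))).
by rewrite (derive_eq0_near cm _ l0 Dx) l0 // expr0n mulr0.
Qed.

End HorizontallyConformal.
End TransSasakian.
End ContactTarget.
End TheoremParts.

Theorem theorem4p4 (R : realType) (m : nat) (M : manifold R m.*2.+1)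
    (SM : acm_structure M) :
  (0 < m)%N -> connected [set: M] -> almost_semi_sasakian SM ->
  (* (1) *)
  ((forall (n : nat) (N : manifold R n.*2.+1) (SN : acm_structure N) (f : M -> N),
      class_B1 SN -> contact_holomorphic SM SN f -> contact_harmonic SM SN f) /\
   (forall (n : nat) (N : manifold R n.*2) (K : ah_structure N) (f : M -> N),
      class_C1 K -> pm_holomorphic SM (cplx K) f ->
      harmonic_map (acm_metric SM) (ah_metric K) f)) /\
  (* (2) *)
  (forall (n : nat) (N : manifold R n.*2.+1) (SN : acm_structure N),
     class_B3 SN ->
     ~ exists f : M -> N, [/\ contact_holomorphic SM SN f,
                              contact_harmonic SM SN f & ~ is_constant f]) /\
  (* (3) *)
  (forall (n : nat) (N : manifold R n.*2.+1) (SN : acm_structure N)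
     (wp theta : N -> R), trans_sasakian SN wp theta ->
     (* (i), (ii) *)
     (forall (f : M -> N) (lam : M -> R),
        contact_holomorphic SM SN f -> reeb_factor SM SN f lam ->
        (contact_harmonic SM SN f <->
         forall i j (V : set 'rV[R]_(m.*2.+1)) (e : 'I_m -> _),
           V `<=` map_dom f i j -> phi_frame (SM i) V e -> forall x, V x ->
           n%:R * reeb_derivative SM lam i x
           + codiff_eta (SN j) (map_rep f i j x) * frame_energy SN f i j e x
           = 0) /\
        [/\ contact_harmonic SM SN f -> constant_along_xi SM lam ->
            constant_along_D SM f,
            contact_harmonic SM SN f -> constant_along_D SM f ->
            constant_along_xi SM lam &
            constant_along_xi SM lam -> constant_along_D SM f ->
            contact_harmonic SM SN f]) /\
     (* (iii) *)
     (~ exists f : M -> N,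
          [/\ contact_holomorphic SM SN f,
              weakly_conformal (acm_metric SM) (acm_metric SN) f,
              contact_harmonic SM SN f & ~ is_constant f]) /\
     (* (iv) *)
     ((n < m)%N -> forall f : M -> N, contact_holomorphic SM SN f ->
        horizontally_weakly_conformal (acm_metric SM) (acm_metric SN) f ->
        (forall lam : M -> R, reeb_factor SM SN f lam ->
           (contact_harmonic SM SN f <->
            forall i j x, map_dom f i j x ->
              reeb_derivative SM lam i x
              + codiff_eta (SN j) (map_rep f i j x)
                * lam (chart_inv i x) ^+ 2 = 0) /\
           (contact_harmonic SM SN f ->
            harmonic_morphism (acm_metric SM) (acm_metric SN) f)) /\
        (minimal_fibres (acm_metric SM) f \/ normal_acm SM ->
           (harmonic_morphism (acm_metric SM) (acm_metric SN) f <->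
            is_constant f)))) /\
  (* (4) *)
  (forall (n : nat) (N : manifold R n.*2.+1) (SN : acm_structure N),
     class_A1 SN \/ class_A4 SN ->
     (* (i) *)
     (forall (f : M -> N) (lam : M -> R),
        contact_holomorphic SM SN f -> reeb_factor SM SN f lam ->
        (contact_harmonic SM SN f <-> constant_along_xi SM lam)) /\
     (* (ii) *)
     (normal_acm SM -> forall f : M -> N, contact_holomorphic SM SN f ->
        contact_harmonic SM SN f) /\
     (* (iii) *)
     (forall f : M -> N, contact_holomorphic SM SN f ->
        weakly_conformal (acm_metric SM) (acm_metric SN) f ->
        homothetic (acm_metric SM) (acm_metric SN) f /\
        contact_harmonic SM SN f) /\
     (* (iv) *)
     ((m <= n)%N -> forall (f : M -> N) (lam : M -> R),
        contact_holomorphic SM SN f ->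
        weakly_conformal (acm_metric SM) (acm_metric SN) f ->
        reeb_factor SM SN f lam ->
        [/\ contact_harmonic SM SN f <->
              is_constant lam /\ homothetic (acm_metric SM) (acm_metric SN) f,
            contact_harmonic SM SN f <-> constant_along_xi SM lam &
            [\/ contact_harmonic SM SN f,
                is_constant lam /\ homothetic (acm_metric SM) (acm_metric SN) f |
                constant_along_xi SM lam] ->
              minimal_image (acm_metric SN) f])) /\
  (* the last claim of (4)(ii) *)
  (forall (n : nat) (N : manifold R n.*2.+1) (SN : acm_structure N) (alpha : R),
     semi_sasakian SM -> alpha_sasakian SN alpha ->
     forall f : M -> N, contact_holomorphic SM SN f ->
       contact_harmonic SM SN f /\
       forall lam : M -> R, reeb_factor SM SN f lam -> is_constant lam).
Proof.
move=> m0 cM semi; split; last split; last split; last split.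
- split=> [n N SN f|n N K f]; first exact: holomorphic_B1_harmonic.
  exact: holomorphic_hermitian_harmonic.
- move=> n N SN B3 [f [ch ha nc]]; apply: nc.
  exact: (holomorphic_B3_constant m0 cM semi B3 ch ha).
- move=> n N SN wp theta ts; split; last split.
  + move=> f lam ch rl; split; first exact: (trans_harmonic m0 semi ts ch rl).
    exact: (trans_two_of_three m0 semi ts ch rl).
  + move=> [f [ch wc ha nc]]; apply: nc.
    exact: (trans_conformal_constant m0 cM semi ts ch wc ha).
  + move=> nm f ch hw; split=> [lam rl|H].
      by split=> [|ha]; [exact: (hwc_harmonic m0 semi ts ch hw rl)|split].
    split=> [[ha _]|cf]; last by split=> //; exact: (constant_harmonic m0 semi ts ch hw cf).
    case: H => [mf|nM].
      exact: (hwc_minimal_fibres_constant m0 cM semi ts ch hw (ltnW nm) mf ha).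
    exact: (hwc_normal_constant m0 cM semi ts ch hw nM ha).
- move=> n N SN cA; split; last split; last split.
  + by move=> f lam ch rl; exact: (class_A_harmonic m0 semi cA ch rl).
  + move=> nM f ch i j x Dx; rewrite [LHS](class_A_tension m0 semi cA ch Dx).
    by rewrite (class_A_normal_lam0 m0 semi cA nM ch Dx) scale0r.
  + move=> f ch [mu wc]; have [mc ha _] := class_A_conformal m0 cM semi cA ch wc.
    by split=> //; exists mu.
  move=> mn f lam ch [mu wc] rl; have [mc ha dl] := class_A_conformal m0 cM semi cA ch wc.
  have hH := class_A_harmonic m0 semi cA ch rl.
  have hom : homothetic (acm_metric SM) (acm_metric SN) f by exists mu.
  have [s cms] := chart_contact_map m0 semi ch.
  have lc : is_constant lam := reeb_factor_constant cM ch cms rl dl.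
  (* By (iii) the three conditions all hold, and the image is minimal. *)
  by split=> // _; exact: (class_A_minimal_image m0 cM semi cA ch wc).
move=> n N SN alpha [_ nM] [ac nN] f ch.
have cA : class_A1 SN \/ class_A4 SN by left; apply: Or41; exists alpha.
have dl := class_A_normal_lam0 m0 semi cA nM ch; split=> [i j x Dx|lam rl].
  by rewrite [LHS](class_A_tension m0 semi cA ch Dx) dl // scale0r.
have [s cms] := chart_contact_map m0 semi ch.
exact: (reeb_factor_constant cM ch cms rl dl).
Qed.
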